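(* Let $d\ge2$, $\kappa\in\mathbb R$, $k\in\{0,\ldots,d-1\}$ and $\ell\in(0,\infty)$, and suppose that the regular crosspolytope $\Diamond_\ell^d(\kappa)$ of geodesic edge length $\ell$ exists. Put $C:=C_\kappa(\ell)$, where $C_\kappa(\ell)=\cosh(\sqrt{-\kappa}\,\ell)$ if $\kappa<0$, $C_\kappa(\ell)=1$ if $\kappa=0$, and $C_\kappa(\ell)=\cos(\sqrt\kappa\,\ell)$ if $\kappa>0$. Let $\xi\sim\mathrm N(0,1)$ be a standard normal random variable and let $F$ be a $k$-dimensional face of $\Diamond_\ell^d(\kappa)$. Then $$\gamma_\kappa\bigl(F,\Diamond_\ell^d(\kappa)\bigr)=\frac12\,\mathbb E\left[\left(2\Phi\left(\sqrt{\frac{C}{1+kC}}\,|\xi|\right)-1\right)^{d-k-1}\right],$$ $$\beta_\kappa\bigl(F,\Diamond_\ell^d(\kappa)\bigr)=\frac12-\frac{2^{d-k-1}}{\sqrt{2\pi}}\,\mathbb E\left[\frac1\xi\,\operatorname{Im}\left[\Phi\left(\mathrm i\sqrt{\frac{C}{1+(d-1)C}}\,\xi\right)^{d-k-1}\right]\right],$$ where in the second formula the integrand at $\xi=0$ is understood by continuous extension. If $\kappa<0$, the corresponding formulas for faces of positive dimension of the ideal regular crosspolytope $\Diamond^d_\infty(\kappa)$ are obtained by letting $C\to\infty$, i.e. for $k\in\{1,\ldots,d-1\}$ by replacing $\frac{C}{1+kC}$ by $\frac1k$ and $\frac{C}{1+(d-1)C}$ by $\frac1{d-1}$.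
   Context: Klein model. $\mathbb B^d(\kappa):=\mathbb R^d$ if $\kappa\ge0$ and $\mathbb B^d(\kappa):=\{x\in\mathbb R^d:\|x\|<1/\sqrt{-\kappa}\}$ if $\kappa<0$; $\bar{\mathbb B}^d(\kappa)$ is its Euclidean closure. The tangent space at $x\in\mathbb B^d(\kappa)$ is identified with $\mathbb R^d$ and carries the inner product $$g_x(u,v)=\frac{\langle u,v\rangle}{1+\kappa\|x\|^2}-\frac{\kappa\langle x,u\rangle\langle x,v\rangle}{(1+\kappa\|x\|^2)^2}.$$ The geodesic distance is $\rho_\kappa(x,y)=\|x-y\|$ for $\kappa=0$, and, with $q=\frac{1+\kappa\langle x,y\rangle}{\sqrt{(1+\kappa\|x\|^2)(1+\kappa\|y\|^2)}}$, it is $\frac1{\sqrt\kappa}\arccos q$ for $\kappa>0$ and $\frac1{\sqrt{-\kappa}}\operatorname{arcosh} q$ for $\kappa<0$. Polytopes and angles. A polytope is the Euclidean convex hull of finitely many points of $\bar{\mathbb B}^d(\kappa)$; (nonempty) faces, relative interiors and dimensions are Euclidean. Let $P=\{y:\langle a_r,y\rangle\le b_r,\ r=1,\ldots,m\}$ be a full-dimensional polytope with irredundant inequalities ($a_r\neq 0$), $F\ne P$ a face, and $I(F)=\{r:\langle a_r,y\rangle=b_r\ \forall y\in F\}$. For $x\in\operatorname{relint}(F)\cap\mathbb B^d(\kappa)$ put $T_x(F,P)=\{u\in\mathbb R^d:\langle a_r,u\rangle\le0\ \forall r\in I(F)\}$ and $N_x(F,P)=\{v\in\mathbb R^d: g_x(v,u)\le0\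 \forall u\in T_x(F,P)\}$. For a polyhedral cone $K$ in $(\mathbb R^d,g_x)$ with linear hull $L$, its solid angle $\alpha_x(K)$ is the ratio of the $(\dim L)$-dimensional volume of $K\cap B$ to that of $L\cap B$, where $B$ is the unit ball and volume is taken with respect to $g_x$ ($\alpha_x(\{0\})=1$). The internal angle is $\beta_\kappa(F,P):=\alpha_x(T_x(F,P))$ and the external angle is $\gamma_\kappa(F,P):=\alpha_x(N_x(F,P))$; they do not depend on the choice of $x$. Regular crosspolytopes. $\Diamond_\ell^d(\kappa)=\operatorname{conv}\{\pm e_1/\tau,\ldots,\pm e_d/\tau\}\subseteq\mathbb B^d(\kappa)$, $\tau>0$, is the crosspolytope (centred at the origin; $e_1,\dots,e_d$ is the standard basis) whose adjacent vertices have geodesic distance $\ell$. For $\kappa<0$, the ideal regular crosspolytope is $\Diamond_\infty^d(\kappa)=\operatorname{conv}\{\pm e_1/\sqrt{-\kappa},\ldots,\pm e_d/\sqrt{-\kappa}\}$. $\Phi$ is the entire function $\Phi(z)=\frac12+\frac1{\sqrt{2\pi}}\int_0^z e^{-t^2/2}\,dt$, $z\in\mathbb C$, and $\mathrm i=\sqrt{-1}$. *)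

(* Defs.v *)
From HB Require Import structures.
From mathcomp Require Import all_boot all_order all_algebra.
From mathcomp Require Import all_classical all_reals all_analysis.
From mathcomp Require Export complex.

Set Implicit Arguments.
Unset Strict Implicit.
Unset Printing Implicit Defensive.

Import Order.TTheory GRing.Theory Num.Theory.
Import numFieldNormedType.Exports.
Local Open Scope classical_set_scope.
Local Open Scope ring_scope.

Section EuclideanGeometry.
Context {R : realType} {d : nat}.
Implicit Types (x y u v : 'rV[R]_d) (A F P K : set 'rV[R]_d).

Definition dotp u v : R := \sum_(i < d) u 0 i * v 0 i.

(* The norm that the library puts on 'rV[R]_d is the sup norm. *)
Definition enorm u : R := Num.sqrt (dotp u u).

Definition convex_hull (I : finType) (p : I -> 'rV[R]_d) : set 'rV[R]_d :=
  [set y | exists2 w : I -> R, (forall i, 0 <= w i) /\ \sum_i w i = 1 &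
           y = \sum_i w i *: p i].

Definition segment x y : set 'rV[R]_d :=
  convex_hull (fun b : bool => if b then x else y).

(* The least linear subspace containing A; it exists and is unique. *)
Definition lin_hull A : {vspace 'rV[R]_d} :=
  xget 0%VS [set L : {vspace 'rV[R]_d} |
    (forall x, A x -> x \in L) /\
    (forall M : {vspace 'rV[R]_d}, (forall x, A x -> x \in M) -> (L <= M)%VS)].

Definition direction A : {vspace 'rV[R]_d} :=
  lin_hull [set x - y | x in A & y in A].

Definition affine_dim A : nat := \dim (direction A).

Definition relint A : set 'rV[R]_d :=
  [set x | A x /\ exists2 e : R, 0 < e &
     forall y, y - x \in direction A -> enorm (y - x) < e -> A y].

(* Nonempty faces, cut out by supporting hyperplanes; a = 0, b = 0 gives P. *)
Definition is_face P F : Prop :=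
  F !=set0 /\ exists (a : 'rV[R]_d) (b : R),
    (forall y, P y -> dotp a y <= b) /\ F = P `&` [set y | dotp a y = b].

Definition adjacent P x y : Prop := x <> y /\ is_face P (segment x y).

Definition irredundant_description P (m : nat)
    (a : 'I_m -> 'rV[R]_d) (b : 'I_m -> R) : Prop :=
  [/\ affine_dim P = d,
      P = [set y | forall r, dotp (a r) y <= b r],
      forall r, a r <> 0 &
      forall r, exists2 y, (forall s, s <> r -> dotp (a s) y <= b s) &
                           b r < dotp (a r) y].

End EuclideanGeometry.

(* n-dimensional Lebesgue measure, as the iterated product of n copies of the
   one-dimensional one (unfolding the library's product_measure1). *)
Fixpoint lebesgue_n (R : realType) (n : nat) : set (n.-tuple R) -> \bar R :=
  match n with
  | 0 => fun A => (\1_A [tuple])%:E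
  | n'.+1 => fun A =>
      (\int[lebesgue_measure]_x lebesgue_n [set t | A (cons_tuple x t)])%E
  end.

Section KleinModel.
Context {R : realType} {d : nat}.
Implicit Types (kappa : R) (x y u v : 'rV[R]_d) (F P K : set 'rV[R]_d).

Definition klein_ball kappa : set 'rV[R]_d :=
  if 0 <= kappa then setT else [set x | enorm x < 1 / Num.sqrt (- kappa)].

Definition klein_metric kappa x u v : R :=
  dotp u v / (1 + kappa * enorm x ^+ 2)
  - kappa * dotp x u * dotp x v / (1 + kappa * enorm x ^+ 2) ^+ 2.

Definition arcosh (q : R) : R := ln (q + Num.sqrt (q ^+ 2 - 1)).

Definition klein_dist kappa x y : R :=
  let q := (1 + kappa * dotp x y) /
           Num.sqrt ((1 + kappa * enorm x ^+ 2) * (1 + kappa * enorm y ^+ 2)) in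
  if kappa == 0 then enorm (x - y)
  else if 0 < kappa then (Num.sqrt kappa)^-1 * acos q
  else (Num.sqrt (- kappa))^-1 * arcosh q.

Definition unit_gball kappa x : set 'rV[R]_d :=
  [set u | klein_metric kappa x u u <= 1].

(* (\dim L)-dimensional volume with respect to g_x of S inside L: Lebesgue
   measure in the coordinates of a basis of L, times the square root of the
   Gram determinant of that basis. *)
Definition gvolume kappa x (L : {vspace 'rV[R]_d}) (S : set 'rV[R]_d) : \bar R :=
  ((Num.sqrt (\det (\matrix_(i < \dim L, j < \dim L)
      klein_metric kappa x (vbasis L)`_i (vbasis L)`_j)))%:E
   * lebesgue_n [set c : (\dim L).-tuple R |
       S (\sum_(i < \dim L) tnth c i *: (vbasis L)`_i)]%R)%E.

Definition solid_angle kappa x K : R :=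
  fine (gvolume kappa x (lin_hull K) (K `&` unit_gball kappa x)) /
  fine (gvolume kappa x (lin_hull K)
          ([set u | u \in lin_hull K] `&` unit_gball kappa x)).

Definition tangent_cone m (a : 'I_m -> 'rV[R]_d) (b : 'I_m -> R) F :
    set 'rV[R]_d :=
  [set u | forall r, (forall y, F y -> dotp (a r) y = b r) ->
           dotp (a r) u <= 0].

Definition normal_cone kappa x m (a : 'I_m -> 'rV[R]_d) (b : 'I_m -> R) F :
    set 'rV[R]_d :=
  [set v | forall u, tangent_cone a b F u -> klein_metric kappa x v u <= 0].

(* The angles depend neither on the description of P nor on x; an equation
   [internal_angle kappa F P = t] with t != 0 asserts that some choice is
   possible, and it is provable only if the chosen value is known to be t. *)
Definition internal_angle kappa F P : R :=
  xget 0 [set t | exists m (a : 'I_m -> 'rV[R]_d) (b : 'I_m -> R) x,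
    [/\ irredundant_description P a b, (relint F `&` klein_ball kappa) x &
        t = solid_angle kappa x (tangent_cone a b F)]].

Definition external_angle kappa F P : R :=
  xget 0 [set t | exists m (a : 'I_m -> 'rV[R]_d) (b : 'I_m -> R) x,
    [/\ irredundant_description P a b, (relint F `&` klein_ball kappa) x &
        t = solid_angle kappa x (normal_cone kappa x a b F)]].

End KleinModel.

Definition crosspolytope {R : realType} (d : nat) (tau : R) : set 'rV[R]_d :=
  convex_hull (fun p : 'I_d * bool =>
    ((-1) ^+ p.2 / tau) *: (delta_mx 0 p.1 : 'rV[R]_d)).
Arguments crosspolytope {R} d tau.

Definition is_regular_crosspolytope {R : realType} (d : nat) (kappa ell : R)
    (P : set 'rV[R]_d) : Prop :=
  exists tau : R,
    [/\ 0 < tau, P = crosspolytope d tau, P `<=` klein_ball kappa &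
        forall v w, adjacent P v w -> klein_dist kappa v w = ell].

Definition ideal_crosspolytope {R : realType} (d : nat) (kappa : R) :
    set 'rV[R]_d :=
  crosspolytope d (Num.sqrt (- kappa)).
Arguments ideal_crosspolytope {R} d kappa.

Definition Ckappa {R : realType} (kappa ell : R) : R :=
  if kappa < 0 then
    (expR (Num.sqrt (- kappa) * ell) + expR (- (Num.sqrt (- kappa) * ell))) / 2
  else if kappa == 0 then 1
  else cos (Num.sqrt kappa * ell).

Section Phi.
Context {R : realType}.

Definition cexp (z : R[i]) : R[i] :=
  ((expR (complex.Re z) * cos (complex.Im z)) +i*
   (expR (complex.Re z) * sin (complex.Im z)))%C.

(* The integral of exp(-t^2/2) from 0 to z, taken along the segment t = s z. *)
Definition Phi (z : R[i]) : R[i] :=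
  let f (s : R) : R[i] := z * cexp (- (s%:C%C * z) ^+ 2 / 2) in
  2^-1 + ((Num.sqrt (2 * pi))^-1)%:C%C *
    ((\int[lebesgue_measure]_(s in `[0, 1]) complex.Re (f s)) +i*
     (\int[lebesgue_measure]_(s in `[0, 1]) complex.Im (f s)))%C.

Definition extend_at0 (f : R -> R) (x : R) : R :=
  if x == 0 then lim (f y @[y --> 0^']) else f x.

End Phi.

(* Main.v *)
Require Import Defs.
From HB Require Import structures.
From mathcomp Require Import all_boot all_order all_algebra.
From mathcomp Require Import all_classical all_reals all_analysis measurable_realfun.
From mathcomp Require Import ring lra.
Import Order.TTheory GRing.Theory Num.Theory.
Import numFieldNormedType.Exports.
Local Open Scope classical_set_scope.
Local Open Scope ring_scope.

(** Let [s] be the sign vector of the face [F], supported on [k + 1] coordinates.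
    At every point [x] of [relint F] the tangent cone is
    [{u | \sum_(s_j = 0) |u_j| + <s, u> <= 0}]. The functionals [<s, .>] and
    [u_j] with [s_j = 0] are orthogonal for the metric dual to [g_x], so that in
    suitable orthonormal coordinates [t, y_1, ..., y_n] with [n = d - k - 1] the
    tangent cone becomes [|y_1| + ... + |y_n| <= - t / sigma] and the normal cone
    [|y_j| <= sigma t], where [sigma ^ 2 = tau ^ 2 / ((k + 1) tau ^ 2 + kappa)]
    equals [C / (1 + k C)].

    A solid angle is the standard Gaussian measure of the cone. For the normal cone
    this is the first expectation. For the tangent cone it is the probability that
    [xi_0 / sigma + |xi_1| + ... + |xi_n| <= 0], and Gil-Pelaez inversion of the
    characteristic function of that sum, in which [|xi|] contributes
    [2 exp(- t ^ 2 / 2) Phi (i t)], gives the second one after rescaling [t] by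
    [(1 / sigma ^ 2 + n) ^ (- 1 / 2)]. *)

Set Implicit Arguments.
Unset Strict Implicit.
Unset Printing Implicit Defensive.

(** * Iterated Lebesgue integrals along vectors *)

(** The volume in the definition of a solid angle refers to an unspecified basis of the linear hull.
    Only a ratio of volumes matters, so the Gram factor and the Jacobian of a change of basis need
    only be positive constants common to numerator and denominator. Steinitz exchange provides such
    a constant without a determinant formula for integrals. The radial constant relating volume to
    Gaussian measure cancels likewise.

    Independence of [x] rests on two facts valid on all of [F]: [<s, x> = 1 / tau], and [x_j = 0]
    where [s_j = 0]. They make the dual norms of [<s, .>] and [u_j] share the same factor depending
    on [x], and only their ratio [1 / sigma] enters the cones.

    The inversion formula is not derived for general laws: the case [n = 0] is a Gaussian tail, and
    each further [|xi_j|] is averaged in by Fubini.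

    Regular and ideal crosspolytopes are covered by the single condition
    [(k + 1) tau ^ 2 + kappa > 0], which says that the barycentre of the face lies in the ball. The
    ideal case is [kappa = - tau ^ 2] with [k >= 1]; no limit in [C] is taken. *)

Section LebesgueAffine.
Context {R : realType}.
Local Notation mu := (@lebesgue_measure R).
Implicit Types (f : R -> \bar R).

Let rshift (a : R) : measurableTypeR R -> measurableTypeR R := fun x => x + a.
Let measurable_rshift a : measurable_fun setT (rshift a).
Proof. exact: measurable_funD. Qed.
HB.instance Definition _ a := isMeasurableFun.Build _ _ _ _ (rshift a) (measurable_rshift a).

(** The image of Lebesgue measure under a translation gives half-open intervals their length, hence
    equals Lebesgue measure. *)
Lemma ge0_integral_shift (a : R) f : measurable_fun setT f ->
  (forall x, 0 <= f x)%E ->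
  (\int[mu]_x f (x + a)%R = \int[mu]_x f x)%E.
Proof.
move=> mf f0.
transitivity (\int[pushforward mu (rshift a)]_x f x)%E.
  by rewrite ge0_integral_pushforward// => ? _; exact: f0.
apply: eq_measure_integral => A mA _; apply/esym.
apply: (@lebesgue_measure_unique _ (pushforward mu (rshift a))) => //.
move=> _ [[x y] _ <-]; rewrite /= /pushforward /=.
rewrite (_ : _ @^-1` _ = `]x - a, y - a]%classic).
  by rewrite !lebesgue_measure_itv/= !lte_fin ltrD2r; case: ifP => // _;
   rewrite -!EFinB; congr EFin; ring.
by apply/seteqP; split => z /=; rewrite !in_itv/= ltrBlDr lerBrDr.
Qed.

Let rscale (k : R) : measurableTypeR R -> measurableTypeR R := fun x => k * x.
Let measurable_rscale k : measurable_fun setT (rscale k).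
Proof. exact: measurable_funM. Qed.
HB.instance Definition _ a := isMeasurableFun.Build _ _ _ _ (rscale a) (measurable_rscale a).

(** The image of Lebesgue measure under [x |-> k * x], multiplied by [|k|], agrees with Lebesgue
    measure on half-open intervals. For [k < 0] their preimages are closed on the other side, which
    does not change the length. *)
Lemma ge0_integral_scale (k : R) f : k != 0 -> measurable_fun setT f ->
  (forall x, 0 <= f x)%E ->
  (\int[mu]_x f (k * x)%R = (`|k|^-1)%:E * \int[mu]_x f x)%E.
Proof.
move=> k0 mf f0.
transitivity (\int[pushforward mu (rscale k)]_x f x)%E.
  by rewrite ge0_integral_pushforward// => ? _; exact: f0.
have nk0 : 0 <= `|k| by [].
have [nu [nuE nuI]] : exists nu : {measure set (measurableTypeR R) -> \bar R},
    (forall A, nu A = `|k|%:E * mu (rscale k @^-1` A))%E /\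
    (\int[nu]_x f x = `|k|%:E * \int[pushforward mu (rscale k)]_x f x)%E.
  unshelve eexists (mscale (NngNum nk0) (pushforward mu (rscale k))); first exact: measurable_rscale.
  by split => //; rewrite ge0_integral_mscale.
have -> : (\int[mu]_x f x = \int[nu]_x f x)%E.
  apply: eq_measure_integral => A mA _.
  apply: (@lebesgue_measure_unique _ nu) => //.
  move=> _ [[x y] _ <-]; rewrite nuE /=.
  rewrite lebesgue_measure_itv/= lte_fin.
  have [kp|kn] := ltP 0 k.
    rewrite (_ : _ @^-1` _ = `]x / k, y / k]%classic); last first.
      by apply/seteqP; split => z /=; rewrite !in_itv/= ltr_pdivrMr// ler_pdivlMr// mulrC.
    rewrite lebesgue_measure_itv/= lte_fin ltr_pM2r ?invr_gt0//; case: ifP => _; last by rewrite mule0.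
    by rewrite -!EFinB -EFinM gtr0_norm//; congr EFin; field.
  have {}kn : k < 0 by rewrite lt_neqAle k0.
  rewrite (_ : _ @^-1` _ = `[y / k, x / k[%classic); last first.
    by apply/seteqP; split => z /=; rewrite !in_itv/= ltr_ndivlMr// ler_ndivrMr// mulrC andbC.
  rewrite lebesgue_measure_itv/= lte_fin ltr_nM2r ?invr_lt0//; case: ifP => _; last by rewrite mule0.
  by rewrite -!EFinB -EFinM ltr0_norm//; congr EFin; field.
rewrite nuI muleA -EFinM mulVf ?mul1e//.
by rewrite normr_eq0.
Qed.

End LebesgueAffine.

Section IteratedIntegral.
Context {R : realType} {d : nat}.
Local Notation mu := (@lebesgue_measure R).
Local Notation V := 'rV[R]_d.
Implicit Types (f : V -> \bar R) (v w b : V) (bs : seq V).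

(** Measurability is tested on coordinatewise measurable maps from arbitrary spaces. Thus [V] needs
    no sigma-algebra, and the notion applies at once to maps such as [(t, x) |-> g t + x *: b] on a
    product, as Tonelli requires. *)
Definition borel_fun f := forall disp (T : measurableType disp) (g : T -> V),
  (forall i, measurable_fun setT (fun t => g t 0 i)) ->
  measurable_fun setT (fun t => f (g t)).

(* The integral of [f] over [v + <<bs>>] in the coordinates [bs], which need
   not be orthonormal (nor free). *)
Fixpoint iter_int bs f v : \bar R :=
  if bs is b :: bs' then (\int[mu]_x iter_int bs' f (v + x *: b)%R)%E else f v.

Lemma iter_int_ge0 bs f v : (forall u, 0 <= f u)%E -> (0 <= iter_int bs f v)%E.
Proof.
move=> f0; elim: bs v => [//|b bs IH] v /=.
by apply: integral_ge0 => x _; exact: IH.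
Qed.

Lemma measurable_coord_line disp (T : measurableType disp) (g : T -> V) b i :
  (forall i, measurable_fun setT (fun t => g t 0 i)) ->
  measurable_fun setT (fun p : T * measurableTypeR R => (g p.1 + p.2 *: b) 0 i).
Proof.
move=> mg; under eq_fun do rewrite !mxE.
apply: measurable_funD; first exact: (measurableT_comp (mg i)).
exact: measurable_funM.
Qed.

Lemma borel_iter_int bs f : borel_fun f -> (forall u, 0 <= f u)%E ->
  borel_fun (iter_int bs f).
Proof.
move=> mf f0; elim: bs => [//|b bs IH] disp T g mg /=.
apply: (measurable_fun_fubini_tonelli_F (m2 := mu)
  (fun p : T * measurableTypeR R => iter_int bs f (g p.1 + p.2 *: b))).
  by apply: IH => i; exact: measurable_coord_line.
by move=> p; exact: iter_int_ge0.
Qed.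

Lemma measurable_iter_int_line bs f v b : borel_fun f -> (forall u, 0 <= f u)%E ->
  measurable_fun setT (fun x : measurableTypeR R => iter_int bs f (v + x *: b)).
Proof.
move=> mf f0; apply: borel_iter_int => // i.
under eq_fun do rewrite !mxE.
apply: measurable_funD => //.
exact: measurable_funM.
Qed.

Lemma eq_iter_int bs f1 f2 v : f1 =1 f2 -> iter_int bs f1 v = iter_int bs f2 v.
Proof. by move=> /funext ->. Qed.

Lemma iter_int_swap b1 b2 bs f v : borel_fun f -> (forall u, 0 <= f u)%E ->
  iter_int (b1 :: b2 :: bs) f v = iter_int (b2 :: b1 :: bs) f v.
Proof.
move=> mf f0 /=.
have := @fubini_tonelli _ _ _ _ R mu mu
  (fun p : measurableTypeR R * measurableTypeR R =>
     iter_int bs f (v + p.1 *: b1 + p.2 *: b2)) _ _.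
rewrite /= => ->.
- by under eq_integral do under eq_integral do rewrite addrAC.
- apply: (@borel_iter_int bs f mf f0) => i.
  under eq_fun do rewrite !mxE.
  apply: measurable_funD; last exact: measurable_funM.
  by apply: measurable_funD; last exact: measurable_funM.
- by move=> p; exact: iter_int_ge0.
Qed.

Lemma iter_int_perm bs1 bs2 f v : borel_fun f -> (forall u, 0 <= f u)%E ->
  perm_eq bs1 bs2 -> iter_int bs1 f v = iter_int bs2 f v.
Proof.
move=> mf f0.
elim: bs1 bs2 v => [|b bs1 IH] bs2 v.
  by move=> /perm_size/esym/size0nil ->.
move=> pe; have bbs2 : b \in bs2 by rewrite -(perm_mem pe) mem_head.
move: pe; case/splitPr: bbs2 => l r.
rewrite perm_sym -cat1s perm_catCA /= perm_cons perm_sym => /IH IHb.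
transitivity (iter_int (b :: l ++ r) f v).
  by rewrite /=; apply: eq_integral => x _; rewrite IHb.
elim: l v {IHb} => [//|c l IHl] v.
rewrite [RHS]/= -[RHS]/(iter_int (c :: (l ++ b :: r)) f v).
by rewrite cat_cons iter_int_swap//=; apply: eq_integral => x _; exact: IHl.
Qed.

(** With [b] permuted to the outermost place, this is translation invariance in one real
    variable. *)
Lemma iter_int_shift_mem bs f v b k : borel_fun f -> (forall u, 0 <= f u)%E ->
  b \in bs -> iter_int bs f (v + k *: b) = iter_int bs f v.
Proof.
move=> mf f0 /perm_to_rem pe.
rewrite !(iter_int_perm _ mf f0 pe) /=.
rewrite -[RHS](@ge0_integral_shift R k); last 2 first.
  exact: measurable_iter_int_line.
  by move=> x; exact: iter_int_ge0.
by apply: eq_integral => x _; rewrite scalerDl (addrC (x *: b)) addrA.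
Qed.

Lemma iter_int_shift bs f v w : borel_fun f -> (forall u, 0 <= f u)%E ->
  w \in <<bs>>%VS -> iter_int bs f (v + w) = iter_int bs f v.
Proof.
move=> mf f0 /(@coord_span _ _ _ (in_tuple bs)) ->.
elim/big_rec : _ v => [|i u _ IH] v; first by rewrite addr0.
rewrite addrCA addrC iter_int_shift_mem ?IH//.
by rewrite mem_nth.
Qed.

Lemma iter_int_scale b bs f v k : borel_fun f -> (forall u, 0 <= f u)%E -> k != 0 ->
  iter_int ((k *: b) :: bs) f v = ((`|k|^-1)%:E * iter_int (b :: bs) f v)%E.
Proof.
move=> mf f0 k0 /=.
rewrite -ge0_integral_scale//; last 2 first.
  exact: measurable_iter_int_line.
  by move=> x; exact: iter_int_ge0.
by apply: eq_integral => x _; rewrite scalerA mulrC.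
Qed.

(** At each fixed outer coordinate [x] the term [x *: w] translates the inner integral within its
    own span. *)
Lemma iter_int_shear b w bs f v : borel_fun f -> (forall u, 0 <= f u)%E ->
  w \in <<bs>>%VS -> iter_int ((b + w) :: bs) f v = iter_int (b :: bs) f v.
Proof.
move=> mf f0 wbs /=.
apply: eq_integral => x _; rewrite scalerDr addrA (@iter_int_shift bs f (v + x *: b) (x *: w))//.
by rewrite memvZ.
Qed.

(** The pivot of the exchange step: [u] can replace [b] in the basis, at the price of a shear by
    [u - k *: b] and the factor [k]. *)
Lemma span_pivot bs (u : V) : u \in <<bs>>%VS -> u != 0 ->
  exists b r k, [/\ perm_eq bs (b :: r), k != 0 & u - k *: b \in << r >>%VS].
Proof.
elim: bs u => [u|b0 bs IH u]; first by rewrite span_nil memv0 => /eqP ->; rewrite eqxx.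
rewrite span_cons => /memv_addP[_ /vlineP[k ->] [u' u'bs ->]] ku0.
have [k0|k0] := eqVneq k 0; last first.
  by exists b0, bs, k; rewrite perm_refl addrC addKr.
move: ku0; rewrite k0 scale0r add0r => /(IH _ u'bs)[b [r [l [pe l0 ur]]]].
exists b, (b0 :: r), l; split=> //.
  apply: (@perm_trans _ (b0 :: b :: r)); first by rewrite perm_cons.
  exact: (permEl (perm_catCA [:: b0] [:: b] r)).
by apply: subvP ur; rewrite span_cons addvSr.
Qed.

(* Steinitz exchange, one vector of [bs2] at a time. *)
Lemma iter_int_basis_change_cat bs1 bs2 xs :
  free (bs1 ++ xs) -> free (bs2 ++ xs) -> <<bs1 ++ xs>>%VS = <<bs2 ++ xs>>%VS ->
  exists2 c : R, 0 < c & forall f, borel_fun f -> (forall u, 0 <= f u)%E ->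
   forall v, iter_int (bs1 ++ xs) f v = (c%:E * iter_int (bs2 ++ xs) f v)%E.
Proof.
elim: bs2 bs1 xs => [|b' r2 IH] bs1 xs fr1 fr2 E.
  have : size (bs1 ++ xs) = size xs.
    by move: fr1 fr2; rewrite /= /free E => /eqP <- /eqP.
  rewrite size_cat -[RHS]add0n => /addIn/size0nil ->.
  by exists 1 => // f _ _ v; rewrite mul1e.
have b'1 : b' \in (<<bs1>> + <<xs>>)%VS.
  by rewrite -span_cat E; apply: memv_span; rewrite inE eqxx.
have [u ubs [w wxs b'E]] := memv_addP b'1.
have u0 : u != 0.
  apply/eqP => u0; move: fr2; rewrite cat_cons free_cons => /andP[/negP + _]; apply.
  by rewrite b'E u0 add0r span_cat; apply: subvP wxs; exact: addvSr.
have [b [r [k [pe k0 ur]]]] := span_pivot ubs u0.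
have pe' : perm_eq (bs1 ++ xs) (b :: (r ++ xs)) by rewrite -cat_cons perm_cat2r.
set w' := (u - k *: b) + w.
have w'r : w' \in << r ++ xs >>%VS by rewrite span_cat memv_add.
have b'w : b' = k *: b + w' by rewrite /w' addrA (addrC u) addrA subrr add0r b'E.
have spE : <<b' :: (r ++ xs)>>%VS = <<bs1 ++ xs>>%VS.
  rewrite (eq_span (perm_mem pe')); apply/eqP; rewrite eqEsubv; apply/andP; split.
    rewrite [X in (X <= _)%VS]span_cons subv_add -memvE; apply/andP; split.
      rewrite b'w memvD//; first by rewrite memvZ// memv_span// mem_head.
      by apply: subvP w'r; rewrite [X in (_ <= X)%VS]span_cons addvSr.
    by rewrite [X in (_ <= X)%VS]span_cons addvSr.
  rewrite [X in (X <= _)%VS]span_cons subv_add -memvE; apply/andP; split.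
    have -> : b = k^-1 *: (b' - w') by rewrite b'w addrK scalerA mulVf// scale1r.
    rewrite memvZ// memvB//; first by rewrite memv_span// mem_head.
    by apply: subvP w'r; rewrite [X in (_ <= X)%VS]span_cons addvSr.
  by rewrite [X in (_ <= X)%VS]span_cons addvSr.
have pe1 : perm_eq (b' :: (r ++ xs)) (r ++ b' :: xs).
  exact: (permEl (perm_catCA [:: b'] r xs)).
have pe2 : perm_eq (b' :: (r2 ++ xs)) (r2 ++ b' :: xs).
  exact: (permEl (perm_catCA [:: b'] r2 xs)).
have [||| c c0 cP] := IH r (b' :: xs).
- rewrite -(perm_free pe1) /free spE (eqP fr1).
  by rewrite (perm_size pe').
- by rewrite -(perm_free pe2).
- by rewrite -(eq_span (perm_mem pe1)) -(eq_span (perm_mem pe2)) spE E.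
exists (`|k| * c); first by rewrite mulr_gt0// normr_gt0.
move=> f mf f0 v; rewrite (iter_int_perm _ mf f0 pe').
rewrite EFinM -muleA cat_cons (iter_int_perm _ mf f0 pe2) -cP//.
rewrite -(iter_int_perm _ mf f0 pe1) b'w iter_int_shear// iter_int_scale//.
by rewrite muleA -EFinM mulfV ?mul1e// normr_eq0.
Qed.

Lemma iter_int_basis_change bs1 bs2 :
  free bs1 -> free bs2 -> <<bs1>>%VS = <<bs2>>%VS ->
  exists2 c : R, 0 < c & forall f, borel_fun f -> (forall u, 0 <= f u)%E ->
   forall v, iter_int bs1 f v = (c%:E * iter_int bs2 f v)%E.
Proof.
have := @iter_int_basis_change_cat bs1 bs2 [::].
by rewrite !cats0.
Qed.

End IteratedIntegral.

(** * Gaussian integrals over cones by layer cake *)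

Section LayerCake.
Context {R : realType}.
Local Notation mu := (@lebesgue_measure R).

Lemma is_derive_continuous (f f' : R -> R) :
  (forall x : R, is_derive x 1 f (f' x)) -> continuous f.
Proof.
move=> df x; apply: differentiable_continuous; apply/derivable1_diffP.
by case: (df x).
Qed.

Lemma cvg_expR_sqr (v : R) : 0 < v -> expR (- (v * r ^+ 2)) @[r --> +oo] --> (0 : R).
Proof.
move=> v0.
have -> : (fun r : R => expR (- (v * r ^+ 2))) = (fun r : R => gauss_fun (r * Num.sqrt v)).
  by apply/funext => r; rewrite /gauss_fun exprMn sqr_sqrtr ?ltW// mulrC.
apply: (cvg_comp (fun r : R => r * Num.sqrt v) (@gauss_fun R)); last exact: cvg_gauss_fun.
by apply: gt0_cvgMly; [rewrite sqrtr_gt0|exact: cvg_id].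
Qed.

Lemma integral_layer_gauss (q : R) : 0 <= q ->
  (\int[mu]_r (if (0 < r) && (q <= r ^+ 2) then r * expR (- (r ^+ 2 / 2)) else 0)%:E
    = (expR (- (q / 2)))%:E)%E.
Proof.
move=> q0; set a := Num.sqrt q.
have a0 : 0 <= a by rewrite sqrtr_ge0.
have aq : a ^+ 2 = q by rewrite sqr_sqrtr.
pose h (r : R) : R := r * expR (- (r ^+ 2 / 2)).
have dF (x : R) : is_derive x 1 (fun r : R => - expR (- (r ^+ 2 / 2))) (h x).
  apply: is_derive_eq.
  by rewrite /h /GRing.scale /=; field.
have dh (x : R) : is_derive x 1 h ((1 - x ^+ 2) * expR (- (x ^+ 2 / 2))).
  apply: is_derive_eq.
  by rewrite /GRing.scale /=; field.
have ch : continuous h by exact: is_derive_continuous dh.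
have mh : measurable_fun setT (EFin \o h).
  by apply/measurable_EFinP; exact: continuous_measurable_fun.
transitivity (\int[mu]_(r in `[a, +oo[) (h r)%:E)%E.
  (* For [q = 0] the condition [0 < r] omits the endpoint of the half-line, a null set. *)
  have [q00|qn] := eqVneq q 0.
    rewrite /a q00 sqrtr0 -integral_itv_obnd_cbnd; last exact: measurable_funTS.
    rewrite [RHS]integral_mkcond; apply: eq_integral => r _.
    rewrite patchE mem_setE in_itv/= andbT sqr_ge0 andbT.
    by case: ifP.
  rewrite [RHS]integral_mkcond; apply: eq_integral => r _.
  rewrite patchE mem_setE in_itv/= andbT.
  have -> : (0 < r) && (q <= r ^+ 2) = (a <= r).
    have ap : 0 < a by rewrite sqrtr_gt0 lt_neqAle eq_sym qn.
    apply/andP/idP => [[r0 qr]|ar]; last first.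
      by split; [exact: lt_le_trans ar|rewrite -aq ler_sqr ?nnegrE// (le_trans a0)].
    have r0' := ltW r0; by rewrite -(@ler_sqr _ a r) ?nnegrE// aq.
  by case: ifP.
rewrite (@ge0_continuous_FTC2y _ h (fun r : R => - expR (- (r ^+ 2 / 2))) a 0).
- by rewrite aq sub0e -EFinN opprK.
- by move=> x ax; rewrite mulr_ge0 ?expR_ge0// (le_trans a0).
- exact: continuous_subspaceT.
- rewrite -oppr0; apply: cvgN.
  under eq_fun do rewrite mulrC.
  exact: cvg_expR_sqr.
- by move=> x _; case: (dF x).
- apply: cvg_at_right_filter.
  exact: (is_derive_continuous dF).
- by move=> x _; rewrite derive1E derive_val.
Qed.
End LayerCake.

Section IteratedIntegralCone.
Context {R : realType} {d : nat}.
Local Notation mu := (@lebesgue_measure R).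
Local Notation V := 'rV[R]_d.
Implicit Types (f : V -> \bar R) (v w b : V) (bs : seq V).

Lemma iter_int_dilate bs f v (k : R) : borel_fun f -> (forall u, 0 <= f u)%E -> k != 0 ->
  iter_int bs (fun u => f (k *: u)) v =
  ((`|k|^-1 ^+ size bs)%:E * iter_int bs f (k *: v))%E.
Proof.
move=> mf f0 k0; elim: bs v => [|b bs IH] v; first by rewrite /= expr0 mul1e.
rewrite /= exprSr EFinM -muleA -ge0_integral_scale//; last 2 first.
- exact: measurable_iter_int_line.
- by move=> x; exact: iter_int_ge0.
rewrite -ge0_integralZl//; last 2 first.
- apply: (@borel_iter_int _ _ bs f mf f0) => i; under eq_fun do rewrite !mxE.
  by apply: measurable_funD => //; apply: measurable_funM => //; exact: measurable_funM.
- by move=> x _; exact: iter_int_ge0.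
by apply: eq_integral => x _; rewrite IH scalerDr scalerA.
Qed.

Lemma iter_intZ bs f v (k : R) : borel_fun f -> (forall u, 0 <= f u)%E -> 0 <= k ->
  iter_int bs (fun u => k%:E * f u)%E v = (k%:E * iter_int bs f v)%E.
Proof.
move=> mf f0 k0; elim: bs v => [//|b bs IH] v /=.
under eq_integral do rewrite IH.
rewrite ge0_integralZl//.
- exact: measurable_iter_int_line.
- by move=> x _; exact: iter_int_ge0.
Qed.

Lemma iter_int_exchange bs (F : R -> V -> \bar R) v :
  (forall disp (T : measurableType disp) (r : T -> R) (g : T -> V),
    measurable_fun setT r -> (forall i, measurable_fun setT (fun t => g t 0 i)) ->
    measurable_fun setT (fun t => F (r t) (g t))) ->
  (forall r u, 0 <= F r u)%E ->
  iter_int bs (fun u => \int[mu]_r F r u)%E v = (\int[mu]_r iter_int bs (F r) v)%E.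
Proof.
move=> mF F0.
have mJ cs disp (T : measurableType disp) (r : T -> R) (g : T -> V) :
    measurable_fun setT r -> (forall i, measurable_fun setT (fun t => g t 0 i)) ->
    measurable_fun setT (fun t => iter_int cs (F (r t)) (g t)).
  elim: cs disp T r g => [|c cs IH] disp T r g mr mg /=; first exact: mF.
  apply: (measurable_fun_fubini_tonelli_F (m2 := mu)
    (fun p : T * measurableTypeR R => iter_int cs (F (r p.1)) (g p.1 + p.2 *: c))).
    apply: IH => [|i]; last exact: measurable_coord_line.
    exact: (measurableT_comp mr).
  by move=> p; exact: iter_int_ge0.
elim: bs v => [//|b bs IH] v /=.
under eq_integral do rewrite IH.
have := @fubini_tonelli _ _ _ _ R mu mu
  (fun p : measurableTypeR R * measurableTypeR R => iter_int bs (F p.2) (v + p.1 *: b)) _ _.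
apply.
- apply: (mJ bs _ _ (fun p : measurableTypeR R * measurableTypeR R => p.2)
    (fun p : measurableTypeR R * measurableTypeR R => v + p.1 *: b)).
    exact: measurable_snd.
  move=> i; under eq_fun do rewrite !mxE.
  by apply: measurable_funD => //; exact: measurable_funM.
- by move=> p; exact: iter_int_ge0.
Qed.

(** Its value [2 ^ (n / 2) * Gamma (n / 2 + 1)] is never computed, as it cancels in the quotient
    that defines a solid angle. *)
Definition layer_const (n : nat) : \bar R :=
  (\int[mu]_r (if (0 < r)%R then r * expR (- (r ^+ 2 / 2)) * r ^+ n else 0)%:E)%E.

(* [expR (- (q / 2))] is the integral of [r * expR (- (r ^+ 2 / 2))] over
   [r ^+ 2 >= q], and [K] is invariant under dilation by [r]. *)
Lemma iter_int_cone bs (K : set V) (Q : V -> R) :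
  borel_fun (fun u => (\1_K u)%:E) -> borel_fun (fun u => (Q u)%:E) ->
  (forall k u, 0 < k -> K u -> K (k *: u)) ->
  (forall k u, Q (k *: u) = k ^+ 2 * Q u) -> (forall u, 0 <= Q u) ->
  iter_int bs (fun u => (\1_K u * expR (- (Q u / 2)))%:E) 0 =
  (layer_const (size bs) * iter_int bs (fun u => (\1_(K `&` [set u | Q u <= 1]) u)%:E) 0)%E.
Proof.
move=> mK mQ KZ QZ Q0.
pose G u := (\1_(K `&` [set u | Q u <= 1%R]) u)%:E : \bar R.
pose F r u := ((if 0 < r then r * expR (- (r ^+ 2 / 2)) else 0) *
  (\1_K u * (if Q u <= r ^+ 2 then 1 else 0)))%:E.
have K1 u : 0 <= \1_K u :> R by rewrite indicE ler0n.
have mK' disp (T : measurableType disp) (g : T -> V) :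
    (forall i, measurable_fun setT (fun t => g t 0 i)) ->
    measurable_fun setT (fun t => \1_K (g t) : R).
  by move=> mg; apply/measurable_EFinP; exact: mK.
have mQ' disp (T : measurableType disp) (g : T -> V) :
    (forall i, measurable_fun setT (fun t => g t 0 i)) ->
    measurable_fun setT (fun t => Q (g t)).
  by move=> mg; apply/measurable_EFinP; exact: mQ.
have GE u : G u = (\1_K u * (if Q u <= 1 then 1 else 0))%:E.
  rewrite /G indicI/= [X in _ * X]indicE.
  rewrite (_ : (u \in _) = (Q u <= 1)); last by apply/idP/idP; rewrite inE.
  by case: (Q u <= 1).
have mG : borel_fun G.
  move=> disp T g mg; under eq_fun do rewrite GE.
  apply/measurable_EFinP; apply: measurable_funM; first exact: mK'.
  by apply: measurable_fun_ifT => //; apply: measurable_fun_ler => //; exact: mQ'.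
have G0 u : (0 <= G u)%E by rewrite lee_fin indicE ler0n.
have F0 r u : (0 <= F r u)%E.
  rewrite lee_fin mulr_ge0//; last by rewrite mulr_ge0//; case: ifP.
  by case: ifP => // r0; rewrite mulr_ge0 ?expR_ge0// ltW.
have mgauss : measurable_fun setT (fun r : measurableTypeR R => r * expR (- (r ^+ 2 / 2))).
  apply: measurable_funM => //; apply: (measurableT_comp (@measurable_expR R)).
  by apply: measurable_funN; apply: measurable_funM => //; exact: measurable_funX.
transitivity (iter_int bs (fun u => \int[mu]_r F r u)%E 0).
  apply: eq_iter_int => u.
  rewrite EFinM -integral_layer_gauss// -ge0_integralZl//; last 2 first.
  - apply/measurable_EFinP.
    have mb : measurable_fun setT (fun r : measurableTypeR R => (0 < r) && (Q u <= r ^+ 2)).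
      apply: measurable_and; first exact: measurable_fun_ltr.
      by apply: measurable_fun_ler => //; exact: measurable_funX.
    exact: (measurable_fun_ifT mb mgauss (measurable_cst (0 : R))).
  - by move=> r _; rewrite lee_fin; case: ifP => // /andP[r0 _]; rewrite mulr_ge0 ?expR_ge0// ltW.
  apply: eq_integral => r _; rewrite -EFinM; congr EFin.
  by case: (0 < r); case: (Q u <= r ^+ 2); rewrite /= ?(mulr1, mulr0, mul0r)// mulrC.
rewrite iter_int_exchange//; last first.
  move=> disp T r g mr mg; apply/measurable_EFinP.
  apply: measurable_funM.
    have mb : measurable_fun setT (fun t : T => 0 < r t) by exact: measurable_fun_ltr.
    exact: (measurable_fun_ifT mb (measurableT_comp mgauss mr) (measurable_cst (0 : R))).
  apply: measurable_funM; first exact: mK'.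
  apply: measurable_fun_ifT => //; apply: measurable_fun_ler; first exact: mQ'.
  exact: measurable_funX.
rewrite -/G /layer_const -ge0_integralZr//; last 3 first.
- apply/measurable_EFinP.
  have mb : measurable_fun setT (fun r : measurableTypeR R => 0 < r) by exact: measurable_fun_ltr.
  have mn : measurable_fun setT (fun r : measurableTypeR R => r ^+ size bs) by exact: measurable_funX.
  exact: (measurable_fun_ifT mb (measurable_funM mgauss mn) (measurable_cst (0 : R))).
- by move=> r _; rewrite lee_fin; case: ifP => // r0; rewrite mulr_ge0 ?mulr_ge0 ?exprn_ge0 ?expR_ge0// ltW.
- exact: iter_int_ge0.
apply: eq_integral => r _.
have [r0|r0] := ltP 0 r; last first.
  rewrite mul0e; transitivity (iter_int bs (fun u => 0%:E * G u)%E 0).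
    by apply: eq_iter_int => u; rewrite /F ltNge r0/= mul0r mul0e.
  by rewrite iter_intZ// mul0e.
(* For [r > 0] the points of [K] with [Q u <= r ^ 2] form the dilate by [r] of those with
   [Q u <= 1]; the dilation contributes [r ^ size bs]. *)
transitivity (iter_int bs (fun u => (r * expR (- (r ^+ 2 / 2)))%:E * G (r^-1 *: u))%E 0).
  apply: eq_iter_int => u; rewrite /F r0 GE -EFinM; congr (_ * _)%:E.
  congr (_ * _).
    rewrite !indicE; congr ((_ : bool)%:R); apply/idP/idP; rewrite !inE => Ku.
      by apply: KZ => //; rewrite invr_gt0.
    by have := KZ _ _ r0 Ku; rewrite scalerA mulfV ?scale1r// gt_eqF.
  by rewrite QZ exprVn mulrC ler_pdivrMr ?exprn_gt0// mul1r.
rewrite (@iter_intZ _ (fun u => G (r^-1 *: u))); last 3 first.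
- move=> disp T g mg; apply: mG => i; under eq_fun do rewrite mxE.
  exact: measurable_funM.
- by move=> u; exact: G0.
- by rewrite mulr_ge0 ?expR_ge0// ltW.
rewrite iter_int_dilate ?invr_eq0 ?gt_eqF// scaler0 muleA -EFinM.
by rewrite normfV invrK gtr0_norm.
Qed.

End IteratedIntegralCone.

(** * Solid angles as Gaussian measures *)

Section InnerProduct.
Context {R : realType} {d : nat}.
Local Notation V := 'rV[R]_d.

Definition inner_product (g : V -> V -> R) :=
  [/\ forall u v, g u v = g v u,
      forall k u v w, g (k *: u + v) w = k * g u w + g v w &
      forall u, u != 0 -> 0 < g u u].

Definition orthonormal (g : V -> V -> R) (o : seq V) :=
  pairwise (fun u v => g u v == 0) o && all (fun u => g u u == 1) o.

Variables (g : V -> V -> R) (gP : inner_product g).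

Lemma ipC u v : g u v = g v u. Proof. by case: gP. Qed.

Lemma ip0l v : g 0 v = 0.
Proof.
case: gP => _ gL _; have := gL (-1) 0 0 v.
by rewrite scaler0 addr0 mulN1r addNr.
Qed.

Lemma ipZl k u v : g (k *: u) v = k * g u v.
Proof. by case: gP => _ gL _; rewrite -[k *: u]addr0 gL ip0l addr0. Qed.

Lemma ipDl u v w : g (u + v) w = g u w + g v w.
Proof. by case: gP => _ gL _; rewrite -{1}[u]scale1r gL mul1r. Qed.

Lemma ipZr k u v : g u (k *: v) = k * g u v.
Proof. by rewrite ipC ipZl ipC. Qed.

Lemma ipDr u v w : g w (u + v) = g w u + g w v.
Proof. by rewrite ipC ipDl !(ipC w). Qed.

Lemma ipNl u v : g (- u) v = - g u v.
Proof. by rewrite -scaleN1r ipZl mulN1r. Qed.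

Lemma ipNr u v : g u (- v) = - g u v.
Proof. by rewrite ipC ipNl ipC. Qed.

Lemma ip0r v : g v 0 = 0. Proof. by rewrite ipC ip0l. Qed.

Lemma ip_suml (I : Type) (r : seq I) (P : pred I) (F : I -> V) v :
  g (\sum_(i <- r | P i) F i) v = \sum_(i <- r | P i) g (F i) v.
Proof.
by elim/big_rec2 : _ => [|i y u _ <-]; rewrite ?ip0l ?ipDl.
Qed.

Lemma ip_ge0 u : 0 <= g u u.
Proof.
have [->|u0] := eqVneq u 0; first by rewrite ip0l.
by apply: ltW; case: gP => _ _; exact.
Qed.

Lemma orthonormal_cons b o : orthonormal g (b :: o) =
  [&& g b b == 1, all (fun u => g b u == 0) o & orthonormal g o].
Proof.
rewrite /orthonormal /=.
by case: (g b b == 1); case: all; case: pairwise; case: all.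
Qed.

Lemma orthonormal_perp b o u : orthonormal g (b :: o) -> u \in o -> g b u = 0.
Proof. by rewrite orthonormal_cons => /and3P[_ /allP + _] => /[apply] /eqP. Qed.

Lemma orthonormal_norm o u : orthonormal g o -> u \in o -> g u u = 1.
Proof. by move=> /andP[_ /allP] /[apply] /eqP. Qed.

Lemma ip_sum_perp (o : seq V) (c : V -> R) v : (forall u, u \in o -> g u v = 0) ->
  g (\sum_(u <- o) c u *: u) v = 0.
Proof.
move=> ov; rewrite ip_suml big_seq big1// => u uo.
by rewrite ipZl ov// mulr0.
Qed.

Lemma span_perp (o : seq V) v w : (forall u, u \in o -> g u v = 0) ->
  w \in <<o>>%VS -> g w v = 0.
Proof.
move=> ov /(@coord_span _ _ _ (in_tuple o)) ->.
rewrite ip_suml big1// => i _.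
by rewrite ipZl ov ?mulr0// mem_nth.
Qed.

Lemma orthonormal_expand o v : orthonormal g o -> v \in <<o>>%VS ->
  v = \sum_(u <- o) g v u *: u.
Proof.
elim: o v => [|b o IH] v; first by rewrite span_nil memv0 big_nil => _ /eqP.
move=> ob; rewrite span_cons => /memv_addP[_ /vlineP[k ->] [w wo ->]].
have bo u := @orthonormal_perp b o u ob.
move: ob; rewrite orthonormal_cons => /and3P[/eqP bb _ oo].
have wb : g w b = 0 by apply: (span_perp _ wo) => u uo; rewrite ipC bo.
rewrite big_cons ipDl ipZl bb mulr1 wb addr0; congr (_ + _).
rewrite {1}(IH w oo wo); rewrite big_seq [RHS]big_seq; apply: eq_bigr => u uo.
by rewrite ipDl ipZl bo// mulr0 add0r.
Qed.

Lemma orthonormal_free o : orthonormal g o -> free o.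
Proof.
elim: o => [|b o IH]; first by rewrite nil_free.
move=> ob; have bo u := @orthonormal_perp b o u ob.
move: ob; rewrite orthonormal_cons => /and3P[/eqP bb _ oo].
rewrite free_cons IH// andbT; apply/negP => bso.
have : g b b = 0 by apply: (span_perp _ bso) => u uo; rewrite ipC bo.
by rewrite bb => /eqP; rewrite oner_eq0.
Qed.

Lemma orthonormal_proj_perp o v u : orthonormal g o -> u \in o ->
  g (v - \sum_(w <- o) g v w *: w) u = 0.
Proof.
move=> oo uo; rewrite ipDl ipNl.
suff -> : g (\sum_(w <- o) g v w *: w) u = g v u by rewrite subrr.
elim: o oo uo => // b o IH ob.
have bo w := @orthonormal_perp b o w ob.
move: ob; rewrite orthonormal_cons => /and3P[/eqP bb _ oo].
rewrite big_cons ipDl ipZl inE => /orP[/eqP ->|uo].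
  rewrite bb mulr1 ip_sum_perp ?addr0// => w wo.
  by rewrite ipC bo.
by rewrite bo// mulr0 add0r IH.
Qed.

Lemma sum_mem_span (o : seq V) (c : V -> R) : \sum_(u <- o) c u *: u \in <<o>>%VS.
Proof.
by rewrite big_seq; apply: memv_suml => u uo; rewrite memvZ// memv_span.
Qed.

(* Gram-Schmidt. *)
Lemma orthonormal_extend o : orthonormal g o ->
  exists o', orthonormal g (o' ++ o) /\ <<o' ++ o>>%VS = fullv.
Proof.
have [n nE] : exists n, n = (\dim {:V} - size o)%N by eexists.
elim: n o nE => [|n IH] o nE oo.
  exists [::]; split=> //=; apply/eqP; rewrite eqEdim subvf/=.
  have := orthonormal_free oo; rewrite /free => /eqP ->.
  by rewrite -subn_eq0 -nE.
have : ~~ (fullv <= <<o>>)%VS.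
  apply/negP => /dimvS; have := orthonormal_free oo; rewrite /free => /eqP -> le.
  by move: le; rewrite -subn_eq0 -nE.
move=> /subvPn[v _ vo].
pose w := v - \sum_(u <- o) g v u *: u.
have w0 : w != 0.
  apply/eqP => /subr0_eq vE; move: vo; rewrite vE; apply/negP/negPn.
  exact: sum_mem_span.
have gw : 0 < g w w by case: gP => _ _; exact.
pose b := (Num.sqrt (g w w))^-1 *: w.
have ob : orthonormal g (b :: o).
  rewrite orthonormal_cons oo andbT; apply/andP; split.
    rewrite ipZl ipZr mulrA -invfM -expr2 sqr_sqrtr ?ltW// mulVf// gt_eqF//.
  by apply/allP => u uo; rewrite ipZl (orthonormal_proj_perp v oo uo) mulr0.
have [|o' []] := IH (b :: o) _ ob; first by rewrite /= subnS -nE.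
by exists (o' ++ [:: b]); rewrite -catA.
Qed.

End InnerProduct.

Section GaussIntegral.
Context {R : realType}.
Local Notation mu := (@lebesgue_measure R).

Lemma integral_gauss_half : (\int[mu]_x (expR (- (x ^+ 2 / 2)))%:E = (Num.sqrt (2 * pi))%:E)%E.
Proof.
have s0 : 0 < Num.sqrt (2 * pi : R) by rewrite sqrtr_gt0 mulr_gt0// pi_gt0.
have E x : expR (- (x ^+ 2 / 2)) = Num.sqrt (2 * pi) * normal_pdf 0 1 x :> R.
  rewrite normal_pdfE ?oner_eq0// /normal_peak /normal_fun subr0 expr1n mul1r.
  have -> : pi *+ 2 = 2 * pi :> R by rewrite mulr_natl.
  by rewrite mulVKf ?gt_eqF// mulNr.
under eq_integral do rewrite E EFinM.
rewrite ge0_integralZl//.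
- by rewrite integral_normal_pdf mule1.
- by apply/measurable_EFinP; exact: measurable_normal_pdf.
- by move=> x _; rewrite lee_fin normal_pdf_ge0.
Qed.

Lemma measurable_gauss_half : measurable_fun [set: measurableTypeR R]
  (fun x : measurableTypeR R => expR (- (x ^+ 2 / 2)) : R).
Proof.
apply: (measurableT_comp (@measurable_expR R)).
by apply: measurable_funN; apply: measurable_funM => //; exact: measurable_funX.
Qed.

End GaussIntegral.

Section ConeCoordinates.
Context {R : realType} {d : nat}.
Local Notation V := 'rV[R]_d.
Variables (g : V -> V -> R) (gP : inner_product g).

Lemma borel_ipr w : borel_fun (fun u => (g u w)%:E).
Proof.
move=> disp T h mh; apply/measurable_EFinP.
under eq_fun => t do rewrite (row_sum_delta (h t)) ip_suml//.
apply: measurable_sum => i.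
under eq_fun do rewrite ipZl//.
exact: measurable_funM.
Qed.

Lemma borel_ip_sqr : borel_fun (fun u => (g u u)%:E).
Proof.
move=> disp T h mh; apply/measurable_EFinP.
under eq_fun => t do rewrite {1}(row_sum_delta (h t)) ip_suml//.
apply: measurable_sum => i.
under eq_fun do rewrite ipZl// ipC//.
apply: measurable_funM => //.
exact/measurable_EFinP/borel_ipr.
Qed.

Lemma borel_gauss : borel_fun (fun u => (expR (- (g u u / 2)))%:E).
Proof.
move=> disp T h mh; apply/measurable_EFinP.
apply: (measurableT_comp (@measurable_expR R)).
apply: measurable_funN; apply: measurable_funM => //.
exact/measurable_EFinP/borel_ip_sqr.
Qed.

Lemma gauss_line u v x : g u u = 1 -> g u v = 0 ->
  expR (- (g (v + x *: u) (v + x *: u) / 2)) =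
  expR (- (g v v / 2)) * expR (- (x ^+ 2 / 2)).
Proof.
move=> uu uv; rewrite -expRD; congr expR.
rewrite (ipDl gP) !(ipDr gP) !(ipZl gP) !(ipZr gP) uu (ipC gP v) uv.
by field.
Qed.

Lemma iter_int_gauss o v : orthonormal g o -> (forall u, u \in o -> g u v = 0) ->
  iter_int o (fun u => (expR (- (g u u / 2)))%:E) v =
  (Num.sqrt (2 * pi) ^+ size o * expR (- (g v v / 2)))%:E.
Proof.
elim: o v => [|b o IH] v; first by rewrite /= mul1r.
move=> ob ov; have bo u := @orthonormal_perp _ _ g b o u ob.
move: ob; rewrite orthonormal_cons => /and3P[/eqP bb _ oo] /=.
under eq_integral => x _.
  rewrite IH//; last first.
    by move=> u uo; rewrite (ipDr gP) (ipZr gP) (ipC gP) [g u b](ipC gP) bo// mulr0 addr0 (ipC gP) ov// inE uo orbT.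
  rewrite gauss_line//; last by rewrite ov// mem_head.
  rewrite mulrA EFinM.
  over.
rewrite ge0_integralZl//.
- by rewrite integral_gauss_half -EFinM exprS; congr EFin; ring.
- by apply/measurable_EFinP; exact: measurable_gauss_half.
Qed.

End ConeCoordinates.

(** * Volumes in a basis and Gram determinants *)

Section GVolume.
Context {R : realType} {d : nat}.
Local Notation V := 'rV[R]_d.

(** The bridge from volumes of sets of coordinate tuples, in which a solid angle is defined, to
    iterated integrals. Both sides integrate the first coordinate outermost. *)
Lemma lebesgue_n_iter_int (bs : seq V) (S : set V) n v : size bs = n ->
  lebesgue_n [set c : n.-tuple R | S (v + \sum_(i < n) tnth c i *: bs`_i)] =
  iter_int bs (fun u => (\1_S u)%:E) v.
Proof.
move=> <-{n}; elim: bs v => [|b bs IH] v /=.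
  rewrite !indicE; congr ((_ : bool)%:R%:E).
  by apply/idP/idP; rewrite !inE /= big_ord0 addr0.
apply: eq_integral => x _; rewrite -IH; congr lebesgue_n.
have E (t : (size bs).-tuple R) :
    \sum_(i < (size bs).+1) tnth (cons_tuple x t) i *: (b :: bs)`_i =
    x *: b + \sum_(i < size bs) tnth t i *: bs`_i.
  rewrite big_ord_recl tnth0; congr (_ + _).
  by apply: eq_bigr => i _; rewrite !(tnth_nth 0).
by apply/seteqP; split => t /=; rewrite E addrA.
Qed.

End GVolume.

Section GramDeterminant.
Context {R : realType} {d : nat}.
Local Notation V := 'rV[R]_d.
Variables (g : V -> V -> R) (gP : inner_product g).

Lemma orthonormal_nth o i j : orthonormal g o -> (i < size o)%N -> (j < size o)%N ->
  g o`_i o`_j = (i == j)%:R.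
Proof.
move=> /andP[/(pairwiseP 0) pw nm] io jo.
case: (ltngtP i j) => [ij|ji|<-].
- exact/eqP/pw.
- by rewrite ipC//; exact/eqP/pw.
- exact/eqP/(allP nm)/mem_nth.
Qed.

(** The Gram matrix is [A *m A^T] with [A] the coordinates of [bs] in the orthonormal sequence [o].
    This [A] is invertible because [o] can conversely be expanded in [bs]; that expansion is the
    matrix [C]. *)
Lemma gram_det_gt0 (bs o : seq V) n : size bs = n -> size o = n ->
  orthonormal g o -> <<bs>>%VS = <<o>>%VS ->
  0 < \det (\matrix_(i < n, j < n) g bs`_i bs`_j).
Proof.
move=> sb so oo sp.
pose A : 'M[R]_n := \matrix_(i, k) g bs`_i o`_k.
have -> : \matrix_(i < n, j < n) g bs`_i bs`_j = A *m A^T.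
  apply/matrixP => i j; rewrite !mxE.
  have bi : bs`_i \in <<o>>%VS by rewrite -sp memv_span// mem_nth// sb.
  rewrite {1}(orthonormal_expand gP oo bi) ip_suml// (big_nth 0) big_mkord so.
  by apply: eq_bigr => k _; rewrite ipZl// !mxE [g bs`_j _]ipC.
rewrite det_mulmx det_tr -expr2 lt_neqAle sqr_ge0 andbT eq_sym expf_eq0/=.
pose t : n.-tuple V := tcast sb (in_tuple bs).
have tE : t = bs :> seq V by rewrite val_tcast.
pose C : 'M[R]_n := \matrix_(j, i) coord t i o`_j.
suff /(congr1 determinant) : C *m A = 1%:M.
  rewrite det_mulmx det1 => CA; apply/eqP => A0.
  by move: CA; rewrite A0 mulr0 => /esym/eqP; rewrite oner_eq0.
apply/matrixP => j k; rewrite !mxE.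
have oj : o`_j \in <<t>>%VS by rewrite tE sp memv_span// mem_nth// so.
rewrite -val_eqE -(orthonormal_nth (i := j) (j := k) oo) ?so//.
rewrite [in RHS](coord_span oj) ip_suml//.
by apply: eq_bigr => i _; rewrite ipZl// !mxE tE.
Qed.

End GramDeterminant.

Section SolidAngleGauss.
Context {R : realType} {d : nat}.
Local Notation V := 'rV[R]_d.

(** [A] is the radial constant, [VK] and [VL] are the volumes in the unit ball of a cone and of its
    linear hull. None of them is known to be finite beforehand; the two equations together with
    [0 < G] force it. *)
Lemma ratio_of_scaled_volumes (A VK VL : \bar R) (a G c : R) :
  (0 <= A)%E -> (0 <= VK)%E -> (0 <= VL)%E -> 0 < G -> 0 < c ->
  (A * VK = a%:E)%E -> (A * VL = G%:E)%E ->
  fine (c%:E * VK)%E / fine (c%:E * VL)%E = a / G.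
Proof.
case: A => [A| |//] A0; last first.
  move=> _ VL0 G0 _ _; have [VL00|VLn] := eqVneq VL 0%E.
    by rewrite VL00 mule0 => GG; move: G0; rewrite -lte_fin -GG ltxx.
  by rewrite gt0_mulye// lt0e VLn.
rewrite lee_fin in A0.
case: VL => [VL| |//] VK0 VL0 G0 c0; last first.
  have [->|An] := eqVneq A 0.
    by rewrite !mul0e => _ GG; move: G0; rewrite -lte_fin -GG ltxx.
  by rewrite gt0_muley// lte_fin lt_neqAle eq_sym An.
move=> AK [] AL.
have Ap : 0 < A.
  rewrite lt_neqAle A0 andbT; apply/eqP => A00.
  by move: G0; rewrite -AL -A00 mul0r ltxx.
move: VK0 AK; case: VK => [VK| |//] VK0; last by rewrite gt0_muley.
move=> [<-]; rewrite -AL /=.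
have VLn : VL != 0 by apply/eqP => V0; move: G0; rewrite -AL V0 mulr0 ltxx.
by field; rewrite VLn !gt_eqF.
Qed.

(** The Gram factor, the change of basis from [vbasis] to [o] and the radial constant multiply
    numerator and denominator alike. What remains is the Gaussian integral over [K] divided by the
    one over the whole hull, which is [sqrt (2 * pi)] to the power [size o]. *)
Lemma solid_angle_gauss (kappa : R) (x : V) (K : set V) (o : seq V) (a : R) :
  inner_product (klein_metric kappa x) ->
  orthonormal (klein_metric kappa x) o -> lin_hull K = <<o>>%VS ->
  borel_fun (fun u => (\1_K u)%:E) -> (forall k u, 0 < k -> K u -> K (k *: u)) ->
  iter_int o (fun u => (\1_K u * expR (- (klein_metric kappa x u u / 2)))%:E) 0 = a%:E ->
  solid_angle kappa x K = a / Num.sqrt (2 * pi) ^+ size o.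
Proof.
move=> gP oo LE mK KZ Ka; rewrite /solid_angle LE /gvolume.
set L := <<o>>%VS; set bs : seq V := vbasis L.
have bsL : <<bs>>%VS = L by apply: span_basis; exact: vbasisP.
have fbs : free bs by apply: basis_free; exact: vbasisP.
have sbs : size bs = \dim L by rewrite size_tuple.
have so : size o = \dim L by have := orthonormal_free gP oo; rewrite /free => /eqP.
set s := Num.sqrt _.
have s0 : 0 < s by rewrite sqrtr_gt0; exact: (gram_det_gt0 gP sbs so oo bsL).
pose g := klein_metric kappa x.
have E (S : set V) : lebesgue_n [set c : (\dim L).-tuple R |
    S (\sum_(i < \dim L) tnth c i *: bs`_i)] = iter_int bs (fun u => (\1_S u)%:E) 0.
  by rewrite -(lebesgue_n_iter_int S 0 sbs); congr lebesgue_n; apply/seteqP; split => c /=; rewrite add0r.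
have mB S : borel_fun (fun u : V => (\1_S u)%:E : \bar R) ->
    borel_fun (fun u : V => (\1_(S `&` unit_gball kappa x) u)%:E : \bar R).
  move=> mS disp T h mh; apply/measurable_EFinP.
  under eq_fun do rewrite indicI/=.
  apply: measurable_funM; first exact/measurable_EFinP/mS.
  rewrite (_ : (fun t => _) = fun t => if g (h t) (h t) <= 1 then 1 else 0 : R).
    apply: measurable_fun_ifT => //; apply: measurable_fun_ler => //.
    exact/measurable_EFinP/borel_ip_sqr.
  apply/funext => t; rewrite indicE (_ : (_ \in _) = (g (h t) (h t) <= 1)).
    by case: ifP.
  by apply/idP/idP; rewrite inE.
have [c c0 cP] := iter_int_basis_change fbs (orthonormal_free gP oo) bsL.
have mT : borel_fun (fun u : V => (\1_[set: V] u)%:E : \bar R).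
  by move=> disp T h mh; rewrite (_ : (fun t => _) = cst 1%:E)//; apply/funext => t; rewrite indicT.
have i0 S (u : V) : (0 <= (\1_S u)%:E :> \bar R)%E by rewrite lee_fin indicE ler0n.
rewrite !E (cP _ (mB _ mK))//.
(* Combinations of [bs] always lie in [L], so the condition [u \in L] is traded for the full space
   before the basis is changed. *)
have -> : iter_int bs (fun u => (\1_([set u | u \in L] `&` unit_gball kappa x) u)%:E) 0 =
    (c%:E * iter_int o (fun u => (\1_([set: V] `&` unit_gball kappa x) u)%:E) 0)%E.
  rewrite -(cP _ (mB _ mT))// -!E; congr lebesgue_n.
  apply/seteqP; split => t [_ /= tB]; split=> //=.
  apply: memv_suml => i _; rewrite memvZ//; apply: vbasis_mem.
  by rewrite mem_nth// size_tuple.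
rewrite !muleA -!EFinM.
apply: (@ratio_of_scaled_volumes (layer_const (size o))).
- apply: integral_ge0 => r _; rewrite lee_fin; case: ifP => // r0.
  by rewrite !mulr_ge0 ?expR_ge0 ?exprn_ge0// ltW.
- exact: iter_int_ge0.
- exact: iter_int_ge0.
- by rewrite exprn_gt0// sqrtr_gt0 mulr_gt0// pi_gt0.
- exact: mulr_gt0.
- have QZ (k : R) (u : V) : g (k *: u) (k *: u) = k ^+ 2 * g u u.
    by rewrite /g (ipZl gP) (ipZr gP) mulrA.
  rewrite -Ka; apply/esym; apply: iter_int_cone => //.
  + exact: borel_ip_sqr.
  + exact: (ip_ge0 gP).
- have QZ (k : R) (u : V) : g (k *: u) (k *: u) = k ^+ 2 * g u u.
    by rewrite /g (ipZl gP) (ipZr gP) mulrA.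
  have := iter_int_gauss gP (o := o) (v := 0) oo.
  rewrite (ip0l gP) mul0r oppr0 expR0 mulr1 => <-; last first.
    by move=> u _; rewrite (ip0r gP).
  transitivity (iter_int o (fun u => (\1_[set: V] u * expR (- (g u u / 2)))%:E) 0).
    apply/esym; apply: iter_int_cone => //.
    + exact: borel_ip_sqr.
    + exact: (ip_ge0 gP).
  by apply: eq_iter_int => u; rewrite indicT mul1r.
Qed.

End SolidAngleGauss.

(** * The characteristic function of the absolute value of a normal variable *)

Section RealAnalysis.
Context {R : realType}.
Local Notation mu := (@lebesgue_measure R).
Implicit Types (f F : R -> R).

Lemma is_derive_under_integral disp (Y : measurableType disp)
    (nu : {measure set Y -> \bar R}) (B : set Y) (f df : R -> Y -> R) (G : Y -> R) :
  measurable B -> (forall x, nu.-integrable B (EFin \o f x)) ->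
  (forall (x : R) y, B y -> is_derive x 1 (f ^~ y) (df x y)) ->
  (forall y, 0 <= G y) -> nu.-integrable B (EFin \o G) ->
  (forall x y, B y -> `|df x y| <= G y) ->
  forall a : R, is_derive a 1 (fun x => \int[nu]_(y in B) f x y) (\int[nu]_(y in B) df a y).
Proof.
move=> mB fi fd G0 Gi dG a.
(* The dominating function [G] serves for all [x], so any open interval around [a] will do. *)
have Ia : `](a - 1), (a + 1)[%classic a by rewrite /= in_itv/= ltrBlDr ltrDl ltr01.
have dE x y : B y -> partial1of2 f x y = df x y.
  by move=> By; rewrite /partial1of2 derive1E; have := fd x y By => ?; rewrite derive_val.
have H1 x y : `](a - 1), (a + 1)[%classic x -> B y -> derivable (f ^~ y) x 1.
  by move=> _ By; case: (fd x y By).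
have H2 x y : `](a - 1), (a + 1)[%classic x -> B y -> `|partial1of2 f x y| <= G y.
  by move=> _ By; rewrite dE// dG.
have H3 x : `](a - 1), (a + 1)[%classic x -> nu.-integrable B (EFin \o f x) by [].
apply: DeriveDef; first exact: (derivable_under_integral mB Ia H3 H1 G0 Gi H2).
rewrite -derive1E (differentiation_under_integral mB Ia H3 H1 G0 Gi H2).
by apply: eq_Rintegral => y; rewrite inE => By; rewrite dE.
Qed.

Lemma integral_FTC f F (a b : R) : a <= b -> continuous f ->
  (forall x : R, is_derive x 1 F (f x)) ->
  (\int[mu]_(x in `[a, b]) (f x)%:E = (F b - F a)%:E)%E.
Proof.
move=> ab cf dF; have cF := is_derive_continuous dF.
have [->|abn] := eqVneq a b; first by rewrite set_itv1 integral_set1 subrr.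
rewrite (@continuous_FTC2 _ f F) ?lt_neqAle ?abn//.
- exact: continuous_subspaceT.
- split.
  + by move=> x _; case: (dF x).
  + exact/cvg_at_right_filter/cF.
  + exact/cvg_at_left_filter/cF.
- by move=> x _; rewrite derive1E; have := dF x => ?; rewrite derive_val.
Qed.

(** Since [f] may change sign, the half-line is exhausted by the intervals [[0, n]] and the limit is
    taken by dominated convergence with [|f|]. *)
Lemma integral_FTCy f F (l : R) : continuous f ->
  (forall x : R, is_derive x 1 F (f x)) ->
  mu.-integrable `[0, +oo[ (EFin \o f) -> F x @[x --> +oo] --> l ->
  (\int[mu]_(x in `[0%R, +oo[) (f x)%:E = (l - F 0)%:E)%E.
Proof.
move=> cf dF fi Fl.
have mf : measurable_fun setT f by exact: continuous_measurable_fun.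
pose fn (n : nat) x : \bar R := (EFin \o f) \_ (`[0, n%:R]) x.
have cv : (\int[mu]_(x in `[0%R, +oo[) fn n x)%E @[n --> \oo] -->
    (\int[mu]_(x in `[0%R, +oo[) (f x)%:E)%E.
  have [] // := @dominated_convergence _ _ _ mu `[0, +oo[%classic _ fn (EFin \o f)
      (abse \o (EFin \o f)).
  - move=> n; apply: measurable_funTS.
    by apply/(measurable_restrictT _ _).1 => //; apply: measurable_funTS; exact/measurable_EFinP.
  - by apply: measurable_funTS; exact/measurable_EFinP.
  - apply: aeW => x; rewrite /= in_itv/= andbT => x0.
    apply: cvg_near_cst; apply: filterS (nbhs_infty_ger x) => n xn.
    by rewrite /fn patchE mem_set//= in_itv/= x0.
  - exact: integrable_abse.
  - by apply: aeW => x n Dx; rewrite /fn patchE; case: ifP => //= _; rewrite normr0 lee_fin.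
have E n : (\int[mu]_(x in `[0%R, +oo[) fn n x)%E = (F n%:R - F 0)%:E.
  rewrite -(integral_FTC (ler0n _ n) cf dF) -integral_mkcondr.
  congr (integral _ _ _); apply/seteqP; split => x /=; rewrite !in_itv/= ?andbT.
    by case.
  by move=> /andP[x0 xn]; rewrite x0 xn.
have Fn : F n%:R @[n --> \oo] --> l.
  exact: (cvg_comp _ _ (@cvgr_idn R) Fl).
move: cv; rewrite (funext E) => cv.
have cv' : (F n%:R - F 0)%:E @[n --> \oo] --> (l - F 0)%:E.
  apply: cvg_EFin; first exact: nearW.
  by apply: cvgB => //; exact: cvg_cst.
exact: (cvg_unique _ cv cv').
Qed.

Lemma integral_scale (k : R) (f : R -> \bar R) : k != 0 ->
  mu.-integrable setT f ->
  (\int[mu]_x f (k * x)%R = (`|k|^-1)%:E * \int[mu]_x f x)%E.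
Proof.
move=> k0 fi; have mf := measurable_int mu fi.
have Ep : (\int[mu]_x (funepos (fun y => f (k * y)%R) x) =
    (`|k|^-1)%:E * \int[mu]_x (funepos f x))%E.
  rewrite -ge0_integral_scale//; last exact: measurable_funepos.
  by apply: eq_integral => x _; rewrite !funeposE.
have En : (\int[mu]_x (funeneg (fun y => f (k * y)%R) x) =
    (`|k|^-1)%:E * \int[mu]_x (funeneg f x))%E.
  rewrite -ge0_integral_scale//; last exact: measurable_funeneg.
  by apply: eq_integral => x _; rewrite !funenegE.
rewrite (integralE mu setT f) muleBr//; last exact: integrable_add_def.
by rewrite -Ep -En -integralE.
Qed.

Lemma integral_even (f : R -> \bar R) : mu.-integrable setT f ->
  (forall x, f (- x) = f x) ->
  (\int[mu]_x f x = 2%:E * \int[mu]_(x in `[0%R, +oo[) f x)%E.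
Proof.
move=> fi fe.
have mf := measurable_int mu fi.
rewrite mule_natl mule2n.
have -> : [set: measurableTypeR R] = `]-oo, 0[ `|` `[0, +oo[.
  by apply/seteqP; split => x //= _; rewrite !in_itv/= andbT; apply/orP; case: (ltP x 0).
rewrite integral_setU//; last 2 first.
- exact: measurable_funTS.
- rewrite disj_set2E; apply/eqP/seteqP; split => // x [] /=; rewrite !in_itv/= andbT => x0.
  by rewrite leNgt x0.
congr (_ + _)%E.
rewrite integral_mkcond.
transitivity (\int[mu]_x ((patch (fun=> 0%E) `]0%R, +oo[%classic f) (-1 * x)%R))%E.
  apply: eq_integral => x _; rewrite !patchE mulN1r fe.
  have -> : (x \in `]-oo, (0:R)[%classic) = (- x \in `]0, +oo[%classic); last by [].
  by rewrite !mem_setE !in_itv/= andbT oppr_gt0.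
rewrite integral_scale ?oppr_eq0 ?oner_eq0//.
  rewrite normrN1 invr1 mul1e -integral_mkcond integral_itv_obnd_cbnd//.
  exact: measurable_funTS.
by apply/(integrable_mkcond _ _).1 => //; exact: integrableS fi.
Qed.

End RealAnalysis.

(** * Half-line cosine and sine transforms of the Gaussian *)

Section GaussTrig.
Context {R : realType}.
Local Notation mu := (@lebesgue_measure R).
Local Notation T := (measurableTypeR R).

Definition gauss_half (y : R) : R := expR (- (y ^+ 2 / 2)).
Local Notation phi := gauss_half.

Lemma gauss_half_ge0 y : 0 <= phi y. Proof. exact: expR_ge0. Qed.

Lemma gauss_half0 : phi 0 = 1.
Proof. by rewrite /gauss_half expr0n/= mul0r oppr0 expR0. Qed.

Global Instance is_derive_gauss_half (y : R) : is_derive y 1 phi (- y * phi y).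
Proof.
rewrite /gauss_half; apply: is_derive_eq.
by rewrite /GRing.scale /=; field.
Qed.

Lemma continuous_gauss_half : continuous phi.
Proof. exact: is_derive_continuous is_derive_gauss_half. Qed.

Lemma cvg_gauss_half : phi y @[y --> +oo] --> (0 : R).
Proof.
rewrite /gauss_half; under eq_fun do rewrite mulrC.
exact: cvg_expR_sqr.
Qed.

Lemma integrable_gauss_half : mu.-integrable setT (EFin \o phi).
Proof.
apply/integrableP; split.
  by apply/measurable_EFinP; exact: measurable_gauss_half.
under eq_integral do rewrite /= ger0_norm ?gauss_half_ge0//.
by rewrite integral_gauss_half ltry.
Qed.

Lemma integrable_abs_gauss_half : mu.-integrable setT (fun y : T => (`|y| * phi y)%:E).
Proof.
pose p (r : R) : R := if (0 < r) && (0 <= r ^+ 2) then r * phi r else 0.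
have p0 r : 0 <= p r.
  by rewrite /p; case: ifP => // /andP[r0 _]; rewrite mulr_ge0 ?gauss_half_ge0// ltW.
have mphi : measurable_fun setT (phi : T -> R) by exact: measurable_gauss_half.
have mp : measurable_fun setT (p : T -> R).
  have mb : measurable_fun setT (fun r : T => (0 < r) && (0 <= r ^+ 2)).
    apply: measurable_and; first exact: measurable_fun_ltr.
    by apply: measurable_fun_ler => //; exact: measurable_funX.
  have mi : measurable_fun setT (fun r : T => r * phi r) by exact: measurable_funM.
  exact: (measurable_fun_ifT mb mi (measurable_cst (0 : R))).
have ip : mu.-integrable setT (EFin \o p).
  apply/integrableP; split; first exact/measurable_EFinP.
  under eq_integral do rewrite /= ger0_norm ?p0//.
  by rewrite integral_layer_gauss// ltry.
have ipN : mu.-integrable setT (fun y => (p (-1 * y))%:E).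
  apply/integrableP; split.
    apply/measurable_EFinP; apply: (measurableT_comp mp); exact: measurable_funM.
  under eq_integral do rewrite /= ger0_norm ?p0//.
  rewrite (@ge0_integral_scale _ (-1) (EFin \o p)) ?oppr_eq0 ?oner_eq0//.
  - by rewrite integral_layer_gauss// normrN1 invr1 mul1e ltry.
  - exact/measurable_EFinP.
apply: (eq_integrable measurableT _ _ _ (integrableD measurableT ip ipN)) => y _ /=.
rewrite -EFinD /p mulN1r !sqr_ge0 !andbT oppr_gt0 /gauss_half sqrrN.
case: (ltgtP 0 y) => [y0|y0|<-]; first by rewrite gtr0_norm// addr0.
- by rewrite ltr0_norm// add0r.
- by rewrite normr0 mul0r addr0.
Qed.

Lemma integrable_linear_gauss (D : set T) (h : R -> R) (c c' : R) :
  measurable D -> measurable_fun setT (h : T -> R) -> (forall y, `|h y| <= c + c' * `|y|) ->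
  mu.-integrable D (EFin \o (fun y => h y * phi y)).
Proof.
move=> mD mh hc.
apply: (@integrableS _ _ _ mu setT) => //.
have i1 := integrableZl measurableT c integrable_gauss_half.
have i2 := integrableZl measurableT c' integrable_abs_gauss_half.
apply: (le_integrable measurableT _ _ (integrableD measurableT i1 i2)).
  apply/measurable_EFinP; apply: measurable_funM => //.
  exact: measurable_gauss_half.
move=> y _ /=; rewrite lee_fin normrM (ger0_norm (gauss_half_ge0 y)).
apply: le_trans (ler_norm _).
by rewrite mulrA -mulrDl ler_wpM2r// gauss_half_ge0.
Qed.

Lemma integrable_bounded_gauss (D : set T) (h : R -> R) :
  measurable D -> measurable_fun setT (h : T -> R) -> (forall y, `|h y| <= 1) ->
  mu.-integrable D (EFin \o (fun y => h y * phi y)).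
Proof.
move=> mD mh h1; apply: (@integrable_linear_gauss _ _ 1 0) => // y.
by rewrite mul0r addr0.
Qed.

Lemma normr_sin_le1 (x : R) : `|sin x| <= 1.
Proof. by rewrite ler_norml sin_geN1 sin_le1. Qed.
Lemma normr_cos_le1 (x : R) : `|cos x| <= 1.
Proof. by rewrite ler_norml cos_geN1 cos_le1. Qed.

Lemma measurable_sin_lin (t : R) : measurable_fun setT (fun y : T => sin (t * y)).
Proof.
apply: (measurableT_comp (f := @sin R)); last exact: measurable_funM.
by apply: continuous_measurable_fun; exact: continuous_sin.
Qed.

Lemma measurable_cos_lin (t : R) : measurable_fun setT (fun y : T => cos (t * y)).
Proof.
apply: (measurableT_comp (f := @cos R)); last exact: measurable_funM.
by apply: continuous_measurable_fun; exact: continuous_cos.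
Qed.

Local Notation H := (`[0%R, +oo[%classic : set T).

Let mH : measurable H. Proof. exact: measurable_itv. Qed.

(** Multiplied by [2 / sqrt (2 * pi)], [half_cos] and [half_sin] are the real and imaginary part of
    the characteristic function of [|xi|]. Each satisfies a first-order linear differential
    equation, from which it is determined. *)
Definition half_cos (t : R) : R := \int[mu]_(y in H) (cos (t * y) * phi y).
Definition half_sin (t : R) : R := \int[mu]_(y in H) (sin (t * y) * phi y).

Let int_cos t : mu.-integrable H (EFin \o (fun y => cos (t * y) * phi y)).
Proof.
apply: integrable_bounded_gauss => //; first exact: measurable_cos_lin.
by move=> y; exact: normr_cos_le1.
Qed.

Let int_sin t : mu.-integrable H (EFin \o (fun y => sin (t * y) * phi y)).
Proof.
apply: integrable_bounded_gauss => //; first exact: measurable_sin_lin.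
by move=> y; exact: normr_sin_le1.
Qed.

Let int_ysin t : mu.-integrable H (EFin \o (fun y => y * sin (t * y) * phi y)).
Proof.
apply: (@integrable_linear_gauss _ (fun y => y * sin (t * y)) 0 1) => //.
  by apply: measurable_funM => //; exact: measurable_sin_lin.
by move=> y; rewrite add0r mul1r normrM ler_piMr// normr_sin_le1.
Qed.

Let int_ycos t : mu.-integrable H (EFin \o (fun y => y * cos (t * y) * phi y)).
Proof.
apply: (@integrable_linear_gauss _ (fun y => y * cos (t * y)) 0 1) => //.
  by apply: measurable_funM => //; exact: measurable_cos_lin.
by move=> y; rewrite add0r mul1r normrM ler_piMr// normr_cos_le1.
Qed.

Let int_absphi (D : set T) : measurable D -> mu.-integrable D (EFin \o (fun y => `|y| * phi y)).
Proof.
move=> mD; apply: (@integrableS _ _ _ mu setT) => //.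
exact: integrable_abs_gauss_half.
Qed.

Let is_derive_half_cos0 (t : R) :
  is_derive t 1 half_cos (\int[mu]_(y in H) (- (y * sin (t * y) * phi y))).
Proof.
apply: (@is_derive_under_integral _ _ _ mu H
  (fun t y => cos (t * y) * phi y) (fun t y => - (y * sin (t * y) * phi y))
  (fun y => `|y| * phi y)) => //.
- move=> x y _; apply: is_derive_eq; rewrite /GRing.scale/=.
  by rewrite mulr1 mulr0 add0r; ring.
- by move=> y; rewrite mulr_ge0 ?gauss_half_ge0.
- exact: int_absphi.
- move=> x y _; rewrite normrN !normrM (ger0_norm (gauss_half_ge0 y)).
  by rewrite ler_wpM2r ?gauss_half_ge0// ler_piMr// normr_sin_le1.
Qed.

Let is_derive_half_sin0 (t : R) :
  is_derive t 1 half_sin (\int[mu]_(y in H) (y * cos (t * y) * phi y)).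
Proof.
apply: (@is_derive_under_integral _ _ _ mu H
  (fun t y => sin (t * y) * phi y) (fun t y => (y * cos (t * y) * phi y))
  (fun y => `|y| * phi y)) => //.
- move=> x y _; apply: is_derive_eq; rewrite /GRing.scale/=.
  by rewrite mulr1 mulr0 add0r; ring.
- by move=> y; rewrite mulr_ge0 ?gauss_half_ge0.
- exact: int_absphi.
- move=> x y _; rewrite !normrM (ger0_norm (gauss_half_ge0 y)).
  by rewrite ler_wpM2r ?gauss_half_ge0// ler_piMr// normr_cos_le1.
Qed.

Lemma cvg_bounded_gauss (h : R -> R) : (forall y, `|h y| <= 1) ->
  h y * phi y @[y --> +oo] --> (0 : R).
Proof.
move=> h1; apply: norm_cvg0.
apply: (@squeeze_cvgr _ _ _ _ (cst 0) phi); last 2 first.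
- exact: cvg_cst.
- exact: cvg_gauss_half.
apply: nearW => y; rewrite normr_ge0/= normrM (ger0_norm (gauss_half_ge0 y)).
by rewrite ler_piMl// gauss_half_ge0.
Qed.

(* The boundary terms of these two integrations by parts are [0] and [1]. *)
Lemma is_derive_half_cos (t : R) : is_derive t 1 half_cos (- t * half_cos t).
Proof.
suff <- : \int[mu]_(y in H) (- (y * sin (t * y) * phi y)) = - t * half_cos t.
  exact: is_derive_half_cos0.
have dF (y : R) : is_derive y 1 (fun y => sin (t * y) * phi y)
    (t * (cos (t * y) * phi y) - y * sin (t * y) * phi y).
  apply: is_derive_eq; rewrite /GRing.scale/=.
  by ring.
have cf : continuous (fun y : R => t * (cos (t * y) * phi y) - y * sin (t * y) * phi y).
  move=> y; apply: differentiable_continuous; apply/derivable1_diffP.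
  exact: ex_derive.
have fi : mu.-integrable H (EFin \o (fun y => t * (cos (t * y) * phi y) - y * sin (t * y) * phi y)).
  exact: (eq_integrable mH _ _ _ (integrableB mH (integrableZl mH t (int_cos t)) (int_ysin t))).
have := integral_FTCy cf dF fi (cvg_bounded_gauss (fun y => normr_sin_le1 (t * y))).
rewrite mulr0 sin0 mul0r subrr => E.
have : \int[mu]_(y in H) (t * (cos (t * y) * phi y) - y * sin (t * y) * phi y) = 0.
  by rewrite /Rintegral E.
rewrite RintegralB//; last first.
  exact: (integrableZl mH t (int_cos t)).
rewrite RintegralZl//.
move=> /subr0_eq E'.
transitivity (- \int[mu]_(y in H) (y * sin (t * y) * phi y)); last by rewrite -E' mulNr.
rewrite -[RHS]mulN1r -RintegralZl//.
by apply: eq_Rintegral => y _; rewrite mulN1r.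
Qed.

Lemma is_derive_half_sin (t : R) : is_derive t 1 half_sin (1 - t * half_sin t).
Proof.
suff <- : \int[mu]_(y in H) (y * cos (t * y) * phi y) = 1 - t * half_sin t.
  exact: is_derive_half_sin0.
have dF (y : R) : is_derive y 1 (fun y => cos (t * y) * phi y)
    (-1 * (t * (sin (t * y) * phi y)) - y * cos (t * y) * phi y).
  apply: is_derive_eq; rewrite /GRing.scale/=.
  by ring.
have cf : continuous (fun y : R => -1 * (t * (sin (t * y) * phi y)) - y * cos (t * y) * phi y).
  move=> y; apply: differentiable_continuous; apply/derivable1_diffP.
  exact: ex_derive.
have its := integrableZl mH t (int_sin t).
have fi : mu.-integrable H (EFin \o (fun y => -1 * (t * (sin (t * y) * phi y)) - y * cos (t * y) * phi y)).
  exact: (eq_integrable mH _ _ _ (integrableB mH (integrableZl mH (-1) its) (int_ycos t))).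
have := integral_FTCy cf dF fi (cvg_bounded_gauss (fun y => normr_cos_le1 (t * y))).
rewrite mulr0 cos0 mul1r gauss_half0 sub0r => E.
have : \int[mu]_(y in H) (-1 * (t * (sin (t * y) * phi y)) - y * cos (t * y) * phi y) = -1.
  by rewrite /Rintegral E.
rewrite RintegralB//; last exact: (integrableZl mH (-1) its).
rewrite RintegralZl// RintegralZl// -/(half_sin t) => E'.
rewrite -[LHS]opprK -[X in - X](addKr (-1 * (t * half_sin t))) E'.
by ring.
Qed.

End GaussTrig.

Section AbsoluteNormal.
Context {R : realType}.
Local Notation mu := (@lebesgue_measure R).
Local Notation T := (measurableTypeR R).
Local Notation phi := gauss_half.
Local Notation H := (`[0%R, +oo[%classic : set T).

Lemma integral_abs_even (h : R -> R) : measurable_fun setT (h : T -> R) ->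
  (forall y, `|h y| <= 1) ->
  (\int[mu]_y (h `|y| * phi y)%:E = (2 * \int[mu]_(y in H) (h y * phi y))%:E)%E.
Proof.
move=> mh h1.
have mha : measurable_fun setT (fun y : T => h `|y|).
  by apply: (measurableT_comp mh); exact: normr_measurable.
have i1 := @integrable_bounded_gauss _ setT (fun y => h `|y|) measurableT mha (fun y => h1 _).
have mH : measurable H by exact: measurable_itv.
have i2 := @integrable_bounded_gauss _ H h mH mh h1.
rewrite integral_even//; last by move=> y; rewrite normrN /gauss_half sqrrN.
rewrite EFinM /Rintegral fineK; last exact: integrable_fin_num.
congr (_ * _)%E; apply: eq_integral => y; rewrite inE/= in_itv/= andbT => y0.
by rewrite ger0_norm.
Qed.

(** The equation [f' = - t * f] makes [f t * exp (t ^ 2 / 2)] constant, and the value at [0] is half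
    of the Gaussian integral. *)
Lemma half_cosE (t : R) : half_cos t = Num.sqrt (2 * pi) / 2 * phi t.
Proof.
have : half_cos t * expR (t ^+ 2 / 2) = half_cos 0 * expR (0 ^+ 2 / 2).
  apply: (is_derive_0_is_cst (f := fun t => half_cos t * expR (t ^+ 2 / 2))) => x.
  have dc := is_derive_half_cos x.
  apply: is_derive_eq; rewrite /GRing.scale/=.
  by field.
rewrite expr0n/= mul0r expR0 mulr1 => E.
have -> : half_cos t = half_cos 0 * phi t.
  by rewrite -E -mulrA /gauss_half -expRD addrN expR0 mulr1.
congr (_ * _).
have E2 : \int[mu]_(y in H) phi y = Num.sqrt (2 * pi) / 2.
  have := @integral_abs_even (cst 1) (measurable_cst _) (fun=> _).
  rewrite /cst normr1 => /(_ (fun=> lexx _)).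
  under eq_integral do rewrite mul1r.
  under eq_Rintegral do rewrite mul1r.
  rewrite (integral_gauss_half : (\int[mu]_x (phi x)%:E = _)%E) => -[] ->.
  by field.
by rewrite -E2; apply: eq_Rintegral => y _; rewrite mul0r cos0 mul1r.
Qed.

Lemma half_sin0 : half_sin (0 : R) = 0.
Proof.
rewrite /half_sin; under eq_Rintegral do rewrite mul0r sin0 mul0r.
by rewrite Rintegral_cst// mul0r.
Qed.

(* [dawson t] is the integral of [exp (u^2 / 2)] over [0, t]. *)
Definition dawson (t : R) : R := half_sin t * expR (t ^+ 2 / 2).

Global Instance is_derive_dawson (t : R) : is_derive t 1 dawson (expR (t ^+ 2 / 2)).
Proof.
have ds := is_derive_half_sin t.
apply: is_derive_eq; rewrite /GRing.scale/=.
by field.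
Qed.

Lemma dawson0 : dawson (0 : R) = 0. Proof. by rewrite /dawson half_sin0 mul0r. Qed.

Lemma half_sinE (t : R) : half_sin t = phi t * dawson t.
Proof. by rewrite /dawson mulrCA /gauss_half -expRD addNr expR0 mulr1. Qed.

Lemma integral_cos_abs (t : R) :
  (\int[mu]_y (cos (t * `|y|) * phi y)%:E = (Num.sqrt (2 * pi) * phi t)%:E)%E.
Proof.
rewrite (@integral_abs_even (fun y => cos (t * y))).
- by rewrite -/(half_cos t) half_cosE; congr EFin; field.
- exact: measurable_cos_lin.
- by move=> y; exact: normr_cos_le1.
Qed.

Lemma integral_sin_abs (t : R) :
  (\int[mu]_y (sin (t * `|y|) * phi y)%:E = (2 * half_sin t)%:E)%E.
Proof.
rewrite (@integral_abs_even (fun y => sin (t * y)))//.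
- exact: measurable_sin_lin.
- by move=> y; exact: normr_sin_le1.
Qed.

Lemma integral_cos (t : R) :
  (\int[mu]_y (cos (t * y) * phi y)%:E = (Num.sqrt (2 * pi) * phi t)%:E)%E.
Proof.
rewrite -integral_cos_abs; apply: eq_integral => y _.
by case: (ger0P y) => // _; rewrite mulrN cosN.
Qed.

End AbsoluteNormal.

(** * Gaussian tails as sine integrals *)

Section GaussTail.
Context {R : realType}.
Local Notation mu := (@lebesgue_measure R).
Local Notation T := (measurableTypeR R).
Local Notation phi := gauss_half.

Lemma normr_sin_le (x : R) : `|sin x| <= `|x|.
Proof.
have cs : forall a b : R, {within `[a, b], continuous (@sin R)}.
  by move=> a b; apply: continuous_subspaceT; exact: continuous_sin.
have [x0|x0] := leP 0 x.
  have [c _] := @MVT_segment R sin cos 0 x x0 (fun y _ => is_derive_sin y) (cs _ _).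
  by rewrite sin0 !subr0 => ->; rewrite normrM ler_piMl// normr_cos_le1.
have [c _] := @MVT_segment R sin cos x 0 (ltW x0) (fun y _ => is_derive_sin y) (cs _ _).
rewrite sin0 !sub0r mulrN => /oppr_inj ->.
by rewrite normrM ler_piMl// normr_cos_le1.
Qed.

Lemma measurable_inv_real : measurable_fun [set: T] (fun t : T => t^-1 : R).
Proof.
have -> : (fun t : T => t^-1) = (fun t : T => if t == 0 then 0 else t^-1) :> (T -> R).
  by apply/funext => t; case: eqP => // ->; rewrite invr0.
apply: measurable_fun_if => //; first exact: measurable_fun_eqr.
rewrite setTI (_ : _ @^-1` _ = [set t | t != 0]); last first.
  by apply/seteqP; split => t /=; case: (t == 0).
apply: open_continuous_measurable_fun; first exact: open_neq.
by move=> t; rewrite inE => /=; exact: inv_continuous.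
Qed.

(** At [t = 0] the quotient is continued by its limit [b], which keeps the derivative in [b] equal
    to [cos (t * b)] for every [t]. *)
Definition sinck (b t : R) : R := if t == 0 then b else sin (t * b) / t.

Lemma normr_sinck b t : `|sinck b t| <= `|b|.
Proof.
rewrite /sinck; case: eqVneq => // t0.
rewrite normrM normfV ler_pdivrMr ?normr_gt0// mulrC -normrM.
exact: normr_sin_le.
Qed.

Lemma measurable_sinck b : measurable_fun [set: T] (fun t : T => sinck b t : R).
Proof.
have mb : measurable_fun setT (fun t : T => t == 0 :> R) by exact: measurable_fun_eqr.
have ms : measurable_fun setT (fun t : T => sin (t * b) / t).
  apply: measurable_funM; last exact: measurable_inv_real.
  under eq_fun do rewrite mulrC.
  exact: measurable_sin_lin.
exact: (measurable_fun_ifT mb (measurable_cst b) ms).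
Qed.

Lemma is_derive_sinck (t b : R) : is_derive b 1 (fun b : R => sinck b t) (cos (t * b)).
Proof.
rewrite /sinck; case: eqVneq => [->|t0].
  by rewrite mul0r cos0; exact: is_derive_id.
apply: is_derive_eq; rewrite /GRing.scale/=.
by rewrite ?mulr1; field.
Qed.

Let int_sinck b : mu.-integrable setT (EFin \o (fun t => sinck b t * phi t)).
Proof.
apply: (@integrable_linear_gauss _ _ _ `|b| 0) => //; first exact: measurable_sinck.
by move=> t; rewrite mul0r addr0 normr_sinck.
Qed.

(** This is [pi * (2 * Phi b - 1)], the Gil-Pelaez integral of one normal variable; it is evaluated
    through its derivative in [b]. *)
Definition sinc_transform (b : R) : R := \int[mu]_t (sinck b t * phi t).

(** Differentiation under the integral removes the denominator [t] and leaves the cosine transform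
    of the Gaussian. *)
Lemma is_derive_sinc_transform (b : R) :
  is_derive b 1 sinc_transform (Num.sqrt (2 * pi) * phi b).
Proof.
have -> : Num.sqrt (2 * pi) * phi b = \int[mu]_t (cos (t * b) * phi t).
  rewrite /Rintegral -[LHS]/(fine (Num.sqrt (2 * pi) * phi b)%:E) -integral_cos.
  by congr fine; apply: eq_integral => t _; rewrite [t * b]mulrC.
apply: (@is_derive_under_integral _ _ _ mu setT
  (fun b t => sinck b t * phi t) (fun b t => cos (t * b) * phi t) phi) => //.
- move=> x t _; have ds := is_derive_sinck t x.
  by apply: is_derive_eq; rewrite /GRing.scale/= mulr0 add0r mulrC.
- by move=> t; exact: gauss_half_ge0.
- exact: integrable_gauss_half.
- move=> x t _; rewrite normrM (ger0_norm (gauss_half_ge0 _)).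
  by rewrite ler_piMl ?gauss_half_ge0// normr_cos_le1.
Qed.

Lemma sinc_transform0 : sinc_transform 0 = 0.
Proof.
rewrite /sinc_transform; under eq_Rintegral => t _.
  rewrite (_ : sinck 0 t = 0) ?mul0r; last first.
    by rewrite /sinck mulr0 sin0 mul0r; case: ifP.
  over.
by rewrite Rintegral_cst// mul0r.
Qed.

(** Half the Gaussian integral minus its part over [[0, b]], for which [sinc_transform] divided by
    [sqrt (2 * pi)] is a primitive. *)
Lemma gauss_tail (b : R) : 0 <= b ->
  (\int[mu]_(x in `[b, +oo[) (phi x)%:E =
   (Num.sqrt (2 * pi) / 2 - sinc_transform b / Num.sqrt (2 * pi))%:E)%E.
Proof.
move=> b0; set s2 := Num.sqrt (2 * pi).
have s0 : 0 < s2 by rewrite sqrtr_gt0 mulr_gt0// pi_gt0.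
have Hf : (\int[mu]_(x in `[0%R, +oo[) (phi x)%:E = (s2 / 2)%:E)%E.
  have := half_cosE (0 : R); rewrite gauss_half0 mulr1 /half_cos => <-.
  under [in RHS]eq_Rintegral do rewrite mul0r cos0 mul1r.
  rewrite /Rintegral fineK//; apply: integrable_fin_num => //.
  by apply: integrableS integrable_gauss_half.
have cphi : continuous (fun x : R => s2^-1 * (s2 * phi x)).
  move=> x; apply: differentiable_continuous; apply/derivable1_diffP.
  exact: ex_derive.
have dF (x : R) : is_derive x 1 (fun x => s2^-1 * sinc_transform x) (s2^-1 * (s2 * phi x)).
  have ds := is_derive_sinc_transform x.
  by apply: is_derive_eq; rewrite /GRing.scale/= -/s2; ring.
have := integral_FTC b0 cphi dF; rewrite sinc_transform0 mulr0 subr0 => Hb.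
move: Hf; rewrite (@itv_bndbnd_setU _ _ _ (BLeft b))// ?bnd_simp//.
rewrite ge0_integral_setU//=; last 3 first.
- by apply/measurable_EFinP; apply: measurable_funTS; exact: measurable_gauss_half.
- by move=> x _; rewrite lee_fin gauss_half_ge0.
- rewrite disj_set2E; apply/eqP/seteqP; split => // x [] /=; rewrite !in_itv/= andbT.
  by move=> /andP[_ xb]; rewrite leNgt xb.
rewrite integral_itv_bndo_bndc; last first.
  by apply/measurable_EFinP; apply: measurable_funTS; exact: measurable_gauss_half.
have -> : (\int[mu]_(x in `[0%R, b]) (phi x)%:E = (sinc_transform b / s2)%:E)%E.
  rewrite mulrC -Hb; apply: eq_integral => x _.
  by rewrite mulKf// gt_eqF.
case: (integral _ _ _) => [r| |] //=.
by rewrite -EFinD => -[] <-; congr EFin; ring.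
Qed.

End GaussTail.

(** * Gil-Pelaez inversion *)

Section GilPelaez.
Context {R : realType}.
Local Notation mu := (@lebesgue_measure R).
Local Notation T := (measurableTypeR R).
Local Notation phi := (@gauss_half R).
Local Notation s2 := (Num.sqrt (2 * pi) : R).

Lemma sqrt2pi_gt0 : 0 < s2.
Proof. by rewrite sqrtr_gt0 mulr_gt0// pi_gt0. Qed.

(* The characteristic function of [`|xi|] at [u] is [phi u + i * abs_gauss_im u];
   [abs_gauss_pow n u] holds the real and imaginary parts of its [n]-th power. *)
Definition abs_gauss_im (u : R) : R := 2 * half_sin u / s2.
Local Notation hs := abs_gauss_im.

Fixpoint abs_gauss_pow (n : nat) (u : R) : R * R :=
  if n is n'.+1 then
    let z := abs_gauss_pow n' u in
    (phi u * z.1 - hs u * z.2, phi u * z.2 + hs u * z.1)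
  else (1, 0).
Local Notation zp := abs_gauss_pow.

Lemma gauss_half_le1 u : phi u <= 1.
Proof. by rewrite -expR0 ler_expR oppr_le0 mulr_ge0// sqr_ge0. Qed.

(** The first bound gives [|hs u| <= 1]. The second, linear at [0], is what later makes the quotient
    by [t] integrable near [t = 0]. *)
Lemma half_sin_bounds : (forall u : R, `|half_sin u| <= s2 / 2) /\
  exists2 c : R, 0 <= c & forall u : R, `|half_sin u| <= c * `|u|.
Proof.
pose H := (`[0%R, +oo[%classic : set T).
have mH : measurable H by exact: measurable_itv.
have i1 u : mu.-integrable H (EFin \o (fun y => sin (u * y) * phi y)).
  apply: integrable_bounded_gauss => //; first exact: measurable_sin_lin.
  by move=> y; exact: normr_sin_le1.
have i3 : mu.-integrable H (EFin \o (fun y => `|y| * phi y)).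
  apply: (@integrableS _ _ _ mu setT) => //; exact: integrable_abs_gauss_half.
have i2 : mu.-integrable H (EFin \o phi).
  by apply: (@integrableS _ _ _ mu setT) => //; exact: integrable_gauss_half.
split=> [u|].
  have -> : s2 / 2 = \int[mu]_(y in H) phi y.
    have := half_cosE (0 : R); rewrite gauss_half0 mulr1 /half_cos => <-.
    by apply: eq_Rintegral => y _; rewrite mul0r cos0 mul1r.
  rewrite /half_sin; apply: le_trans (le_normr_Rintegral _ _) _ => //.
  apply: le_Rintegral => //; first exact: integrable_norm.
  move=> y _; rewrite normrM (ger0_norm (gauss_half_ge0 _)).
  by rewrite ler_piMl ?gauss_half_ge0// normr_sin_le1.
exists (\int[mu]_(y in H) (`|y| * phi y)).
  by apply: Rintegral_ge0 => y _; rewrite mulr_ge0// gauss_half_ge0.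
move=> u; rewrite mulrC -RintegralZl//.
rewrite /half_sin; apply: le_trans (le_normr_Rintegral _ _) _ => //.
apply: le_Rintegral => //; first exact: integrable_norm.
  exact: (integrableZl mH `|u| i3).
move=> y _; rewrite normrM (ger0_norm (gauss_half_ge0 _)) mulrA.
by rewrite ler_wpM2r ?gauss_half_ge0// -normrM normr_sin_le.
Qed.

Lemma normr_abs_gauss_im_le1 u : `|hs u| <= 1.
Proof.
have [/(_ u) h _] := half_sin_bounds; have s0 := sqrt2pi_gt0.
rewrite normrM normfV (gtr0_norm s0) ler_pdivrMr// mul1r normrM gtr0_norm//.
by rewrite mulrC -ler_pdivlMr.
Qed.

(** The modulus is in fact at most [1], but any bound uniform in [u] suffices for integrability
    against a Gaussian. *)
Lemma abs_gauss_pow_bounded n u : `|(zp n u).1| <= 2 ^+ n /\ `|(zp n u).2| <= 2 ^+ n.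
Proof.
have p1 : `|phi u| <= 1 by rewrite ger0_norm ?gauss_half_ge0// gauss_half_le1.
have q1 := normr_abs_gauss_im_le1 u.
elim: n => [|n [IH1 IH2]] /=; first by rewrite normr1 normr0 expr0 ler01.
have bd (p q a b : R) : `|p| <= 1 -> `|q| <= 1 -> `|a| <= 2 ^+ n -> `|b| <= 2 ^+ n ->
    `|p * a| + `|q * b| <= 2 ^+ n.+1.
  move=> hp hq ha hb; rewrite exprS mulr_natl mulr2n !normrM.
  by rewrite lerD// -[leRHS]mul1r ler_pM.
split.
  by apply: le_trans (ler_normB _ _) _; exact: bd.
by apply: le_trans (ler_normD _ _) _; exact: bd.
Qed.

Lemma abs_gauss_pow_im_linear n :
  exists2 K, 0 <= K & forall u, `|(zp n u).2| <= K * `|u|.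
Proof.
have [_ [c c0 hc]] := half_sin_bounds; have s0 := sqrt2pi_gt0.
elim: n => [|n [K K0 IH]]; first by exists 0 => // u; rewrite normr0 mul0r.
exists (K + 2 * c / s2 * 2 ^+ n).
  by rewrite addr_ge0// mulr_ge0 ?exprn_ge0// divr_ge0 ?mulr_ge0// ltW.
move=> u /=; have [z1 z2] := abs_gauss_pow_bounded n u.
have p1 : `|phi u| <= 1 by rewrite ger0_norm ?gauss_half_ge0// gauss_half_le1.
apply: le_trans (ler_normD _ _) _; rewrite mulrDl lerD//.
  by rewrite normrM -[leRHS]mul1r ler_pM.
have hsb : `|hs u| <= 2 * c / s2 * `|u|.
  have -> : 2 * c / s2 * `|u| = 2 * (c * `|u|) / s2 by ring.
  rewrite normrM normfV (gtr0_norm s0) ler_wpM2r ?invr_ge0 ?(ltW s0)//.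
  by rewrite normrM gtr0_norm// ler_wpM2l.
by rewrite normrM mulrAC ler_pM.
Qed.

Lemma measurable_abs_gauss_pow n :
  measurable_fun setT (fun u : T => (zp n u).1) /\
  measurable_fun setT (fun u : T => (zp n u).2).
Proof.
have mp : measurable_fun setT (phi : T -> R) by exact: measurable_gauss_half.
have mh : measurable_fun setT (hs : T -> R).
  apply: measurable_funM => //; apply: measurable_funM => //.
  apply: continuous_measurable_fun; exact: is_derive_continuous is_derive_half_sin.
elim: n => [|n [IH1 IH2]] /=; first by split; exact: measurable_cst.
split; first by apply: measurable_funB; exact: measurable_funM.
by apply: measurable_funD; exact: measurable_funM.
Qed.

End GilPelaez.

Section GilPelaezStep.
Context {R : realType}.
Local Notation mu := (@lebesgue_measure R).
Local Notation T := (measurableTypeR R).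
Local Notation phi := (@gauss_half R).
Local Notation s2 := (Num.sqrt (2 * pi) : R).
Local Notation zp := (@abs_gauss_pow R).
Variable sigma : R.
Hypothesis sigma0 : 0 <= sigma.

(** Imaginary and, below, real part of the characteristic function of [a + |xi_1| + ... + |xi_n|] at
    [sigma * t]. The shift [a] is kept free because it absorbs the next absolute value in the
    induction. *)
Definition shifted_im (n : nat) (a t : R) : R :=
  sin (sigma * t * a) * (zp n (sigma * t)).1 + cos (sigma * t * a) * (zp n (sigma * t)).2.
Definition shifted_re (n : nat) (a t : R) : R :=
  cos (sigma * t * a) * (zp n (sigma * t)).1 - sin (sigma * t * a) * (zp n (sigma * t)).2.

Lemma shifted_imD n a b t : shifted_im n (a + b) t =
  shifted_im n a t * cos (sigma * t * b) + shifted_re n a t * sin (sigma * t * b).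
Proof. by rewrite /shifted_im /shifted_re mulrDr sinD cosD; ring. Qed.

(** The bound grows only linearly in [a], so it survives the substitution of [a + |y|] for [a] and
    the integration of [y] against a Gaussian. *)
Lemma normr_shifted_im n : exists2 K, 0 <= K & forall a t,
  `|shifted_im n a t / t| <= sigma * 2 ^+ n * `|a| + K.
Proof.
have [K K0 hK] := @abs_gauss_pow_im_linear R n.
exists (sigma * K); first by rewrite mulr_ge0.
(* At [t = 0] the quotient is [0], by the convention for the inverse of [0]. *)
move=> a t; have [->|t0] := eqVneq t 0.
  by rewrite invr0 mulr0 normr0 addr_ge0 ?mulr_ge0// exprn_ge0.
rewrite normrM normfV ler_pdivrMr ?normr_gt0//.
apply: le_trans (ler_normD _ _) _; rewrite mulrDl lerD// normrM.
  have [z1 _] := abs_gauss_pow_bounded n (sigma * t).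
  apply: le_trans (ler_pM _ _ (normr_sin_le _) z1) _ => //.
  by rewrite !normrM (ger0_norm sigma0) le_eqVlt; apply/orP; left; apply/eqP; ring.
apply: le_trans (ler_pM _ _ (normr_cos_le1 _) (hK _)) _ => //.
by rewrite normrM (ger0_norm sigma0) mul1r le_eqVlt; apply/orP; left; apply/eqP; ring.
Qed.

Lemma measurable_shifted_im n disp (X : measurableType disp) (a t : X -> R) :
  measurable_fun setT a -> measurable_fun setT t ->
  measurable_fun setT (fun x => shifted_im n (a x) (t x) / t x).
Proof.
move=> ma mt; have [m1 m2] := measurable_abs_gauss_pow (R := R) n.
have mst : measurable_fun setT (fun x => sigma * t x) by exact: measurable_funM.
have msta : measurable_fun setT (fun x => sigma * t x * a x) by exact: measurable_funM.
apply: measurable_funM; last exact: (measurableT_comp measurable_inv_real mt).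
apply: measurable_funD; apply: measurable_funM.
- apply: (measurableT_comp (f := @sin R)) => //.
  by apply: continuous_measurable_fun; exact: continuous_sin.
- exact: (measurableT_comp m1 mst).
- apply: (measurableT_comp (f := @cos R)) => //.
  by apply: continuous_measurable_fun; exact: continuous_cos.
- exact: (measurableT_comp m2 mst).
Qed.

Lemma integrable_shifted n a : mu.-integrable setT (EFin \o (fun t => shifted_im n a t / t * phi t)).
Proof.
have [K K0 hK] := normr_shifted_im n.
apply: (@integrable_linear_gauss _ _ _ (sigma * 2 ^+ n * `|a| + K) 0) => //.
  exact: (@measurable_shifted_im n _ T (cst a) id).
by move=> t; rewrite mul0r addr0.
Qed.

Definition gil_pelaez_int (n : nat) (a : R) : R := \int[mu]_t (shifted_im n a t / t * phi t).

(** By the addition formulas, averaging over [|y|] multiplies by the characteristic function of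
    [|xi|], which is the recursion of [abs_gauss_pow]. *)
Lemma integral_shifted_im n a t :
  mu.-integrable setT (fun y : T => (shifted_im n (a + `|y|) t * phi y)%:E) /\
  (\int[mu]_y (shifted_im n (a + `|y|) t * phi y)%:E = (s2 * shifted_im n.+1 a t)%:E)%E.
Proof.
have ic u : mu.-integrable setT (EFin \o (fun y => cos (u * `|y|) * phi y)).
  apply: (@integrable_bounded_gauss _ _ (fun y => cos (u * `|y|))) => //.
    by apply: (measurableT_comp (measurable_cos_lin u)); exact: normr_measurable.
  by move=> y; exact: normr_cos_le1.
have is_ u : mu.-integrable setT (EFin \o (fun y => sin (u * `|y|) * phi y)).
  apply: (@integrable_bounded_gauss _ _ (fun y => sin (u * `|y|))) => //.
    by apply: (measurableT_comp (measurable_sin_lin u)); exact: normr_measurable.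
  by move=> y; exact: normr_sin_le1.
have E y : ((shifted_im n (a + `|y|) t * phi y)%:E =
    (shifted_im n a t)%:E * (cos (sigma * t * `|y|) * phi y)%:E +
    (shifted_re n a t)%:E * (sin (sigma * t * `|y|) * phi y)%:E)%E.
  by rewrite shifted_imD -!EFinM -EFinD; congr EFin; ring.
have i1 := integrableZl measurableT (shifted_im n a t) (ic (sigma * t)).
have i2 := integrableZl measurableT (shifted_re n a t) (is_ (sigma * t)).
split.
  by apply: (eq_integrable measurableT _ _ _ (integrableD measurableT i1 i2)) => y _; rewrite E.
under eq_integral do rewrite E.
rewrite (integralD measurableT i1 i2).
rewrite (integralZl measurableT (ic (sigma * t))) (integralZl measurableT (is_ (sigma * t))).
rewrite integral_cos_abs integral_sin_abs -!EFinM -EFinD; congr EFin.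
have s0 := @sqrt2pi_gt0 R.
rewrite /shifted_im /shifted_re /= /abs_gauss_im.
by field; rewrite gt_eqF.
Qed.

Let fub n a (p : T * T) : \bar R :=
  (shifted_im n (a + `|p.1|) p.2 / p.2 * phi p.2 * phi p.1)%:E.

Let measurable_fub n a : measurable_fun setT (fub n a).
Proof.
have mphi : measurable_fun setT (phi : T -> R) by exact: measurable_gauss_half.
apply/measurable_EFinP; apply: measurable_funM.
  apply: measurable_funM; last exact: (measurableT_comp mphi measurable_snd).
  apply: (@measurable_shifted_im n _ _ (fun p : T * T => a + `|p.1|) (fun p : T * T => p.2)).
    apply: measurable_funD => //.
    exact: (measurableT_comp (@normr_measurable _ setT) measurable_fst).
  exact: measurable_snd.
exact: (measurableT_comp mphi measurable_fst).
Qed.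

(** The absolute value is at most [(c + c' * |y|) * phi y * phi t], which is integrable in both
    variables. *)
Let integrable_fub n a : (mu \x mu)%E.-integrable setT (fub n a).
Proof.
have [K K0 hK] := normr_shifted_im n.
apply/integrable12ltyP; first exact: (@measurable_fub n a).
pose c := sigma * 2 ^+ n * `|a| + K; pose c' := sigma * 2 ^+ n.
have c0 : 0 <= c by rewrite addr_ge0 ?mulr_ge0// exprn_ge0.
have c'0 : 0 <= c' by rewrite mulr_ge0// exprn_ge0.
have s0 := @sqrt2pi_gt0 R.
have mphi : measurable_fun setT (phi : T -> R) by exact: measurable_gauss_half.
have il : mu.-integrable setT (EFin \o (fun y => s2 * (c + c' * `|y|) * phi y)).
  apply: (@integrable_linear_gauss _ _ (fun y => s2 * (c + c' * `|y|)) (s2 * c) (s2 * c')) => //.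
    apply: measurable_funM => //; apply: measurable_funD => //.
    by apply: measurable_funM => //; exact: normr_measurable.
  move=> y; rewrite ger0_norm.
    by rewrite mulrDr mulrA.
  by rewrite mulr_ge0 ?(ltW s0)// addr_ge0// mulr_ge0.
have /integrableP[_] := il; apply: le_lt_trans.
apply: ge0_le_integral => //.
- by move=> y _; exact: integral_ge0.
- apply: (measurable_fun_fubini_tonelli_F (m2 := mu) (abse \o fub n a)) => //.
    by apply: measurableT_comp => //; exact: (@measurable_fub n a).
  by move=> p; exact: abse_ge0.
- by apply: measurableT_comp => //; exact: measurable_int il.
move=> y _ /=.
apply: (@le_trans _ _ (\int[mu]_t (((c + c' * `|y|) * phi y)%:E * (phi t)%:E))%E).
  apply: ge0_le_integral => //.
  - have m := @measurable_fub n a.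
    have mt : measurable_fun setT (fun t : T => fub n a (y, t)).
      by apply: (measurableT_comp m); exact: measurable_pair1.
    move/measurable_EFinP : mt => mt; apply/measurable_EFinP.
    exact: (measurableT_comp (@normr_measurable _ setT) mt).
  - apply/measurable_EFinP; exact: measurable_funM.
  move=> t _; rewrite -EFinM lee_fin !normrM !(ger0_norm (gauss_half_ge0 _)) mulrAC.
  rewrite ler_wpM2r ?gauss_half_ge0// ler_wpM2r ?gauss_half_ge0// -normrM.
  apply: le_trans (hK _ _) _.
  rewrite /c /c' -addrA [K + _]addrC addrA lerD2r -mulrDr ler_wpM2l//.
  by rewrite (le_trans (ler_normD _ _))// normr_id.
rewrite ge0_integralZl//=.
- rewrite (integral_gauss_half : (\int[mu]_x (phi x)%:E = _)%E) lee_fin.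
  have -> : (c + c' * `|y|) * phi y * s2 = s2 * (c + c' * `|y|) * phi y by ring.
  exact: ler_norm.
- exact/measurable_EFinP.
- by move=> x _; rewrite lee_fin gauss_half_ge0.
- by rewrite lee_fin mulr_ge0 ?gauss_half_ge0// addr_ge0// mulr_ge0.
Qed.

(** One double integral read in two orders: integrating [t] first gives [gil_pelaez_int] at the
    shift [a + |y|], integrating [y] first raises [n] by one. *)
Lemma gil_pelaez_int_step n a :
  mu.-integrable setT (fun y : T => (gil_pelaez_int n (a + `|y|) * phi y)%:E) /\
  (\int[mu]_y (gil_pelaez_int n (a + `|y|) * phi y)%:E =
   (s2 * gil_pelaez_int n.+1 a)%:E)%E.
Proof.
have FE y : (\int[mu]_t fub n a (y, t) = (gil_pelaez_int n (a + `|y|) * phi y)%:E)%E.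
  rewrite /fub /=; under eq_integral do rewrite EFinM.
  rewrite (integralZr measurableT (@integrable_shifted n (a + `|y|))).
  by rewrite EFinM /gil_pelaez_int /Rintegral fineK//; exact: (integrable_fin_num measurableT (@integrable_shifted n (a + `|y|))).
split.
  have := integrable_fubini_F (@integrable_fub n a).
  by apply: eq_integrable => // y _; exact: FE.
under eq_integral do rewrite -FE.
rewrite (Fubini (@integrable_fub n a)).
transitivity (\int[mu]_t (s2%:E * (shifted_im n.+1 a t / t * phi t)%:E))%E.
  apply: eq_integral => t _; rewrite /fub/=.
  transitivity (\int[mu]_y ((phi t / t)%:E * (shifted_im n (a + `|y|) t * phi y)%:E))%E.
    by apply: eq_integral => y _; rewrite -EFinM; congr EFin; ring.
  have [ish Esh] := integral_shifted_im n a t.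
  by rewrite (integralZl measurableT ish) Esh -!EFinM; congr EFin; ring.
rewrite (integralZl measurableT (@integrable_shifted n.+1 a)) EFinM.
by rewrite /gil_pelaez_int /Rintegral fineK//; exact: (integrable_fin_num measurableT (@integrable_shifted n.+1 a)).
Qed.

(* Gil-Pelaez inversion of the characteristic function: this is the probability
   that [xi_0 >= sigma * (a + |xi_1| + ... + |xi_n|)] for independent standard
   normal variables. *)
Definition gil_pelaez (n : nat) (a : R) : R := 2^-1 - gil_pelaez_int n a / (2 * pi).

Lemma gil_pelaez_step n a :
  mu.-integrable setT (fun y : T => (gil_pelaez n (a + `|y|) * phi y)%:E) /\
  (\int[mu]_y (gil_pelaez n (a + `|y|) * phi y)%:E = (s2 * gil_pelaez n.+1 a)%:E)%E.
Proof.
have [i1 E] := gil_pelaez_int_step n a.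
have E' y : ((gil_pelaez n (a + `|y|) * phi y)%:E = 2^-1%:E * (phi y)%:E -
    ((2 * pi)^-1)%:E * (gil_pelaez_int n (a + `|y|) * phi y)%:E)%E.
  by rewrite -!EFinM -EFinB; congr EFin; rewrite /gil_pelaez; ring.
have i2 := integrableZl measurableT 2^-1 (@integrable_gauss_half R).
have i3 := integrableZl measurableT (2 * pi)^-1 i1.
split.
  by apply: (eq_integrable measurableT _ _ _ (integrableB measurableT i2 i3)) => y _; rewrite E'.
under eq_integral do rewrite E'.
rewrite (integralB measurableT i2 i3).
rewrite (integralZl measurableT (@integrable_gauss_half R)) (integralZl measurableT i1) E.
rewrite (integral_gauss_half : (\int[mu]_x (phi x)%:E = _)%E) -!EFinM -EFinB.
by congr EFin; rewrite /gil_pelaez; ring.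
Qed.

Lemma gil_pelaez_base (a : R) : 0 <= a ->
  (\int[mu]_(x in `[(sigma * a)%R, +oo[) (phi x)%:E = (s2 * gil_pelaez 0 a)%:E)%E.
Proof.
move=> a0; rewrite gauss_tail ?mulr_ge0//.
have s0 := @sqrt2pi_gt0 R.
have ss : s2 ^+ 2 = 2 * pi by rewrite sqr_sqrtr// mulr_ge0// pi_ge0.
rewrite /gil_pelaez; have -> : gil_pelaez_int 0 a = sinc_transform (sigma * a).
  have m1 : measurable_fun setT (fun t : T => (shifted_im 0 a t / t * phi t)%:E).
    exact: (measurable_int mu (@integrable_shifted 0 a)).
  have m2 : measurable_fun setT (fun t : T => (sinck (sigma * a) t * phi t)%:E).
    apply/measurable_EFinP; apply: measurable_funM; first exact: measurable_sinck.
    exact: measurable_gauss_half.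
  rewrite /gil_pelaez_int /sinc_transform /Rintegral; congr fine.
  (* Off [t = 0] the two integrands agree; at [t = 0] one is [0] and the other [sigma * a], so this
     point is removed. *)
  have mD : measurable ([set: T] `\ (0 : R)) by exact: measurableD.
  rewrite -(integral_setD1 mD (measurable_funTS m1)).
  rewrite -[RHS](integral_setD1 mD (measurable_funTS m2)).
  apply: eq_integral => t; rewrite inE => -[_ /eqP t0].
  rewrite /shifted_im /sinck (negbTE t0) /= mulr1 mulr0 addr0.
  by congr (sin _ / _ * _)%:E; ring.
have p0 : (pi : R) != 0 by rewrite gt_eqF// pi_gt0.
have -> : sinc_transform (sigma * a) / (2 * pi) = sinc_transform (sigma * a) / s2 ^+ 2.
  by rewrite ss.
by congr EFin; field; rewrite gt_eqF.
Qed.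

End GilPelaezStep.

(** * The expectations of the theorem as Gaussian integrals *)

Section NormalExpectation.
Context {R : realType} {disp : measure_display} {Omega : measurableType disp}.
Local Notation mu := (@lebesgue_measure R).
Local Notation T := (measurableTypeR R).
Local Notation phi := (@gauss_half R).
Local Notation s2 := (Num.sqrt (2 * pi) : R).
Variables (Pr : probability Omega R) (xi : {RV Pr >-> R}).
Hypothesis hxi : forall A : set R, measurable A -> distribution Pr xi A = normal_prob 0 1 A.

Lemma normal_pdf01 (x : R) : normal_pdf 0 1 x = s2^-1 * phi x.
Proof.
rewrite normal_pdfE ?oner_eq0// /normal_peak /normal_fun subr0 expr1n mul1r.
have -> : pi *+ 2 = 2 * pi :> R by rewrite mulr_natl.
by rewrite /gauss_half mulNr.
Qed.

Let measurable_comp_xi (f : R -> R) : measurable_fun setT (f : T -> R) ->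
  measurable_fun setT (fun w => f (xi w)).
Proof.
move=> mf; have mx : measurable_fun setT (xi : Omega -> R) by [].
exact: (measurableT_comp mf mx).
Qed.

(* Layer cake: [f x] is the measure of [{s | 0 <= s <= f x}]. *)
Let ge0_integral_xi (f : R -> R) : measurable_fun setT (f : T -> R) ->
  (forall x, 0 <= f x) ->
  (\int[Pr]_w (f (xi w))%:E = (s2^-1)%:E * \int[mu]_x (f x * phi x)%:E)%E.
Proof.
move=> mf f0; have s0 := @sqrt2pi_gt0 R.
pose G (r s : R) : R := if (0 <= s) && (s <= r) then 1 else 0.
have G0 r s : 0 <= G r s by rewrite /G; case: ifP.
have mG disp' (X : measurableType disp') (r s : X -> R) : measurable_fun setT r ->
    measurable_fun setT s -> measurable_fun setT (fun x => G (r x) (s x)).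
  move=> mr ms.
  have mb : measurable_fun setT (fun x => (0 <= s x) && (s x <= r x)).
    by apply: measurable_and; exact: measurable_fun_ler.
  exact: (measurable_fun_ifT mb (measurable_cst (1 : R)) (measurable_cst (0 : R))).
have GE r : 0 <= r -> (\int[mu]_s (G r s)%:E = r%:E)%E.
  move=> r0; transitivity (\int[mu]_(s in `[0%R, r]) cst 1 s)%E.
    rewrite [RHS]integral_mkcond; apply: eq_integral => s _.
    by rewrite patchE mem_setE in_itv/= /G; case: ifP.
  rewrite integral_cst//= mul1e lebesgue_measure_itv/= lte_fin.
  by case: ltP => [_|r00]; rewrite ?sube0//; congr EFin; apply/eqP; rewrite eq_le r0 r00.
have mphi : measurable_fun setT (phi : T -> R) by exact: measurable_gauss_half.
transitivity (\int[Pr]_w \int[mu]_s (G (f (xi w)) s)%:E)%E.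
  by apply: eq_integral => w _; rewrite GE.
have := @fubini_tonelli _ _ _ _ R Pr mu (fun p : Omega * T => (G (f (xi p.1)) p.2)%:E).
move=> -> //; last first.
- by move=> p; rewrite lee_fin.
- apply/measurable_EFinP; apply: mG; last exact: measurable_snd.
  exact: (measurableT_comp (measurable_comp_xi mf) measurable_fst).
transitivity (\int[mu]_s \int[mu]_x ((s2^-1)%:E * (G (f x) s * phi x)%:E))%E.
  apply: eq_integral => s _.
  pose A := [set x : R | (0 <= s) && (s <= f x)].
  have mA : measurable (A : set T).
    have mb : measurable_fun setT (fun x : T => (0 <= s) && (s <= f x)).
      by apply: measurable_and; exact: measurable_fun_ler.
    by have := mb measurableT [set true] I; rewrite setTI.
  (* For fixed [s] the integral over [Omega] is the probability that [xi] lies in [A]; the law of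
     [xi] enters here. *)
  transitivity (Pr (xi @^-1` A)).
    have mxA : measurable (xi @^-1` A).
      have mx : measurable_fun setT (xi : Omega -> R) by [].
      by have := mx measurableT A mA; rewrite setTI.
    rewrite -[RHS]mul1e -integral_cst// [RHS]integral_mkcond; apply: eq_integral => w _.
    rewrite patchE /G (_ : (w \in _) = (0 <= s) && (s <= f (xi w))).
      by case: ifP.
    by apply/idP/idP; rewrite inE.
  rewrite -[LHS]/(distribution Pr xi A) hxi// /normal_prob.
  rewrite integral_mkcond; apply: eq_integral => x _.
  rewrite patchE normal_pdf01 /G (_ : (x \in _) = (0 <= s) && (s <= f x)).
    by case: ifP => _; rewrite ?mul1r ?mul0r ?mule0// EFinM.
  by apply/idP/idP; rewrite inE.
have := @fubini_tonelli _ _ _ _ R mu mu (fun p : T * T => ((s2^-1)%:E * (G (f p.2) p.1 * phi p.2)%:E)%E).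
move=> -> //; last first.
- by move=> p; rewrite -EFinM lee_fin !mulr_ge0 ?gauss_half_ge0// invr_ge0 ltW.
- apply/measurable_EFinP; apply: measurable_funM => //; apply: measurable_funM.
    by apply: mG; [exact: (measurableT_comp mf measurable_snd)|exact: measurable_fst].
  exact: (measurableT_comp mphi measurable_snd).
rewrite -ge0_integralZl//; last 2 first.
- by apply/measurable_EFinP; apply: measurable_funM.
- by move=> x _; rewrite lee_fin mulr_ge0 ?gauss_half_ge0.
apply: eq_integral => x _ /=.
under eq_integral do rewrite -EFinM mulrC -mulrA EFinM.
rewrite ge0_integralZr//.
- by rewrite GE// -!EFinM; congr EFin; ring.
- by apply/measurable_EFinP; exact: (@mG _ T (cst (f x)) id).
- by move=> s _; rewrite lee_fin.
- by rewrite lee_fin mulr_ge0 ?gauss_half_ge0// invr_ge0 ltW.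
Qed.

Lemma expectation_normal (f : R -> R) : measurable_fun setT (f : T -> R) ->
  mu.-integrable setT (fun x : T => (f x * phi x)%:E) ->
  (\int[Pr]_w (f (xi w))%:E = (s2^-1)%:E * \int[mu]_x (f x * phi x)%:E)%E.
Proof.
move=> mf fi.
have mphi : measurable_fun setT (phi : T -> R) by exact: measurable_gauss_half.
pose fp x := Num.max (f x) 0; pose fn x := Num.max (- f x) 0.
have fE x : f x = fp x - fn x.
  rewrite /fp /fn; case/orP: (le_total 0 (f x)) => h.
    by rewrite max_l// max_r ?oppr_le0// subr0.
  by rewrite (max_r h) max_l ?oppr_ge0// sub0r opprK.
have fp0 x : 0 <= fp x by rewrite /fp le_max lexx orbT.
have fn0 x : 0 <= fn x by rewrite /fn le_max lexx orbT.
have mp : measurable_fun setT (fp : T -> R) by apply: measurable_maxr => //.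
have mn : measurable_fun setT (fn : T -> R).
  by apply: measurable_maxr => //; exact: measurable_funN.
have ip : mu.-integrable setT (fun x : T => (fp x * phi x)%:E).
  apply: (le_integrable measurableT _ _ fi).
    by apply/measurable_EFinP; exact: measurable_funM.
  move=> x _ /=; rewrite lee_fin !normrM ler_wpM2r// ger0_norm//.
  by rewrite /fp ge_max normr_ge0 andbT ler_norm.
have in_ : mu.-integrable setT (fun x : T => (fn x * phi x)%:E).
  apply: (le_integrable measurableT _ _ fi).
    by apply/measurable_EFinP; exact: measurable_funM.
  move=> x _ /=; rewrite lee_fin !normrM ler_wpM2r// ger0_norm//.
  by rewrite /fn ge_max normr_ge0 andbT -normrN ler_norm.
have intP (h : R -> R) : measurable_fun setT (h : T -> R) -> (forall x, 0 <= h x) ->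
    mu.-integrable setT (fun x : T => (h x * phi x)%:E) ->
    Pr.-integrable setT (fun w => (h (xi w))%:E).
  move=> mh h0 ih; apply/integrableP; split.
    by apply/measurable_EFinP; exact: measurable_comp_xi.
  under eq_integral do rewrite /= ger0_norm//.
  rewrite ge0_integral_xi//.
  have := integrable_fin_num measurableT ih.
  by case: (integral _ _ _) => // r _; rewrite -EFinM ltry.
transitivity (\int[Pr]_w ((fp (xi w))%:E - (fn (xi w))%:E))%E.
  by apply: eq_integral => w _; rewrite -EFinB -fE.
rewrite (integralB measurableT (intP _ mp fp0 ip) (intP _ mn fn0 in_)).
rewrite ge0_integral_xi// ge0_integral_xi// -muleBr//; last first.
  by apply: fin_num_adde_defr; exact: (integrable_fin_num measurableT ip).
congr (_ * _)%E; rewrite -(integralB measurableT ip in_).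
by apply: eq_integral => x _; rewrite -EFinB -mulrBl -fE.
Qed.

End NormalExpectation.

(** * Values of [Phi] on the real and imaginary axes *)

Section PhiValues.
Context {R : realType}.
Local Notation mu := (@lebesgue_measure R).
Local Notation T := (measurableTypeR R).
Local Notation phi := (@gauss_half R).
Local Notation s2 := (Num.sqrt (2 * pi) : R).

Lemma cexp_real (a : R) : cexp (a%:C)%C = ((expR a)%:C)%C.
Proof. by rewrite /cexp /= cos0 sin0 mulr1 mulr0. Qed.

(** On the segment from [0] to [i x] the exponent [- (s i x) ^ 2 / 2] is the real number
    [(s x) ^ 2 / 2], so the path integral is [i] times [dawson x]. *)
Lemma Phi_imag (x : R) : Phi ('i%C * x%:C%C) = (2^-1 +i* (dawson x / s2))%C.
Proof.
have E (s : R) : ('i * x%:C * cexp (- (s%:C * ('i * x%:C)) ^+ 2 / 2) =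
    0 +i* (x * expR ((s * x) ^+ 2 / 2)))%C.
  have -> : (- (s%:C * ('i * x%:C)) ^+ 2 / 2 = ((s * x) ^+ 2 / 2)%:C :> R[i])%C.
    have -> : ((s%:C * ('i * x%:C)) ^+ 2 = (- (s * x) ^+ 2)%:C :> R[i])%C.
      by apply/eqP; rewrite expr2 eq_complex /=; apply/andP; split; apply/eqP; ring.
    have -> : (2^-1 = (2^-1)%:C :> R[i])%C by rewrite fmorphV rmorph_nat.
    by rewrite -rmorphN -rmorphM; congr (_%:C)%C; rewrite opprK.
  by rewrite cexp_real; apply/eqP; rewrite eq_complex /=; apply/andP; split; apply/eqP; ring.
rewrite /Phi.
have -> : \int[mu]_(s in `[0, 1]) complex.Re ('i%C * x%:C%C * cexp (- (s%:C%C * ('i%C * x%:C%C)) ^+ 2 / 2)) = 0.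
  under eq_Rintegral do rewrite E /=.
  by rewrite Rintegral_cst// mul0r.
have -> : \int[mu]_(s in `[0, 1]) complex.Im ('i%C * x%:C%C * cexp (- (s%:C%C * ('i%C * x%:C%C)) ^+ 2 / 2)) = dawson x.
  under eq_Rintegral do rewrite E /=.
  have cf : continuous (fun s : R => x * expR ((s * x) ^+ 2 / 2)).
    move=> s; apply: differentiable_continuous; apply/derivable1_diffP.
    exact: ex_derive.
  have dF (s : R) : is_derive s 1 (fun s => dawson (s * x)) (x * expR ((s * x) ^+ 2 / 2)).
    have dd := @is_derive_dawson R (s * x).
    have dm : is_derive s 1 (fun s : R => s * x) x.
      by apply: is_derive_eq; rewrite /GRing.scale/= mulr0 add0r mulr1.
    apply: is_derive_eq; rewrite /GRing.scale/=; ring.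
  by rewrite /Rintegral (integral_FTC ler01 cf dF)/= mul0r mul1r dawson0 subr0.
rewrite (_ : 2^-1 = (2^-1)%:C :> R[i])%C; last by rewrite fmorphV rmorph_nat.
by apply/eqP; rewrite eq_complex /=; apply/andP; split; apply/eqP; ring.
Qed.

(** Identifies [sinc_transform] as the error function behind [Phi], so that measurability of the
    external integrand follows from continuity of [sinc_transform]. *)
Lemma Re_Phi_real (x : R) :
  2 * complex.Re (Phi x%:C%C) - 1 = 2 * sinc_transform x / s2 ^+ 2.
Proof.
have s0 := @sqrt2pi_gt0 R.
have E (s : R) : (x%:C * cexp (- (s%:C * x%:C) ^+ 2 / 2) =
    (x * phi (s * x))%:C :> R[i])%C.
  have -> : (- (s%:C * x%:C) ^+ 2 / 2 = (- ((s * x) ^+ 2 / 2))%:C :> R[i])%C.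
    have -> : (2^-1 = (2^-1)%:C :> R[i])%C by rewrite fmorphV rmorph_nat.
    rewrite -rmorphM -rmorphXn -rmorphN -rmorphM; congr (_%:C)%C; ring.
  by rewrite cexp_real -rmorphM.
rewrite /Phi.
have -> : \int[mu]_(s in `[0, 1]) complex.Re (x%:C%C * cexp (- (s%:C%C * x%:C%C) ^+ 2 / 2)) =
    s2^-1 * sinc_transform x.
  under eq_Rintegral do rewrite E /=.
  have cf : continuous (fun s : R => x * phi (s * x)).
    move=> s; apply: differentiable_continuous; apply/derivable1_diffP.
    have dm : is_derive s 1 (fun s : R => s * x) x.
      by apply: is_derive_eq; rewrite /GRing.scale/= mulr0 add0r mulr1.
    have dp := is_derive_gauss_half (s * x).
    exact: ex_derive.
  have dF (s : R) : is_derive s 1 (fun s => s2^-1 * sinc_transform (s * x)) (x * phi (s * x)).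
    have dd := @is_derive_sinc_transform R (s * x).
    have dm : is_derive s 1 (fun s : R => s * x) x.
      by apply: is_derive_eq; rewrite /GRing.scale/= mulr0 add0r mulr1.
    apply: is_derive_eq; rewrite /GRing.scale/=.
    by field; rewrite gt_eqF.
  rewrite /Rintegral (integral_FTC ler01 cf dF)/= mul0r mul1r sinc_transform0.
  by rewrite mulr0 subr0.
set J := \int[mu]_(s in _) complex.Im _.
rewrite (_ : 2^-1 = (2^-1)%:C :> R[i])%C; last by rewrite fmorphV rmorph_nat.
rewrite /= mul0r subr0.
by field; rewrite gt_eqF.
Qed.

Lemma integral_gauss_interval (x : R) : 0 <= x ->
  (\int[mu]_y (if (`|y| <= x)%R then phi y else 0)%:E =
   (s2 * (2 * complex.Re (Phi x%:C%C) - 1))%:E)%E.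
Proof.
move=> x0; have s0 := @sqrt2pi_gt0 R.
have mphi : measurable_fun setT (phi : T -> R) by exact: measurable_gauss_half.
have mf : measurable_fun setT (fun y : T => if `|y| <= x then phi y else 0).
  have mb : measurable_fun setT (fun y : T => `|y| <= x).
    by apply: measurable_fun_ler => //; exact: normr_measurable.
  exact: (measurable_fun_ifT mb mphi (measurable_cst (0 : R))).
have fi : mu.-integrable setT (fun y : T => (if `|y| <= x then phi y else 0)%:E).
  apply: (le_integrable measurableT _ _ (@integrable_gauss_half R)).
    exact/measurable_EFinP.
  by move=> y _ /=; rewrite lee_fin; case: ifP => // _; rewrite normr0.
rewrite integral_even//; last by move=> y; rewrite normrN /gauss_half sqrrN.
transitivity (2%:E * \int[mu]_(y in `[0%R, x]) (phi y)%:E)%E.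
  congr (_ * _)%E; rewrite integral_mkcond [RHS]integral_mkcond.
  apply: eq_integral => y _; rewrite !patchE !mem_setE !in_itv/= andbT.
  by case: (leP 0 y) => //= y0; rewrite ger0_norm//; case: ifP.
have dF (y : R) : is_derive y 1 (fun s => s2^-1 * sinc_transform s) (phi y).
  have dd := @is_derive_sinc_transform R y.
  apply: is_derive_eq; rewrite /GRing.scale/=.
  by field; rewrite gt_eqF.
rewrite (integral_FTC x0 (@continuous_gauss_half R) dF) sinc_transform0 mulr0 subr0.
rewrite Re_Phi_real -EFinM; congr EFin.
by field; rewrite gt_eqF.
Qed.

Lemma abs_gauss_powE n (u : R) :
  ((abs_gauss_pow n u).1 +i* (abs_gauss_pow n u).2)%C =
  ((2 * phi u) ^+ n)%:C%C * Phi ('i%C * u%:C%C) ^+ n.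
Proof.
have s0 := @sqrt2pi_gt0 R.
rewrite rmorphXn -exprMn.
have -> : ((2 * phi u)%:C%C * Phi ('i%C * u%:C%C) = (phi u +i* abs_gauss_im u)%C).
  rewrite Phi_imag; apply/eqP; rewrite eq_complex /= !mul0r subr0 addr0.
  by apply/andP; split; apply/eqP; rewrite ?/abs_gauss_im ?half_sinE; field; rewrite ?gt_eqF.
elim: n => [|n IH] /=; first by rewrite expr0.
rewrite exprS -IH; apply/eqP; rewrite eq_complex /=.
by rewrite !eqxx.
Qed.

Lemma abs_gauss_pow_im n (u : R) : (abs_gauss_pow n u).2 =
  (2 * phi u) ^+ n * complex.Im (Phi ('i%C * u%:C%C) ^+ n).
Proof.
have := congr1 (@complex.Im R) (abs_gauss_powE n u).
rewrite /= => ->.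
by case: (Phi _ ^+ n) => a b /=; rewrite mul0r addr0.
Qed.

End PhiValues.

Section IntegrableScale.
Context {R : realType}.
Local Notation mu := (@lebesgue_measure R).
Local Notation T := (measurableTypeR R).
Lemma integrable_scale (k : R) (f : R -> \bar R) : k != 0 ->
  mu.-integrable setT f -> mu.-integrable setT (fun x : T => f (k * x)).
Proof.
move=> k0 /integrableP[mf fi].
have mk : measurable_fun setT (fun x : T => k * x) by exact: measurable_funM.
apply/integrableP; split; first exact: (measurableT_comp mf mk).
have mf' : measurable_fun setT (abse \o f) by exact: measurableT_comp.
have E := ge0_integral_scale k0 mf' (fun x => abse_ge0 (f x)).
rewrite E; by apply: lte_mul_pinfty => //.
Qed.
End IntegrableScale.

Section AngleExpectations.
Context {R : realType} {disp : measure_display} {Omega : measurableType disp}.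
Local Notation mu := (@lebesgue_measure R).
Local Notation T := (measurableTypeR R).
Local Notation phi := (@gauss_half R).
Local Notation s2 := (Num.sqrt (2 * pi) : R).
Variables (Pr : probability Omega R) (xi : {RV Pr >-> R}).
Hypothesis hxi : forall A : set R, measurable A -> distribution Pr xi A = normal_prob 0 1 A.
Variables (sigma : R) (n : nat).
Hypothesis sigma0 : 0 < sigma.

(** [a] is the Gaussian integral over the polar cone, with the axis coordinate [t] running over a
    half-line. The integrand of the expectation is even in [xi], and this symmetry accounts for the
    factor [1 / 2]. *)
Lemma external_expectation : exists a : R,
  (\int[mu]_t (if (0 <= t)%R then
     phi t * (s2 * (2 * complex.Re (Phi (sigma * t)%:C%C) - 1)) ^+ n else 0)%:E = a%:E)%E /\
  ((a / s2 ^+ n.+1)%:E = (1 / 2)%:E * 'E_Pr[fun w : Omega =>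
     ((2 * complex.Re (Phi (sigma * `|xi w|)%:C%C) - 1) ^+ n)%R])%E.
Proof.
have s0 := @sqrt2pi_gt0 R.
pose q (x : R) := 2 * sinc_transform (sigma * `|x|) / s2 ^+ 2.
pose p (x : R) := q x ^+ n.
have mphi : measurable_fun setT (phi : T -> R) by exact: measurable_gauss_half.
have cs : continuous (@sinc_transform R) by exact: is_derive_continuous (@is_derive_sinc_transform R).
have msn : measurable_fun setT (fun x : T => sigma * `|x|).
  by apply: measurable_funM => //; exact: normr_measurable.
have mq : measurable_fun setT (q : T -> R).
  apply: measurable_funM => //; apply: measurable_funM => //.
  exact: (measurableT_comp (continuous_measurable_fun cs) msn).
have mp : measurable_fun setT (p : T -> R) by exact: measurable_funX.
(* [q x] is the probability that a standard normal variable lies in [[- sigma |x|, sigma |x|]]. *)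
have q01 x : 0 <= q x <= 1.
  have sx : 0 <= sigma * `|x| by rewrite mulr_ge0// ltW.
  have := integral_gauss_interval sx; rewrite Re_Phi_real -/(q x).
  set f := (X in integral _ _ X) => E.
  have mf : measurable_fun setT f.
    have mb : measurable_fun setT (fun y : T => `|y| <= sigma * `|x|).
      by apply: measurable_fun_ler => //; exact: normr_measurable.
    by apply/measurable_EFinP; exact: (measurable_fun_ifT mb mphi (measurable_cst (0 : R))).
  have f0 y : (0 <= f y)%E by rewrite lee_fin; case: ifP => // _; exact: gauss_half_ge0.
  have h0 : (0 <= (s2 * q x)%:E)%E by rewrite -E; apply: integral_ge0 => y _; exact: f0.
  have h1 : ((s2 * q x)%:E <= s2%:E)%E.
    rewrite -E -[leRHS](integral_gauss_half : (\int[mu]_x (phi x)%:E = _)%E).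
    apply: ge0_le_integral => //.
    - by move=> y _; exact: f0.
    - exact/measurable_EFinP.
    by move=> y _; rewrite lee_fin; case: ifP => // _; exact: gauss_half_ge0.
  by move: h0 h1; rewrite !lee_fin pmulr_rge0// => ->; rewrite ger_pMr.
have p01 x : `|p x| <= 1.
  by have /andP[q0 q1] := q01 x; rewrite /p ger0_norm ?exprn_ge0// exprn_ile1//.
have ip := @integrable_bounded_gauss R setT p measurableT mp p01.
rewrite unlock.
have -> : (\int[Pr]_w ((2 * complex.Re (Phi (sigma * `|xi w|)%:C%C) - 1) ^+ n)%:E =
    \int[Pr]_w (p (xi w))%:E)%E.
  by apply: eq_integral => w _; rewrite Re_Phi_real.
have EX := expectation_normal hxi mp ip.
rewrite EX => {EX}.
have even x : ((p (- x) * phi (- x))%:E = (p x * phi x)%:E)%E.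
  by rewrite /p /q /gauss_half normrN sqrrN.
have EV := integral_even ip even.
rewrite EV => {EV}.
have E2 : ((s2 ^+ n)%:E * \int[mu]_(x in `[0%R, +oo[) (p x * phi x)%:E =
    \int[mu]_t (if (0 <= t)%R then
     phi t * (s2 * (2 * complex.Re (Phi (sigma * t)%:C%C) - 1)) ^+ n else 0)%:E)%E.
  rewrite -ge0_integralZl//; last 2 first.
  - by apply/measurable_EFinP; apply: measurable_funTS; exact: measurable_funM.
  - move=> x _; rewrite lee_fin mulr_ge0 ?gauss_half_ge0// exprn_ge0//.
    by have /andP[] := q01 x.
  rewrite integral_mkcond; apply: eq_integral => x _.
  rewrite patchE mem_setE in_itv/= andbT; case: ifP => // x0.
  rewrite -EFinM; congr EFin.
  by rewrite Re_Phi_real exprMn /p /q ger0_norm//; ring.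
have : (\int[mu]_(x in `[0%R, +oo[) (p x * phi x)%:E)%E \is a fin_num.
  apply: integrable_fin_num => //.
  by apply: (@integrableS _ _ _ mu setT) => //; exact: ip.
rewrite -E2; set I := (X in (_ * X)%E) => Ifin.
exists (s2 ^+ n * fine I); split; first by rewrite EFinM fineK.
rewrite -[in RHS](fineK Ifin) -!EFinM; congr EFin; rewrite exprS; field.
by rewrite expf_eq0 gt_eqF// andbF.
Qed.

Local Notation W := (fun u : R => complex.Im (Phi ('i%C * u%:C%C) ^+ n)).

(** Dividing the imaginary part of [abs_gauss_pow] by the nonvanishing [(2 * phi u) ^ n] gives this
    function, which thus inherits measurability. *)
Lemma measurable_Im_Phi_pow : measurable_fun setT (W : T -> R).
Proof.
have [_ mz] := @measurable_abs_gauss_pow R n.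
have E (u : R) : W u = (abs_gauss_pow n u).2 * (2^-1 * expR (u ^+ 2 / 2)) ^+ n.
  rewrite abs_gauss_pow_im mulrAC -exprMn.
  have -> : 2 * phi u * (2^-1 * expR (u ^+ 2 / 2)) = 1.
    rewrite mulrACA mulfV ?mul1r// /gauss_half -expRD addNr expR0//.
  by rewrite expr1n mul1r.
rewrite (funext E); apply: measurable_funM => //; apply: measurable_funX.
apply: measurable_funM => //; apply: (measurableT_comp (@measurable_expR R)).
by apply: measurable_funM => //; exact: measurable_funX.
Qed.

Lemma internal_expectation :
  ((gil_pelaez sigma n 0)%:E = (1 / 2)%:E - (2 ^+ n / s2)%:E *
    'E_Pr[fun w : Omega => extend_at0 (fun x : R =>
       (1 / x * complex.Im (Phi ('i%C * (sigma / Num.sqrt (1 + n%:R * sigma ^+ 2) * x)%:C%C)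
          ^+ n))%R) (xi w)])%E.
Proof.
have s0 := @sqrt2pi_gt0 R.
have ss : s2 ^+ 2 = 2 * pi by rewrite sqr_sqrtr// mulr_ge0// pi_ge0.
have v0 : 0 < 1 + n%:R * sigma ^+ 2 by rewrite ltr_pwDl// mulr_ge0// sqr_ge0.
(* The Gaussian factors combine to [exp (- (1 + n * sigma ^ 2) * t ^ 2 / 2)]; the substitution
   [t = k * x] turns this into [phi x]. *)
set k := (Num.sqrt (1 + n%:R * sigma ^+ 2))^-1.
have k0 : 0 < k by rewrite invr_gt0 sqrtr_gt0.
have kk : k ^+ 2 * (1 + n%:R * sigma ^+ 2) = 1.
  by rewrite exprVn sqr_sqrtr ?ltW// mulVf// gt_eqF.
set s' := sigma * k.
pose g (x : R) := 1 / x * W (s' * x).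
have mW := measurable_Im_Phi_pow.
have mg : measurable_fun setT (g : T -> R).
  apply: measurable_funM; first by apply: measurable_funM => //; exact: measurable_inv_real.
  have ml : measurable_fun setT (fun x : T => s' * x) by exact: measurable_funM.
  exact: (measurableT_comp mW ml).
pose f (x : R) := extend_at0 g x.
have mf : measurable_fun setT (f : T -> R).
  have mb : measurable_fun setT (fun x : T => x == 0 :> R) by exact: measurable_fun_eqr.
  exact: (measurable_fun_ifT mb (measurable_cst _) mg).
have scaled x : shifted_im sigma n 0 (k * x) / (k * x) * phi (k * x) =
    2 ^+ n / k * (g x * phi x).
  rewrite /shifted_im mulr0 sin0 cos0 mul0r add0r mul1r abs_gauss_pow_im.
  have -> : sigma * (k * x) = s' * x by rewrite mulrA.
  have <- : phi (s' * x) ^+ n * phi (k * x) = phi x.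
    rewrite /gauss_half -expRM_natl -expRD; congr expR.
    rewrite -[x in RHS]mul1r -[in RHS](expr1n _ 2) .
    have -> : n%:R * - ((s' * x) ^+ 2 / 2) + - ((k * x) ^+ 2 / 2) =
        - (k ^+ 2 * (1 + n%:R * sigma ^+ 2) * x ^+ 2 / 2) by rewrite /s'; ring.
    by rewrite kk expr1n !mul1r.
  by rewrite /g exprMn invfM; ring.
have ish := @integrable_shifted R sigma (ltW sigma0) n 0.
have ig0 : mu.-integrable setT (fun x : T => (2 ^+ n / k * (g x * phi x))%:E).
  apply: (eq_integrable measurableT _ _ _ (integrable_scale (lt0r_neq0 k0) ish)) => x _.
  by rewrite /= scaled.
have c0 : 2 ^+ n / k != 0 by rewrite gt_eqF// divr_gt0// exprn_gt0.
have ig : mu.-integrable setT (fun x : T => (g x * phi x)%:E).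
  apply: (eq_integrable measurableT _ _ _ (integrableZl measurableT (2 ^+ n / k)^-1 ig0)).
  by move=> x _; rewrite -EFinM mulrA mulVf// mul1r.
have igf : mu.-integrable setT (fun x : T => (f x * phi x)%:E).
  have mphi : measurable_fun setT (phi : T -> R) by exact: measurable_gauss_half.
  have mfp : measurable_fun setT (fun x : T => (f x * phi x)%:E).
    by apply/measurable_EFinP; exact: measurable_funM.
  apply/integrableP; split => //; have /integrableP[mgp] := ig; apply: le_lt_trans.
  have m1 : measurable_fun setT (abse \o (fun x : T => (f x * phi x)%:E)) by exact: measurableT_comp.
  have m2 : measurable_fun setT (abse \o (fun x : T => (g x * phi x)%:E)) by exact: measurableT_comp.
  have mD : measurable ([set: T] `\ (0 : R)) by exact: measurableD.
  rewrite -(integral_setD1 mD (measurable_funTS m1)) -(integral_setD1 mD (measurable_funTS m2)).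
  rewrite le_eqVlt; apply/orP; left; apply/eqP; apply: eq_integral => t.
  by rewrite inE => -[_ /eqP t0]; rewrite /f /extend_at0 /= (negbTE t0).
(* [f] and [g] differ at most at [0], a null set. *)
have If : (\int[mu]_x (f x * phi x)%:E = \int[mu]_x (g x * phi x)%:E)%E.
  have mD : measurable ([set: T] `\ (0 : R)) by exact: measurableD.
  rewrite -(integral_setD1 mD (measurable_funTS (measurable_int mu igf))).
  rewrite -[RHS](integral_setD1 mD (measurable_funTS (measurable_int mu ig))).
  by apply: eq_integral => t; rewrite inE => -[_ /eqP t0]; rewrite /f /extend_at0 (negbTE t0).
(* The factor [1 / k] coming from [1 / (k * x)] cancels against the Jacobian of the substitution;
   [2 ^ n] remains from [(2 * phi) ^ n]. *)
have Es : gil_pelaez_int sigma n 0 = 2 ^+ n * \int[mu]_x (g x * phi x).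
  have := integral_scale (lt0r_neq0 k0) ish.
  under [X in X = _ -> _]eq_integral do rewrite /= scaled EFinM.
  rewrite (integralZl measurableT ig) gtr0_norm// => E.
  have : (k%:E * ((2 ^+ n / k)%:E * \int[mu]_x (g x * phi x)%:E) =
     \int[mu]_x (shifted_im sigma n 0 x / x * phi x)%:E)%E.
    by rewrite E muleA -EFinM mulfV ?gt_eqF// mul1e.
  rewrite muleA -EFinM => E'.
  rewrite /gil_pelaez_int /Rintegral -E' fineM//; last exact: (integrable_fin_num measurableT ig).
  by rewrite /= mulrCA mulfV ?gt_eqF// mulr1.
rewrite unlock -[X in (_ * X)%E]/(\int[Pr]_w (f (xi w))%:E)%E.
rewrite (expectation_normal hxi mf igf) If.
have : (\int[mu]_x (g x * phi x)%:E)%E \is a fin_num by exact: (integrable_fin_num measurableT ig).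
rewrite /gil_pelaez Es /Rintegral.
case: (integral _ _ _) => // r _.
rewrite -!EFinM -EFinB; congr EFin => /=.
have -> : 2 ^+ n * r / (2 * pi) = 2 ^+ n * r / s2 ^+ 2 by rewrite ss.
by field; rewrite gt_eqF.
Qed.

End AngleExpectations.

(** * Tangent and normal cones in the Klein metric *)

Section DotProduct.
Context {R : realType} {d : nat}.
Local Notation V := 'rV[R]_d.

Lemma ip_CauchySchwarz (g : V -> V -> R) (u v : V) : inner_product g ->
  g u v ^+ 2 <= g u u * g v v.
Proof.
move=> gP; have [->|u0] := eqVneq u 0.
  by rewrite (ip0l gP) (ip0l gP) expr0n/= mul0r.
have guu : 0 < g u u by case: gP => _ _; exact.
have := ip_ge0 gP (v - (g u v / g u u) *: u).
rewrite (ipDl gP) !(ipDr gP) !(ipNl gP) !(ipNr gP) !(ipZl gP) !(ipZr gP) (ipC gP v u).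
have -> : g v v - g u v / g u u * g u v + (- (g u v / g u u * g u v) -
    - (g u v / g u u * (g u v / g u u * g u u))) = (g u u * g v v - g u v ^+ 2) / g u u.
  by field; rewrite gt_eqF.
by rewrite pmulr_lge0 ?invr_gt0// subr_ge0.
Qed.

Lemma inner_product_dotp : inner_product (@dotp R d).
Proof.
split.
- by move=> u v; apply: eq_bigr => i _; rewrite mulrC.
- move=> k u v w; rewrite /dotp mulr_sumr -big_split/=.
  by apply: eq_bigr => i _; rewrite !mxE mulrDl mulrA.
- move=> u u0; rewrite lt_neqAle eq_sym; apply/andP; split; last first.
    by apply: sumr_ge0 => i _; rewrite -expr2 sqr_ge0.
  apply: contra u0 => /eqP uu.
  apply/eqP/rowP => i; rewrite mxE; apply/eqP; rewrite -sqrf_eq0 expr2; apply/eqP.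
  by apply: (psumr_eq0P _ uu) => // j _; rewrite -expr2 sqr_ge0.
Qed.

Lemma enorm_sqr (x : V) : enorm x ^+ 2 = dotp x x.
Proof. by rewrite sqr_sqrtr// (ip_ge0 inner_product_dotp). Qed.

Lemma dotp_delta (u : V) i : dotp (delta_mx 0 i) u = u 0 i.
Proof.
rewrite /dotp (bigD1 i)//= !mxE !eqxx mul1r big1 ?addr0// => j ji.
by rewrite !mxE (negbTE ji) andbF mul0r.
Qed.

Section Klein.
Variables (kappa : R) (x : V).
Local Notation c := (1 + kappa * dotp x x).
Local Notation g := (klein_metric kappa x).

Lemma klein_ball_gt0 : klein_ball kappa x -> 0 < c.
Proof.
rewrite /klein_ball; case: ifPn => [k0 _|].
  by rewrite ltr_pwDl// mulr_ge0// (ip_ge0 inner_product_dotp).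
rewrite -ltNge => k0 /= xk.
have k0' : 0 < - kappa by rewrite oppr_gt0.
have sk : 0 < Num.sqrt (- kappa) by rewrite sqrtr_gt0.
have : enorm x ^+ 2 < (1 / Num.sqrt (- kappa)) ^+ 2.
  by rewrite ltr_pXn2r// ?nnegrE ?sqrtr_ge0// divr_ge0// ltW.
rewrite enorm_sqr div1r exprVn sqr_sqrtr ?ltW// -[ltRHS]div1r ltr_pdivlMr//.
by rewrite mulrN mulrC => h; lra.
Qed.

Lemma klein_metricE u v : g u v = dotp u v / c - kappa * dotp x u * dotp x v / c ^+ 2.
Proof. by rewrite /klein_metric enorm_sqr. Qed.

(** For positivity, [c ^ 2 * g u u] equals [|u|^2 + kappa * (|x|^2 * |u|^2 - <x, u>^2)], where
    Cauchy-Schwarz settles [kappa >= 0]. For [kappa < 0] it is regrouped as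
    [c * |u|^2 - kappa * <x, u>^2]. *)
Lemma inner_product_klein : 0 < c -> inner_product g.
Proof.
have dP := inner_product_dotp; move=> c0; split.
- by move=> u v; rewrite !klein_metricE (ipC dP u); ring.
- move=> k u v w; rewrite !klein_metricE !(ipDl dP) !(ipDr dP) !(ipZl dP) !(ipZr dP).
  ring.
- move=> u u0; rewrite klein_metricE.
  have -> : dotp u u / c - kappa * dotp x u * dotp x u / c ^+ 2 =
      (dotp u u + kappa * (dotp x x * dotp u u - dotp x u ^+ 2)) / c ^+ 2.
    by field; rewrite gt_eqF.
  rewrite divr_gt0 ?exprn_gt0//.
  have uu : 0 < dotp u u by case: dP => _ _; exact.
  have cs := ip_CauchySchwarz x u dP.
  have [k0|k0] := leP 0 kappa.
    by rewrite ltr_pwDl// mulr_ge0// subr_ge0.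
  have -> : dotp u u + kappa * (dotp x x * dotp u u - dotp x u ^+ 2) =
    c * dotp u u + - kappa * dotp x u ^+ 2 by ring.
  by rewrite ltr_pwDl ?mulr_gt0// mulr_ge0 ?sqr_ge0// oppr_ge0 ltW.
Qed.

(* Represents the functional [dotp w] with respect to [g]. *)
Definition klein_dual (w : V) : V := c *: (w + (kappa * dotp x w) *: x).

Lemma klein_dualP w u : 0 < c -> g (klein_dual w) u = dotp w u.
Proof.
have dP := inner_product_dotp; move=> c0; rewrite klein_metricE /klein_dual.
rewrite !(ipZl dP) !(ipZr dP) !(ipDl dP) !(ipDr dP) !(ipZl dP) !(ipZr dP).
by field; rewrite gt_eqF.
Qed.

Lemma dotp_klein_dual w u : dotp u (klein_dual w) = c * (dotp u w + kappa * dotp x w * dotp u x).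
Proof.
have dP := inner_product_dotp.
by rewrite /klein_dual (ipZr dP) (ipDr dP) (ipZr dP).
Qed.

End Klein.
End DotProduct.

Section LinHull.
Context {R : realType} {d : nat}.
Local Notation V := 'rV[R]_d.

Lemma lin_hullP (A : set V) (L : {vspace V}) : (forall x, A x -> x \in L) ->
  (forall M : {vspace V}, (forall x, A x -> x \in M) -> (L <= M)%VS) -> lin_hull A = L.
Proof.
move=> AL Lmin; rewrite /lin_hull; apply: xget_unique => //.
move=> M [AM Mmin]; apply/eqP; rewrite eqEsubv; apply/andP; split.
  exact: Mmin.
exact: Lmin.
Qed.

End LinHull.

Definition sign_cone {R : realType} {d : nat} (s : 'rV[R]_d) : set 'rV[R]_d :=
  [set u : 'rV[R]_d | \sum_(j | s 0 j == 0) `|u 0 j| + dotp s u <= 0].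

Definition polar_cone {R : realType} {d : nat} (g : 'rV[R]_d -> 'rV[R]_d -> R)
  (K : set 'rV[R]_d) : set 'rV[R]_d := [set v | forall u, K u -> g v u <= 0].

Section Cones.
Context {R : realType} {d : nat}.
Local Notation V := 'rV[R]_d.
Local Notation mu := (@lebesgue_measure R).
Local Notation T := (measurableTypeR R).
Local Notation phi := (@gauss_half R).
Local Notation s2 := (Num.sqrt (2 * pi) : R).
Variables (kappa tau : R) (x s : V).
Local Notation c := (1 + kappa * dotp x x).
Local Notation g := (klein_metric kappa x).
Local Notation N := #|[pred i | s 0 i != 0]|.
Local Notation Z := (enum [pred j | s 0 j == 0]).
Hypotheses (c0 : 0 < c) (t0 : 0 < tau) (sP : forall i, s 0 i != 0 -> s 0 i ^+ 2 = 1).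
Hypotheses (xs : dotp s x = 1 / tau) (xZ : forall j, s 0 j = 0 -> x 0 j = 0).
Hypothesis m0 : 0 < N%:R * tau ^+ 2 + kappa.

(** Since [<s, x> = 1 / tau], the vector [klein_dual kappa x s] has squared [g]-norm [c * (N + kappa
    / tau ^ 2) = c / sigma ^ 2], while the dual of [u_j] has squared norm [c]. The ratio [1 / sigma]
    of these norms does not depend on [x]. *)
Definition cone_sigma : R := Num.sqrt (tau ^+ 2 / (N%:R * tau ^+ 2 + kappa)).
Local Notation sigma := cone_sigma.

(* With [t] the coordinate along [cone_axis] and [y j] those along [cone_side j],
   the tangent cone is [\sum_j |y j| <= - t / sigma] and its polar is
   [forall j, |y j| <= sigma * t], all other coordinates being [0]. *)
Definition cone_axis : V := (sigma / Num.sqrt c) *: klein_dual kappa x s.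
Definition cone_side (j : 'I_d) : V := (Num.sqrt c)^-1 *: klein_dual kappa x (delta_mx 0 j).
Local Notation b0 := cone_axis.
Local Notation bj := cone_side.

Let gP : inner_product g := inner_product_klein c0.
Let dP : inner_product (@dotp R d) := inner_product_dotp.
Let sc0 : 0 < Num.sqrt c. Proof. by rewrite sqrtr_gt0. Qed.

Lemma cone_sigma_gt0 : 0 < sigma.
Proof. by rewrite sqrtr_gt0 divr_gt0// exprn_gt0. Qed.
Let sigma0 := cone_sigma_gt0.

Let sigma_sqr : sigma ^+ 2 * (N%:R + kappa / tau ^+ 2) = 1.
Proof.
rewrite sqr_sqrtr; last by rewrite divr_ge0 ?sqr_ge0// ltW.
by field; rewrite !gt_eqF.
Qed.

Lemma cone_axisP u : g b0 u = sigma / Num.sqrt c * dotp s u.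
Proof. by rewrite (ipZl gP) klein_dualP. Qed.

Lemma cone_sideP j u : g (bj j) u = (Num.sqrt c)^-1 * u 0 j.
Proof. by rewrite (ipZl gP) klein_dualP// dotp_delta. Qed.

Lemma dotp_sign : dotp s s = N%:R.
Proof.
rewrite /dotp (bigID (fun i => s 0 i != 0))/= [X in _ + X]big1 ?addr0; last first.
  by move=> i /negPn/eqP ->; rewrite mul0r.
by rewrite -sum1_card natr_sum; apply: eq_bigr => i si; rewrite -expr2 sP.
Qed.

(** Both [s_j] and [x_j] vanish for [j] in [Z], which removes every mixed term, including the
    rank-one correction of the metric. *)
Lemma orthonormal_cone : orthonormal g (b0 :: map bj Z).
Proof.
have cc : Num.sqrt c ^+ 2 = c by rewrite sqr_sqrtr// ltW.
have cn : Num.sqrt c != 0 by rewrite gt_eqF.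
have tn : tau != 0 by rewrite gt_eqF.
rewrite orthonormal_cons; apply/and3P; split.
- apply/eqP; rewrite cone_axisP (ipZr dP) dotp_klein_dual (ipC dP x) xs dotp_sign.
  have E : c / Num.sqrt c ^+ 2 = 1 by rewrite cc mulfV// gt_eqF.
  transitivity (sigma ^+ 2 * (N%:R + kappa / tau ^+ 2) * (c / Num.sqrt c ^+ 2)).
    by field; rewrite cn tn.
  by rewrite E mulr1 sigma_sqr.
- apply/allP => _ /mapP[j + ->]; rewrite mem_enum inE => /eqP sj.
  rewrite cone_axisP (ipZr dP) dotp_klein_dual (ipC dP x) (ipC dP s (delta_mx _ _)) !dotp_delta.
  by rewrite sj xZ// mulr0 mul0r addr0 !mulr0.
- have : uniq Z by exact: enum_uniq.
  have : all (fun j => s 0 j == 0) Z by apply/allP => j; rewrite mem_enum.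
  elim: Z => [//|j js IH] /= /andP[/eqP sj sjs] /andP[jjs ujs].
  rewrite orthonormal_cons IH// andbT; apply/andP; split.
    rewrite cone_sideP /cone_side /klein_dual !mxE !eqxx xZ// mulr0 addr0 mulr1.
    by rewrite mulrA -expr2 exprVn cc mulVf// gt_eqF.
  apply/allP => _ /mapP[i + ->] => ijs.
  rewrite cone_sideP /cone_side /klein_dual !mxE eqxx/= xZ// mulr0 addr0.
  have -> : (j == i) = false by apply/negbTE; apply: contraNneq jjs => ->.
  by rewrite !mulr0.
Qed.

Lemma sign_coneP u : sign_cone s u <->
  \sum_(j <- Z) `|g (bj j) u| + g b0 u / sigma <= 0.
Proof.
have -> : \sum_(j <- Z) `|g (bj j) u| + g b0 u / sigma =
    (Num.sqrt c)^-1 * (\sum_(j | s 0 j == 0) `|u 0 j| + dotp s u).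
  rewrite mulrDr big_enum/= mulr_sumr; congr (_ + _).
    by apply: eq_bigr => j _; rewrite cone_sideP normrM normfV (gtr0_norm sc0).
  by rewrite cone_axisP; field; rewrite !gt_eqF.
by rewrite /sign_cone /= pmulr_rle0// invr_gt0.
Qed.

Variable o2 : seq V.
Hypotheses (oo : orthonormal g (o2 ++ b0 :: map bj Z))
  (full : <<o2 ++ b0 :: map bj Z>>%VS = fullv).

Let o2P w : w \in o2 -> g b0 w = 0 /\ forall j, j \in Z -> g (bj j) w = 0.
Proof.
move: oo => /andP[+ _]; rewrite pairwise_cat => /and3P[/allrelP al _ _] wo2; split.
  by rewrite (ipC gP); apply/eqP/al => //; rewrite mem_head.
move=> j jZ; rewrite (ipC gP); apply/eqP/al => //.
by rewrite inE map_f ?orbT.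
Qed.

Let oo2 : orthonormal g o2.
Proof.
move: oo => /andP[]; rewrite pairwise_cat all_cat => /and3P[_ p _] /andP[a _].
exact/andP.
Qed.

Let b0b0 : g b0 b0 = 1.
Proof. by apply: (orthonormal_norm orthonormal_cone); rewrite mem_head. Qed.

Let b0bj j : j \in Z -> g b0 (bj j) = 0.
Proof. by move=> jZ; apply: (orthonormal_perp orthonormal_cone); rewrite map_f. Qed.

Let bjbj i j : i \in Z -> j \in Z -> g (bj i) (bj j) = (i == j)%:R.
Proof.
rewrite !mem_enum !inE => /eqP si /eqP sj.
have cc : Num.sqrt c ^+ 2 = c by rewrite sqr_sqrtr// ltW.
rewrite cone_sideP /cone_side /klein_dual !mxE eqxx/= xZ// mulr0 addr0.
case: (i == j); rewrite ?mulr0// mulr1.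
by rewrite mulrA -expr2 exprVn cc mulVf// gt_eqF.
Qed.

Lemma cone_size : (size o2 + size Z).+1 = d.
Proof.
have /eqP := orthonormal_free gP oo.
by rewrite full dimvf /dim /= mul1n size_cat /= size_map addnS => <-.
Qed.

Lemma cone_card : (N + size Z = d)%N.
Proof.
rewrite -cardE addnC -[RHS]card_ord -(cardC [pred j | s 0 j == 0]).
by congr (_ + _)%N; apply: eq_card => i; rewrite !inE.
Qed.

(** Shows that [o2], the orthonormal complement of the cone coordinates, spans the directions within
    the face; the dimension of a face is computed from it. *)
Lemma perp_cone_span u : u \in <<o2>>%VS <->
  (forall j, s 0 j = 0 -> u 0 j = 0) /\ dotp s u = 0.
Proof.
split=> [uo|[uj su]].
  have g0 w : (forall v, v \in o2 -> g w v = 0) -> g w u = 0.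
    move=> h; rewrite (ipC gP); apply: (span_perp gP _ uo) => v vo.
    by rewrite (ipC gP) h.
  split=> [j sj|].
    have : g (bj j) u = 0.
      by apply: g0 => v /o2P[_]; apply; rewrite mem_enum inE sj.
    by rewrite cone_sideP => /eqP; rewrite mulf_eq0 invr_eq0 (gt_eqF sc0) => /eqP.
  have : g b0 u = 0 by apply: g0 => v /o2P[].
  rewrite cone_axisP => /eqP; rewrite !mulf_eq0 invr_eq0 (gt_eqF sc0) (gt_eqF sigma0).
  by move/eqP.
have uf : u \in <<o2 ++ b0 :: map bj Z>>%VS by rewrite full memvf.
rewrite (orthonormal_expand gP oo uf) big_cat/= big_cons big_map.
rewrite [g u b0](ipC gP) cone_axisP su mulr0 scale0r add0r [X in _ + X]big_seq [X in _ + X]big1 ?addr0.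
  exact: sum_mem_span.
move=> j; rewrite mem_enum inE => /eqP sj.
by rewrite (ipC gP) cone_sideP uj// mulr0 scale0r.
Qed.

(** The cone contains [o2], [- b0] and the boundary vectors [bj - sigma *: b0], and these span
    everything. *)
Lemma lin_hull_sign_cone : lin_hull (sign_cone s) = <<o2 ++ b0 :: map bj Z>>%VS.
Proof.
apply: lin_hullP => [u _|M HM]; first by rewrite full memvf.
have oM w : w \in o2 -> w \in M.
  move=> wo; apply: HM; apply/sign_coneP; have [h1 h2] := o2P wo.
  rewrite h1 mul0r addr0 big_seq big1// => j jZ.
  by rewrite h2// normr0.
have b0M : b0 \in M.
  rewrite -[b0]opprK memvN; apply: HM; apply/sign_coneP.
  rewrite (ipNr gP) b0b0 big_seq big1 ?add0r.
    by rewrite mulN1r oppr_le0 invr_ge0 ltW.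
  by move=> j jZ; rewrite (ipNr gP) (ipC gP) b0bj// oppr0 normr0.
have bjM j : j \in Z -> bj j \in M.
  move=> jZ; rewrite -[bj j](subrK (sigma *: b0)); apply: memvD; last exact: memvZ.
  apply: HM; apply/sign_coneP.
  rewrite (ipDr gP) (ipNr gP) (ipZr gP) b0b0 b0bj// add0r mulr1 mulNr mulfV ?gt_eqF//.
  rewrite (bigD1_seq j) ?enum_uniq//= big_seq_cond big1 ?addr0.
    rewrite (ipDr gP) (ipNr gP) (ipZr gP) [g _ b0](ipC gP) b0bj// mulr0 subr0 bjbj// eqxx.
    by rewrite normr1 subrr.
  move=> i /andP[iZ ij].
  rewrite (ipDr gP) (ipNr gP) (ipZr gP) [g _ b0](ipC gP) b0bj// mulr0 subr0 bjbj//.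
  by rewrite (negbTE ij) normr0.
apply/span_subvP => w; rewrite mem_cat inE => /or3P[/oM//|/eqP -> //|/mapP[j jZ ->]].
exact: bjM.
Qed.

Let cond (v : V) : bool :=
  [&& all (fun w => g w v == 0) o2, 0 <= g b0 v &
      all (fun j => `|g (bj j) v| <= sigma * g b0 v) Z].

(** Necessity tests [v] on the lines spanned by [o2], on [- b0] and on [bj - sigma *: b0] and
    [- bj - sigma *: b0]. For sufficiency, the coordinate bounds on [v] show that [g v u] is at most
    [sigma * g v b0] times the expression in [sign_coneP], which is nonpositive. *)
Lemma polar_sign_coneP v : polar_cone g (sign_cone s) v <-> cond v.
Proof.
split=> [H|/and3P[/allP h1 h2 /allP h3] u /sign_coneP Tu]; last first.
  have uf : v \in <<o2 ++ b0 :: map bj Z>>%VS by rewrite full memvf.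
  rewrite (orthonormal_expand gP oo uf) big_cat/= big_cons big_map.
  rewrite big_seq big1 ?add0r; last first.
    by move=> w wo; rewrite (ipC gP) (eqP (h1 w wo)) scale0r.
  rewrite (ipDl gP) (ipZl gP) (ip_suml gP).
  apply: (@le_trans _ _ (sigma * g v b0 * (\sum_(j <- Z) `|g (bj j) u| + g b0 u / sigma))).
    rewrite [leRHS]mulrDr [leLHS]addrC lerD//; last first.
      by rewrite le_eqVlt; apply/orP; left; apply/eqP; field; rewrite gt_eqF.
    rewrite mulr_sumr big_seq [leRHS]big_seq; apply: ler_sum => j jZ.
    rewrite (ipZl gP); apply: le_trans (ler_norm _) _; rewrite normrM ler_wpM2r//.
    by rewrite (ipC gP v) (ipC gP v); exact: h3.
  by rewrite mulr_ge0_le0// mulr_ge0 ?(ltW sigma0)// (ipC gP).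
have oH w : w \in o2 -> g w v = 0.
  move=> wo; have [h1 h2] := o2P wo.
  have h (k : R) : sign_cone s (k *: w).
    apply/sign_coneP; rewrite (ipZr gP) h1 mulr0 mul0r addr0 big_seq big1// => j jZ.
    by rewrite (ipZr gP) h2// mulr0 normr0.
  have := H _ (h 1); have := H _ (h (-1)); rewrite !(ipZr gP) mul1r mulN1r oppr_le0 => a b.
  by rewrite (ipC gP); apply/eqP; rewrite eq_le a b.
have ray j (k : R) : j \in Z -> `|k| = 1 -> sign_cone s (k *: bj j - sigma *: b0).
  move=> jZ k1; apply/sign_coneP.
  rewrite (ipDr gP) (ipNr gP) 2!(ipZr gP) b0b0 b0bj// mulr0 add0r mulr1 mulNr mulfV ?gt_eqF//.
  rewrite (bigD1_seq j) ?enum_uniq//= big_seq_cond big1 ?addr0.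
    rewrite (ipDr gP) (ipNr gP) 2!(ipZr gP) [g _ b0](ipC gP) b0bj// mulr0 subr0 bjbj// eqxx.
    by rewrite mulr1 k1 subrr.
  move=> i /andP[iZ ij].
  rewrite (ipDr gP) (ipNr gP) 2!(ipZr gP) [g _ b0](ipC gP) b0bj// mulr0 subr0 bjbj//.
  by rewrite (negbTE ij) mulr0 normr0.
apply/and3P; split.
- by apply/allP => w wo; rewrite oH.
- have : sign_cone s (- b0).
    apply/sign_coneP; rewrite (ipNr gP) b0b0 big_seq big1 ?add0r.
      by rewrite mulN1r oppr_le0 invr_ge0 ltW.
    by move=> j jZ; rewrite (ipNr gP) (ipC gP) b0bj// oppr0 normr0.
  by move=> /H; rewrite (ipNr gP) oppr_le0 (ipC gP).
- apply/allP => j jZ.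
  have gray k : g v (k *: bj j - sigma *: b0) = k * g v (bj j) - sigma * g v b0.
    by rewrite (ipDr gP) (ipNr gP) 2!(ipZr gP).
  have n1 : `|1 : R| = 1 by rewrite normr1.
  have n2 : `|-1 : R| = 1 by rewrite normrN1.
  have := H _ (ray j 1 jZ n1); have := H _ (ray j (-1) jZ n2).
  rewrite !gray mul1r mulN1r (ipC gP v) (ipC gP v) => a b.
  by rewrite ler_norml; apply/andP; split; lra.
Qed.

Lemma lin_hull_polar_cone : lin_hull (polar_cone g (sign_cone s)) = <<b0 :: map bj Z>>%VS.
Proof.
apply: lin_hullP => [v /polar_sign_coneP/and3P[/allP h1 _ _]|M HM].
  have uf : v \in <<o2 ++ b0 :: map bj Z>>%VS by rewrite full memvf.
  rewrite (orthonormal_expand gP oo uf) big_cat/= big_seq big1 ?add0r; last first.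
    by move=> w wo; rewrite (ipC gP) (eqP (h1 w wo)) scale0r.
  exact: sum_mem_span.
have b0M : b0 \in M.
  apply: HM; apply/polar_sign_coneP/and3P; split.
  - by apply/allP => w /o2P[h _]; rewrite (ipC gP) h.
  - by rewrite b0b0.
  - by apply/allP => j jZ; rewrite (ipC gP) b0bj// normr0 b0b0 mulr1 ltW.
apply/span_subvP => w; rewrite inE => /orP[/eqP -> //|/mapP[j jZ ->]].
(* [b0 + sigma *: bj j] lies on the boundary of the polar cone. *)
have -> : bj j = sigma^-1 *: ((b0 + sigma *: bj j) - b0).
  by rewrite addrC addKr scalerA mulVf ?gt_eqF// scale1r.
have gr u : g u (b0 + sigma *: bj j) = g u b0 + sigma * g u (bj j).
  by rewrite (ipDr gP) [X in _ + X](ipZr gP).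
apply: memvZ; apply: memvB => //; apply: HM; apply/polar_sign_coneP/and3P; split.
- apply/allP => w' /o2P[h1 h2].
  by rewrite gr (ipC gP) h1 (ipC gP) h2// mulr0 addr0.
- by rewrite gr b0b0 b0bj// mulr0 addr0.
- apply/allP => i iZ.
  rewrite !gr b0b0 b0bj// (ipC gP _ b0) b0bj// mulr0 add0r addr0 bjbj//.
  by case: (i == j); rewrite !(mulr1, mulr0) ?normr0 ?gtr0_norm// ltW.
Qed.

Let ms w disp (X : measurableType disp) (h : X -> V) :
  (forall i, measurable_fun setT (fun t => h t 0 i)) ->
  measurable_fun setT (fun t => g w (h t)).
Proof.
move=> mh; under eq_fun do rewrite (ipC gP).
exact/measurable_EFinP/(borel_ipr gP).
Qed.

Lemma borel_sign_cone : borel_fun (fun u : V => (\1_(sign_cone s) u)%:E : \bar R).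
Proof.
move=> disp X h mh; apply/measurable_EFinP.
have mb : measurable_fun setT (fun t => \sum_(j <- Z) `|g (bj j) (h t)| + g b0 (h t) / sigma <= 0).
  apply: measurable_fun_ler => //; apply: measurable_funD.
    apply: measurable_sum => j; apply: (measurableT_comp (@normr_measurable _ setT)).
    exact: ms.
  by apply: measurable_funM => //; exact: ms.
rewrite (_ : (fun t => _) = fun t => if \sum_(j <- Z) `|g (bj j) (h t)| + g b0 (h t) / sigma <= 0
  then 1 else 0 : R).
  exact: (measurable_fun_ifT mb (measurable_cst (1 : R)) (measurable_cst (0 : R))).
apply/funext => t; rewrite indicE (_ : (_ \in _) = (\sum_(j <- Z) `|g (bj j) (h t)| + g b0 (h t) / sigma <= 0)).
  by case: ifP.
by apply/idP/idP; rewrite inE => /sign_coneP.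
Qed.

Lemma borel_polar_cone : borel_fun (fun u : V => (\1_(polar_cone g (sign_cone s)) u)%:E : \bar R).
Proof.
move=> disp X h mh; apply/measurable_EFinP.
have mall (I : Type) (r : seq I) (P : I -> X -> bool) : (forall i, measurable_fun setT (P i)) ->
    measurable_fun setT (fun t => all (P ^~ t) r).
  move=> mP; elim: r => [|i r IH] /=; first exact: measurable_cst.
  exact: measurable_and.
have mb : measurable_fun setT (fun t => cond (h t)).
  apply: measurable_and; first by apply: mall => w; apply: measurable_fun_eqr => //; exact: ms.
  apply: measurable_and; first by apply: measurable_fun_ler => //; exact: ms.
  apply: mall => j; apply: measurable_fun_ler.
    by apply: (measurableT_comp (@normr_measurable _ setT)); exact: ms.
  by apply: measurable_funM => //; exact: ms.
rewrite (_ : (fun t => _) = fun t => if cond (h t) then 1 else 0 : R).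
  exact: (measurable_fun_ifT mb (measurable_cst (1 : R)) (measurable_cst (0 : R))).
apply/funext => t; rewrite indicE (_ : (_ \in _) = cond (h t)); first by case: ifP.
by apply/idP/idP; rewrite inE => /polar_sign_coneP.
Qed.

Let gint (C : R) : (\int[mu]_y (C * phi y)%:E = (C * s2)%:E)%E.
Proof.
under eq_integral do rewrite EFinM.
rewrite (integralZl measurableT (@integrable_gauss_half R)).
by rewrite (integral_gauss_half : (\int[mu]_x (phi x)%:E = _)%E).
Qed.

Let A v := \sum_(j <- Z) `|g (bj j) v|.
Let Q v := expR (- (g v v / 2)).
Let F u := (\1_(sign_cone s) u * Q u)%:E.

Let lineE u v y : g u u = 1 -> g u v = 0 -> Q (v + y *: u) = Q v * phi y.
Proof. exact: gauss_line. Qed.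

Let perp_line (b u v : V) y : g u b = 0 -> g u (v + y *: b) = g u v.
Proof. by move=> h; rewrite (ipDr gP) [X in _ + X](ipZr gP) h mulr0 addr0. Qed.

Let perp_line' (b u v : V) y : g u v = 0 -> g u (v + y *: b) = y * g u b.
Proof. by move=> h; rewrite (ipDr gP) h add0r [LHS](ipZr gP). Qed.

Let A_line b v y : (forall j, j \in Z -> g (bj j) b = 0) -> A (v + y *: b) = A v.
Proof.
by move=> h; apply: eq_big_seq => j jZ; rewrite perp_line// h.
Qed.

Let A_line_side j v y : j \in Z -> g (bj j) v = 0 -> A (v + y *: bj j) = A v + `|y|.
Proof.
move=> jZ jv; rewrite /A !(bigD1_seq j (jZ) (enum_uniq _))/= jv normr0 add0r.
rewrite addrC; congr (_ + _); last by rewrite perp_line'// bjbj// eqxx mulr1.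
rewrite big_seq_cond [RHS]big_seq_cond; apply: eq_bigr => i /andP[iZ ij].
by rewrite perp_line// bjbj// (negbTE ij).
Qed.

Let in_cone v : \1_(sign_cone s) v = (A v + g b0 v / sigma <= 0)%R%:R :> R.
Proof. by rewrite indicE; congr ((_ : bool)%:R); apply/idP/idP; rewrite inE => /sign_coneP. Qed.

Let int_perp o' v : orthonormal g o' -> {subset o' <= o2} ->
  (forall w, w \in o' -> g w v = 0) ->
  iter_int o' F v = (s2 ^+ size o' * (\1_(sign_cone s) v * Q v))%:E.
Proof.
elim: o' v => [|b o' IH] v; first by rewrite /= mul1r.
move=> obo sub ov; have bo u := @orthonormal_perp _ _ g b o' u obo.
move: obo; rewrite orthonormal_cons => /and3P[/eqP bb _ oo'] /=.
have bo2 : b \in o2 by apply: sub; rewrite mem_head.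
have [b0b bjb] := o2P bo2.
transitivity (\int[mu]_y ((s2 ^+ size o' * (\1_(sign_cone s) v * Q v)) * phi y)%:E)%E.
  apply: eq_integral => y _; rewrite IH//; last 2 first.
  - by move=> w wo; apply: sub; rewrite inE wo orbT.
  - move=> w wo; rewrite perp_line; first by rewrite ov// inE wo orbT.
    by rewrite (ipC gP) bo.
  rewrite lineE//; last by rewrite ov// mem_head.
  by rewrite !in_cone A_line// perp_line// !mulrA.
by rewrite gint exprS; congr EFin; ring.
Qed.

(** With the side coordinates fixed, the cone is the half-line [y <= - sigma * A v] on the axis;
    reflected, it gives the tail computed by [gil_pelaez_base]. *)
Let int_axis v : g b0 v = 0 -> (forall w, w \in o2 -> g w v = 0) ->
  iter_int (b0 :: o2) F v = (s2 ^+ (size o2).+1 * Q v * gil_pelaez sigma 0 (A v))%:E.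
Proof.
move=> b0v ov /=.
have A0 : 0 <= A v by rewrite sumr_ge0.
transitivity (\int[mu]_y ((s2 ^+ size o2 * Q v)%:E *
    (if (sigma * A v <= -1 * y)%R then phi (-1 * y) else 0)%:E))%E.
  apply: eq_integral => y _; rewrite int_perp//; last first.
    by move=> w wo; rewrite perp_line ?ov// (ipC gP); have [] := o2P wo.
  rewrite -EFinM; congr EFin; rewrite lineE// in_cone.
  rewrite A_line; last by move=> j jZ; rewrite (ipC gP) b0bj.
  rewrite perp_line'// b0b0 mulr1.
  have -> : (A v + y / sigma <= 0) = (sigma * A v <= -1 * y).
    by rewrite -[RHS]subr_ge0 -(pmulr_rle0 _ sigma0) -[RHS]oppr_le0; congr (_ <= _); field; rewrite gt_eqF.
  by case: ifP => _; rewrite ?mulN1r /gauss_half ?sqrrN ?mul1r ?mul0r ?mulr0// mulrA.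
have mphi : measurable_fun setT (phi : T -> R) by exact: measurable_gauss_half.
have mf : measurable_fun setT (fun y : T => (if (sigma * A v <= y)%R then phi y else 0)%:E).
  have mb : measurable_fun setT (fun y : T => sigma * A v <= y) by exact: measurable_fun_ler.
  by apply/measurable_EFinP; exact: (measurable_fun_ifT mb mphi (measurable_cst (0 : R))).
have f0 (y : R) : (0 <= (if (sigma * A v <= y)%R then phi y else 0)%:E)%E.
  by rewrite lee_fin; case: ifP => // _; exact: gauss_half_ge0.
rewrite ge0_integralZl//; last 2 first.
- have mN : measurable_fun setT (fun y : T => -1 * y) by exact: measurable_funM.
  exact: (measurableT_comp mf mN).
- by rewrite lee_fin mulr_ge0 ?expR_ge0// exprn_ge0.
have n1 : (-1 : R) != 0 by rewrite oppr_eq0 oner_eq0.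
rewrite (ge0_integral_scale n1 mf f0) normrN1 invr1 mul1e.
have := gil_pelaez_base (ltW sigma0) A0.
rewrite integral_mkcond => E.
have -> : (\int[mu]_y (if (sigma * A v <= y)%R then phi y else 0)%:E =
    (s2 * gil_pelaez sigma 0 (A v))%:E)%E.
  rewrite -E; apply: eq_integral => y _; rewrite patchE mem_setE in_itv/= andbT.
  by case: ifP.
by rewrite -EFinM exprS; congr EFin; ring.
Qed.

(** The axis is integrated before the sides: [A v] collects the sides that are still fixed, and
    moving along [bj j] adds [|y|] to it, which is the shift in [gil_pelaez_step]. *)
Let int_side js v : uniq js -> {subset js <= Z} -> g b0 v = 0 ->
  (forall w, w \in o2 -> g w v = 0) -> (forall j, j \in js -> g (bj j) v = 0) ->
  iter_int (map bj js ++ b0 :: o2) F v =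
  (s2 ^+ (size js + (size o2).+1) * Q v * gil_pelaez sigma (size js) (A v))%:E.
Proof.
elim: js v => [|j js IH] v; first by move=> _ _ b0v ov _; exact: int_axis.
move=> /andP[jjs ujs] sub b0v ov jv; rewrite map_cons cat_cons.
rewrite [LHS]/=.
have jZ : j \in Z by apply: sub; rewrite mem_head.
have jvj : g (bj j) v = 0 by rewrite jv// mem_head.
have [i1 E1] := gil_pelaez_step (ltW sigma0) (size js) (A v).
transitivity (\int[mu]_y ((s2 ^+ (size js + (size o2).+1) * Q v)%:E *
    (gil_pelaez sigma (size js) (A v + `|y|) * phi y)%:E))%E.
  apply: eq_integral => y _; rewrite IH//.
  - rewrite -EFinM; congr EFin; rewrite A_line_side// lineE//; first by ring.
    by rewrite bjbj// eqxx.
  - by move=> i ijs; apply: sub; rewrite inE ijs orbT.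
  - by rewrite perp_line// b0bj.
  - by move=> w wo; rewrite perp_line ?ov// (ipC gP); have [_ ->] := o2P wo.
  - move=> i ijs; have iZ : i \in Z by apply: sub; rewrite inE ijs orbT.
    rewrite perp_line; first by rewrite jv// inE ijs orbT.
    by rewrite bjbj//; case: eqP => // ij; move: jjs; rewrite -ij ijs.
rewrite (integralZl measurableT i1) E1 -EFinM; congr EFin.
by rewrite addSn exprS; ring.
Qed.

Lemma solid_angle_sign_cone :
  solid_angle kappa x (sign_cone s) = gil_pelaez sigma #|[pred j | s 0 j == 0]| 0.
Proof.
have s20 := @sqrt2pi_gt0 R.
rewrite (@solid_angle_gauss _ _ kappa x _ _
   (s2 ^+ size (o2 ++ b0 :: map bj Z) * gil_pelaez sigma (size Z) 0) gP oo lin_hull_sign_cone).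
- by rewrite [X in X / _]mulrC mulfK ?expf_neq0 ?gt_eqF// -cardE.
- exact: borel_sign_cone.
- move=> k u k0 /sign_coneP Tu; apply/sign_coneP.
  have -> : \sum_(j <- Z) `|g (bj j) (k *: u)| + g b0 (k *: u) / sigma =
      k * (\sum_(j <- Z) `|g (bj j) u| + g b0 u / sigma).
    rewrite [g b0 (k *: u)](ipZr gP) [RHS]mulrDr mulr_sumr; congr (_ + _); last by rewrite mulrA.
    by apply: eq_bigr => j _; rewrite [g (bj j) (k *: u)](ipZr gP) normrM gtr0_norm.
  by rewrite pmulr_rle0.
(* The order used by [int_side]: sides outermost, then the axis, then the directions of the face. *)
have pe : perm_eq (o2 ++ b0 :: map bj Z) (map bj Z ++ b0 :: o2).
  rewrite perm_sym perm_catC /=.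
  exact: (permEl (perm_catCA [:: b0] o2 (map bj Z))).
rewrite (iter_int_perm _ _ _ pe).
- rewrite int_side ?enum_uniq//.
  + rewrite /A big_seq big1 => [|j _]; last by rewrite (ip0r gP) normr0.
    rewrite /Q (ip0l gP) mul0r oppr0 expR0 mulr1; congr (_ ^+ _ * _)%:E.
    by rewrite size_cat /= size_map addnC addSn addnS.
  + by rewrite (ip0r gP).
  + by move=> w _; rewrite (ip0r gP).
  + by move=> j _; rewrite (ip0r gP).
- move=> disp X h mh; apply/measurable_EFinP; apply: measurable_funM.
    exact/measurable_EFinP/borel_sign_cone.
  exact/measurable_EFinP/(borel_gauss gP).
- by move=> u; rewrite lee_fin mulr_ge0 ?expR_ge0// indicE ler0n.
Qed.

(** For [t >= 0], the integral of [phi] over [[- sigma * t, sigma * t]]: the contribution of one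
    side at axis coordinate [t]. *)
Let kk t := s2 * (2 * complex.Re (Phi (sigma * t)%:C%C) - 1).
Let Fp u := (\1_(polar_cone g (sign_cone s)) u * Q u)%:E.

Let in_polar v : \1_(polar_cone g (sign_cone s)) v = (cond v)%:R :> R.
Proof. by rewrite indicE; congr ((_ : bool)%:R); apply/idP/idP; rewrite inE => /polar_sign_coneP. Qed.

Let cond_side j v y : j \in Z -> g (bj j) v = 0 ->
  cond (v + y *: bj j) = cond v && (`|y| <= sigma * g b0 v).
Proof.
move=> jZ jv; rewrite /cond.
have E0 : g b0 (v + y *: bj j) = g b0 v by rewrite perp_line// b0bj.
rewrite E0 -!andbA.
have -> : all (fun w => g w (v + y *: bj j) == 0) o2 = all (fun w => g w v == 0) o2.
  by apply: eq_in_all => w wo; rewrite perp_line// (ipC gP); have [_ ->] := o2P wo.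
case: (all _ o2) => //=; case: (boolP (0 <= g b0 v)) => //= b0v.
apply/allP/andP => [h|[/allP h yv] i iZ].
  split; last by have := h _ jZ; rewrite perp_line'// bjbj// eqxx mulr1.
  apply/allP => i iZ; have [->|ij] := eqVneq i j.
    by rewrite jv normr0 mulr_ge0// ltW.
  by have := h _ iZ; rewrite perp_line// bjbj// (negbTE ij).
have [->|ij] := eqVneq i j; first by rewrite perp_line'// bjbj// eqxx mulr1.
by rewrite perp_line; [exact: h|rewrite bjbj// (negbTE ij)].
Qed.

(** In the polar cone the sides constrain each other only through the axis coordinate, so the axis
    is kept outermost and the integral over the sides factors into equal ones. *)
Let int_polar_side js v : uniq js -> {subset js <= Z} ->
  (forall j, j \in js -> g (bj j) v = 0) ->
  iter_int (map bj js) Fp v = ((cond v)%:R * Q v * kk (g b0 v) ^+ size js)%:E.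
Proof.
elim: js v => [|j js IH] v; first by move=> _ _ _; rewrite /= /Fp in_polar mulr1.
move=> /andP[jjs ujs] sub jv; rewrite map_cons [LHS]/=.
have jZ : j \in Z by apply: sub; rewrite mem_head.
have jvj : g (bj j) v = 0 by rewrite jv// mem_head.
transitivity (\int[mu]_y (((cond v)%:R * Q v * kk (g b0 v) ^+ size js)%:E *
    (if (`|y| <= sigma * g b0 v)%R then phi y else 0)%:E))%E.
  apply: eq_integral => y _; rewrite IH//.
  - rewrite cond_side// lineE//; last by rewrite bjbj// eqxx.
    rewrite [g b0 (v + _)]perp_line ?b0bj// -EFinM; congr EFin.
    by case: (cond v); case: (_ <= sigma * g b0 v) => /=; ring.
  - by move=> i ijs; apply: sub; rewrite inE ijs orbT.
  - move=> i ijs; have iZ : i \in Z by apply: sub; rewrite inE ijs orbT.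
    rewrite perp_line; first by rewrite jv// inE ijs orbT.
    by rewrite bjbj//; case: eqP => // ij; move: jjs; rewrite -ij ijs.
have [cv|_] := boolP (cond v); last first.
  by under eq_integral do rewrite mul0r mul0r mul0e; rewrite integral0 !mul0r.
have b0v : 0 <= sigma * g b0 v by move: cv => /and3P[_ h _]; rewrite mulr_ge0// ltW.
have mphi : measurable_fun setT (phi : T -> R) by exact: measurable_gauss_half.
have mb : measurable_fun setT (fun y : T => `|y| <= sigma * g b0 v).
  by apply: measurable_fun_ler => //; exact: normr_measurable.
have fi : mu.-integrable setT (fun y : T => (if `|y| <= sigma * g b0 v then phi y else 0)%:E).
  apply: (le_integrable measurableT _ _ (@integrable_gauss_half R)).
    by apply/measurable_EFinP; exact: (measurable_fun_ifT mb mphi (measurable_cst (0 : R))).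
  by move=> y _ /=; rewrite lee_fin; case: ifP => // _; rewrite normr0.
rewrite (integralZl measurableT fi) (integral_gauss_interval b0v) -EFinM; congr EFin.
by rewrite exprS /kk; ring.
Qed.

Lemma solid_angle_polar_cone (a : R) :
  (\int[mu]_t (if (0 <= t)%R then
     phi t * (s2 * (2 * complex.Re (Phi (sigma * t)%:C%C) - 1)) ^+ #|[pred j | s 0 j == 0]|
     else 0)%:E = a%:E)%E ->
  solid_angle kappa x (polar_cone g (sign_cone s)) = a / s2 ^+ #|[pred j | s 0 j == 0]|.+1.
Proof.
move=> Ea.
rewrite (@solid_angle_gauss _ _ kappa x _ _ a gP orthonormal_cone lin_hull_polar_cone).
- by rewrite /= size_map -cardE.
- exact: borel_polar_cone.
- move=> k u k0 Tu w /Tu h; rewrite [X in X <= _](ipZl gP).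
  by rewrite mulr_ge0_le0// ltW.
rewrite -Ea [LHS]/=; apply: eq_integral => t _.
rewrite add0r int_polar_side ?enum_uniq//; last first.
  by move=> j jZ; rewrite [LHS](ipZr gP) (ipC gP) b0bj// mulr0.
have E0 : g b0 (t *: b0) = t by rewrite [LHS](ipZr gP) b0b0 mulr1.
have -> : cond (t *: b0) = (0 <= t).
  rewrite /cond E0; apply/and3P/idP => [[]//|t_ge0]; split=> //.
    by apply/allP => w wo; rewrite [g w _](ipZr gP) (ipC gP); have [-> _] := o2P wo; rewrite mulr0.
  apply/allP => j jZ; rewrite [g _ (t *: _)](ipZr gP) (ipC gP) b0bj// mulr0 normr0.
  by rewrite mulr_ge0// ltW.
have -> : Q (t *: b0) = phi t.
  by rewrite /Q [g _ _](ipZl gP) E0 -expr2.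
rewrite E0 -cardE; congr EFin; case: ifP => _; first by rewrite mul1r.
by rewrite !mul0r.
Qed.

End Cones.

(** * Faces of the crosspolytope *)

Section Crosspolytope.
Context {R : realType} {d : nat}.
Local Notation V := 'rV[R]_d.
Let dP : inner_product (@dotp R d) := inner_product_dotp.

Lemma small_scale (I : finType) (f : I -> R) : exists2 e : R, 0 < e & forall i, e * f i <= 1.
Proof.
have S0 : 0 <= \sum_i `|f i| by exact: sumr_ge0.
exists (1 + \sum_i `|f i|)^-1; first by rewrite invr_gt0 ltr_pwDl.
move=> i; rewrite mulrC ler_pdivrMr ?ltr_pwDl// mul1r (le_trans (ler_norm _))//.
rewrite (le_trans (_ : _ <= \sum_i `|f i|))//; last by rewrite lerDr.
by rewrite (bigD1 i)//= lerDl sumr_ge0.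
Qed.

Variable tau : R.
Hypothesis t0 : 0 < tau.

Lemma crosspolytopeE : (0 < d)%N ->
  crosspolytope d tau = [set y : V | \sum_i `|y 0 i| <= 1 / tau].
Proof.
move=> d0; apply/seteqP; split => y /=.
  move=> [w [w0 w1] ->].
  have E i : (\sum_p w p *: (((-1) ^+ p.2 / tau) *: (delta_mx 0 p.1 : V))) 0 i =
      \sum_p w p * ((-1) ^+ p.2 / tau * (i == p.1)%:R).
    by rewrite summxE; apply: eq_bigr => p _; rewrite !mxE eqxx.
  under eq_bigr do rewrite E.
  apply: (@le_trans _ _ (\sum_i \sum_p w p / tau * (i == p.1)%:R)).
    apply: ler_sum => i _; apply: le_trans (ler_norm_sum _ _ _) _.
    apply: ler_sum => p _; rewrite !normrM normr_sign normr_nat (ger0_norm (w0 p)).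
    by rewrite normfV (gtr0_norm t0) mul1r mulrA.
  rewrite exchange_big/= -[X in _ <= X / _]w1 mulr_suml; apply: ler_sum => p _.
  by rewrite (bigD1 p.1)//= eqxx mulr1 big1 ?addr0// => i /negbTE ->; rewrite mulr0.
move=> y1; pose e := 1 - tau * \sum_i `|y 0 i|.
have e0 : 0 <= e.
  by rewrite subr_ge0 mulrC -ler_pdivlMr.
have dn : (d%:R : R) != 0 by rewrite pnatr_eq0 -lt0n.
have tn : tau != 0 by rewrite gt_eqF.
(* The first summand is [tau] times the positive part of the coordinate when [p.2] is [false], and
   its negative part when [p.2] is [true]. The remaining mass [e] is spread evenly over all [2 * d]
   vertices, where opposite ones cancel. *)
exists (fun p : 'I_d * bool => tau * ((`|y 0 p.1| + (-1) ^+ p.2 * y 0 p.1) / 2) + e / (d%:R * 2)).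
  split => [p|].
    apply: addr_ge0; last by rewrite (divr_ge0 e0)// mulr_ge0 ?ler0n.
    apply: mulr_ge0; first exact: ltW.
    have := ler_norm ((-1) ^+ (~~ p.2) * y 0 p.1).
    by rewrite normrM normr_sign mul1r signrN mulNr; lra.
  rewrite -(pair_bigA _ (fun i (b : bool) => tau * ((`|y 0 i| + (-1) ^+ b * y 0 i) / 2) + e / (d%:R * 2)))/=.
  transitivity (\sum_i (tau * `|y 0 i| + e / d%:R)).
    by apply: eq_bigr => i _; rewrite big_bool/= expr1 expr0; field.
  rewrite big_split/= -mulr_sumr sumr_const card_ord -[X in _ + X = _]mulr_natr mulfVK//.
  by rewrite /e; ring.
apply/rowP => i; rewrite summxE.
rewrite -(pair_bigA _ (fun j (b : bool) => ((tau * ((`|y 0 j| + (-1) ^+ b * y 0 j) / 2) + e / (d%:R * 2))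
   *: (((-1) ^+ b / tau) *: (delta_mx 0 j : V))) 0 i))/=.
rewrite (bigD1 i)//= big_bool/= !mxE !eqxx big1 => [|j ji].
  by rewrite expr1 expr0/=; field; rewrite ?dn ?tn.
by rewrite big_bool/= !mxE eq_sym (negbTE ji) andbF !mulr0 addr0.
Qed.

Local Notation P := [set y : V | \sum_i `|y 0 i| <= 1 / tau].

Lemma crosspolytope_vertex (e : R) i : `|e| = 1 -> P ((e / tau) *: delta_mx 0 i).
Proof.
move=> e1 /=; rewrite (bigD1 i)//= big1 => [|j ji].
  by rewrite !mxE !eqxx mulr1 addr0 normrM e1 normfV gtr0_norm.
by rewrite !mxE (negbTE ji) andbF mulr0 normr0.
Qed.

Lemma affine_dim_crosspolytope : affine_dim P = d.
Proof.
rewrite /affine_dim /direction (@lin_hullP _ _ _ fullv).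
- by rewrite dimvf /dim/= mul1n.
- by move=> x _; exact: memvf.
move=> M HM; apply/subvP => u _; rewrite (row_sum_delta u).
apply: rpred_sum => i _; apply: rpredZ.
have -> : delta_mx 0 i = tau *: ((1 / tau) *: (delta_mx 0 i : V) - 0).
  by rewrite subr0 scalerA div1r mulfV ?scale1r// gt_eqF.
apply: rpredZ; apply: HM; exists ((1 / tau) *: delta_mx 0 i).
  by apply: crosspolytope_vertex; rewrite normr1.
exists 0 => //=; rewrite big1 ?divr_ge0 ?ltW// => j _.
by rewrite mxE normr0.
Qed.

(** Hoelder's inequality for the sup and sum norms, with its equality case: [y] is on the boundary,
    and wherever [y_i] is nonzero [a_i] has modulus [M] and the sign of [y_i]. *)
Lemma dotp_tight (a y : V) (M : R) : 0 < M -> (forall i, `|a 0 i| <= M) -> P y ->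
  dotp a y <= M / tau /\ (dotp a y = M / tau <->
    \sum_i `|y 0 i| = 1 / tau /\ forall i, a 0 i * y 0 i = M * `|y 0 i|).
Proof.
move=> M0 aM /= Py.
have le i : a 0 i * y 0 i <= M * `|y 0 i|.
  by rewrite (le_trans (ler_norm _))// normrM ler_wpM2r.
have le2 : dotp a y <= M * \sum_i `|y 0 i| by rewrite mulr_sumr ler_sum.
have le3 : M * \sum_i `|y 0 i| <= M / tau by rewrite ler_pM2l// -div1r.
split; first exact: le_trans le2 le3.
split => [E|[E1 E2]]; last first.
  by rewrite /dotp (eq_bigr _ (fun i _ => E2 i)) -mulr_sumr E1 div1r.
have E1 : M * \sum_i `|y 0 i| = M / tau.
  by apply/eqP; rewrite eq_le le3 -E le2.
split; first by apply: (mulfI (lt0r_neq0 M0)); rewrite E1 div1r.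
move=> i; apply/eqP; rewrite eq_sym -subr_eq0; apply/eqP.
have S : \sum_i (M * `|y 0 i| - a 0 i * y 0 i) = 0.
  by rewrite sumrB -mulr_sumr E1 -E; exact: subrr.
by apply: (psumr_eq0P _ S) => // j _; rewrite subr_ge0.
Qed.

Definition sign_vector (s : V) := forall i, s 0 i != 0 -> s 0 i ^+ 2 = 1.

Lemma sign_vector_norm s i : sign_vector s -> `|s 0 i| = (s 0 i != 0)%:R.
Proof.
move=> sP; have [->|si] := eqVneq (s 0 i) 0; first by rewrite normr0.
by apply/eqP; rewrite -(eqrXn2 (n := 2))// real_normK ?num_real// sP// expr1n.
Qed.

Definition cross_face (s : V) := P `&` [set y : V | dotp s y = 1 / tau].

Lemma cross_faceP s y : sign_vector s -> cross_face s y <->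
  \sum_i `|y 0 i| = 1 / tau /\ forall i, s 0 i * y 0 i = `|y 0 i|.
Proof.
move=> sP; have s1 i : `|s 0 i| <= 1 by rewrite sign_vector_norm// lern1 leq_b1.
split => [[Py sy]|[E1 E2]].
  have [_ [/(_ sy)[E1 E2] _]] := dotp_tight ltr01 s1 Py.
  by split => // i; rewrite E2 mul1r.
split; first by rewrite /= E1.
by rewrite /= -E1; exact: eq_bigr.
Qed.

(** Let [M] be the sup norm of a supporting functional [a]. Its maximum [M / tau] is attained
    exactly in the equality case of [dotp_tight], which depends only on the signs of the coordinates
    with [|a_i| = M]; these signs form [s]. The bound on the dimension excludes [a = 0]. *)
Lemma face_crosspolytope F : is_face P F -> (affine_dim F < d)%N ->
  exists s, [/\ sign_vector s, exists i, s 0 i != 0 & F = cross_face s].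
Proof.
move=> [[y0 Fy0] [a [b [ab FE]]]] dF.
have [a0|a0] := pselect (a = 0).
  exfalso; move: dF; have -> : F = P; last by rewrite affine_dim_crosspolytope ltnn.
  rewrite FE; apply/seteqP; split => [y []//|y Py]; split => //=.
  by move: Fy0; rewrite FE a0 => -[_ /= <-]; rewrite !(ip0l dP).
have [i1 ai1] : exists i, a 0 i != 0.
  apply: contra_notP a0 => /forallNP h; apply/rowP => i.
  by rewrite mxE; apply/eqP/negPn/negP/h.
have [i0 _ imax] : extremum_spec >=%R xpredT (fun i => `|a 0 i|) [arg max_(i > i1) `|a 0 i|]%O.
  exact: Order.TotalTheory.arg_maxP.
set M := `|a 0 i0| in imax.
have aM i : `|a 0 i| <= M by exact: imax.
have M0 : 0 < M by rewrite (lt_le_trans _ (aM i1))// normr_gt0.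
have bM : b = M / tau.
  move: Fy0; rewrite FE => -[Py0 /= by0].
  apply/eqP; rewrite eq_le; apply/andP; split.
    by rewrite -by0; exact: (dotp_tight M0 aM Py0).1.
  have a00 : a 0 i0 != 0 by rewrite -normr_gt0.
  (* The vertex in the direction of a largest coordinate of [a] attains [M / tau]. *)
  have /ab : P ((Num.sg (a 0 i0) / tau) *: delta_mx 0 i0).
    by apply: crosspolytope_vertex; rewrite normr_sg a00.
  by rewrite (ipZr dP) (ipC dP) dotp_delta mulrAC -normrEsg.
pose s : V := \row_i (if `|a 0 i| == M then Num.sg (a 0 i) else 0).
have sP : sign_vector s.
  move=> i; rewrite mxE; case: ifP; rewrite ?eqxx// sgr_eq0 => _ ai.
  by rewrite sqr_sg ai.
exists s; split => //.
  by exists i0; rewrite mxE eqxx sgr_eq0 -normr_gt0.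
rewrite FE; apply/seteqP; split => y.
  move=> [Py /= ay]; apply/(cross_faceP _ sP).
  have [_ [/(_ _)[]]] := dotp_tight M0 aM Py; first by rewrite ay.
  move=> E1 E2 _; split => // i; rewrite mxE; case: ifPn => aiM.
    apply: (mulfI (lt0r_neq0 M0)); rewrite -E2 [in RHS](numEsg (a 0 i)) (eqP aiM).
    by rewrite mulrCA mulrA.
  have aiM' : `|a 0 i| < M by rewrite lt_neqAle aiM aM.
  rewrite mul0r; apply/esym/eqP; rewrite eq_le normr_ge0 andbT leNgt; apply/negP => y0'.
  have := ler_norm (a 0 i * y 0 i); rewrite normrM E2 ler_pM2r// => h.
  by move: (le_lt_trans h aiM'); rewrite ltxx.
move=> sy; have [Py _] := sy; move/(cross_faceP _ sP): sy => [E1 E2]; split => //=.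
rewrite bM; apply/(dotp_tight M0 aM Py).2; split => // i.
rewrite -E2 mxE; case: ifPn => aiM; last first.
  have := E2 i; rewrite mxE (negbTE aiM) mul0r => /esym/eqP; rewrite normr_eq0 => /eqP ->.
  by rewrite !mulr0.
by rewrite [in LHS](numEsg (a 0 i)) (eqP aiM) mulrCA mulrA.
Qed.

End Crosspolytope.

Section CrosspolytopeFace.
Context {R : realType} {d : nat}.
Local Notation V := 'rV[R]_d.
Let dP : inner_product (@dotp R d) := inner_product_dotp.
Variables (tau : R) (s : V).
Hypotheses (t0 : 0 < tau) (sP : sign_vector s) (sn0 : exists i, s 0 i != 0).
Local Notation N := #|[pred i | s 0 i != 0]|.
Local Notation P := [set y : V | \sum_i `|y 0 i| <= 1 / tau].
Local Notation F := (cross_face tau s).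

Lemma sign_card_gt0 : (0 < N)%N.
Proof. by apply/card_gt0P; have [i si] := sn0; exists i. Qed.
Let N0 : 0 < N%:R :> R. Proof. by rewrite ltr0n sign_card_gt0. Qed.

Definition barycentre : V := (tau * N%:R)^-1 *: s.
Local Notation z := barycentre.
Let tN : 0 < tau * N%:R. Proof. exact: mulr_gt0. Qed.

Lemma dotp_barycentre (u : V) : dotp u z = (tau * N%:R)^-1 * dotp u s.
Proof. exact: (ipZr dP). Qed.

Lemma dotp_segment (w u : V) e : dotp w (z + e *: u) = dotp w z + e * dotp w u.
Proof. by rewrite (ipDr dP) [X in _ + X](ipZr dP). Qed.

Lemma barycentre_sqr : dotp z z = 1 / (tau ^+ 2 * N%:R).
Proof.
by rewrite dotp_barycentre (ipC dP) dotp_barycentre dotp_sign//; field; rewrite !gt_eqF.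
Qed.

(** A perturbation of size at most [(tau * N)^-1], the common modulus of the nonzero coordinates of
    [z], cannot reverse their signs. *)
Lemma barycentre_near (u : V) : (forall j, s 0 j = 0 -> u 0 j = 0) -> dotp s u = 0 ->
  (forall i, `|u 0 i| <= (tau * N%:R)^-1) -> F (z + u).
Proof.
move=> uZ su u1.
have E i : s 0 i * (z + u) 0 i = `|(z + u) 0 i|.
  rewrite !mxE; have [si|si] := eqVneq (s 0 i) 0; first by rewrite si uZ// mul0r mulr0 addr0 normr0.
  have s1 : `|s 0 i| = 1 by rewrite sign_vector_norm// si.
  rewrite -[RHS]mul1r -s1 -normrM ger0_norm// mulrDr mulrCA -expr2 sP// mulr1.
  have := ler_norm (- (s 0 i * u 0 i)); rewrite normrN normrM s1 mul1r => h.
  by have := u1 i; lra.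
apply/(cross_faceP _ _ sP); split=> //; under eq_bigr do rewrite -E.
rewrite -[LHS]/(dotp s (z + u)) (ipDr dP) su addr0 dotp_barycentre dotp_sign//.
by field; rewrite !gt_eqF.
Qed.

Lemma barycentre_mem : F z.
Proof.
rewrite -[z]addr0; apply: barycentre_near => [j _||i]; rewrite ?mxE ?(ip0r dP)//.
by rewrite normr0 invr_ge0 ltW.
Qed.

Lemma cross_face_off y : F y -> forall j, s 0 j = 0 -> y 0 j = 0.
Proof.
move=> /(cross_faceP _ _ sP)[_ h] j sj; have := h j.
by rewrite sj mul0r => /esym/eqP; rewrite normr_eq0 => /eqP.
Qed.

Lemma cross_face_diff x y : F x -> F y ->
  (forall j, s 0 j = 0 -> (x - y) 0 j = 0) /\ dotp s (x - y) = 0.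
Proof.
move=> Fx Fy; split=> [j sj|].
  by rewrite !mxE (cross_face_off Fx sj) (cross_face_off Fy sj) subrr.
by rewrite (ipDr dP) (ipNr dP) Fx.2 Fy.2 subrr.
Qed.

Lemma barycentre_near_scale (u : V) : (forall j, s 0 j = 0 -> u 0 j = 0) -> dotp s u = 0 ->
  exists2 e : R, 0 < e & F (z + e *: u).
Proof.
move=> uZ su; have [e e0 he] := small_scale (fun i => `|u 0 i| * (tau * N%:R)).
exists e => //; apply: barycentre_near => [j /uZ uj||i].
- by rewrite mxE uj mulr0.
- by rewrite (ipZr dP) su mulr0.
- by rewrite mxE normrM gtr0_norm// -[leRHS]div1r ler_pdivlMr// -mulrA.
Qed.

Lemma direction_cross_face (L : {vspace V}) :
  (forall u, u \in L <-> (forall j, s 0 j = 0 -> u 0 j = 0) /\ dotp s u = 0) ->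
  direction F = L.
Proof.
move=> LP; apply: lin_hullP => [_ [x Fx [y Fy <-]]|M HM].
  by apply/LP/cross_face_diff.
apply/subvP => u /LP[uZ su]; have [e e0 Fe] := barycentre_near_scale uZ su.
have -> : u = e^-1 *: ((z + e *: u) - z).
  by rewrite addrC addKr scalerA mulVf ?scale1r// gt_eqF.
apply: rpredZ; apply: HM; exists (z + e *: u) => //.
by exists z => //; exact: barycentre_mem.
Qed.

(* At curvature [0] these vectors are orthonormal without any condition on [tau];
   this suffices for counting dimensions. *)
Local Notation cone_list := (cone_axis 0 tau z s :: map (cone_side 0 z) (enum [pred j | s 0 j == 0]))%R.

Let flat_basis : exists o2 : seq V, [/\ orthonormal (@klein_metric R d 0 z)
    (o2 ++ cone_list) & <<o2 ++ cone_list>>%VS = fullv].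
Proof.
have c0 : 0 < 1 + 0 * dotp z z by rewrite mul0r addr0.
have Fz := barycentre_mem.
have m0 : 0 < N%:R * tau ^+ 2 + 0 by rewrite addr0 mulr_gt0// exprn_gt0.
have oc := orthonormal_cone c0 t0 sP Fz.2 (cross_face_off Fz) m0.
have [r [oo full]] := orthonormal_extend (inner_product_klein c0) oc.
by exists r.
Qed.

Lemma mem_direction_cross_face u : u \in direction F <->
  (forall j, s 0 j = 0 -> u 0 j = 0) /\ dotp s u = 0.
Proof.
have c0 : 0 < 1 + 0 * dotp z z by rewrite mul0r addr0.
have m0 : 0 < N%:R * tau ^+ 2 + 0 by rewrite addr0 mulr_gt0// exprn_gt0.
have [r [oo full]] := flat_basis.
have pc := perp_cone_span c0 t0 m0 oo full.
by rewrite (direction_cross_face pc).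
Qed.

Lemma affine_dim_cross_face : (affine_dim F).+1 = N.
Proof.
have c0 : 0 < 1 + 0 * dotp z z by rewrite mul0r addr0.
have m0 : 0 < N%:R * tau ^+ 2 + 0 by rewrite addr0 mulr_gt0// exprn_gt0.
have [r [oo full]] := flat_basis.
have pc := perp_cone_span c0 t0 m0 oo full.
rewrite /affine_dim (direction_cross_face pc).
have fr : free r by have := orthonormal_free (inner_product_klein c0) oo; exact: catl_free.
rewrite (eqP fr).
have E1 := cone_size c0 oo full; have E2 := cone_card s.
by apply/eqP; rewrite -(eqn_add2r (size (enum [pred j | s 0 j == 0]))) addSn E1 E2.
Qed.

Lemma norm_le_enorm (u : V) i : `|u 0 i| <= enorm u.
Proof.
rewrite -(ler_pXn2r (n := 2))// ?nnegrE ?normr_ge0 ?sqrtr_ge0//.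
rewrite enorm_sqr real_normK ?num_real// /dotp (bigD1 i)//= -expr2 lerDl.
by apply: sumr_ge0 => j _; rewrite -expr2 sqr_ge0.
Qed.

Lemma relint_barycentre : relint F z.
Proof.
split; first exact: barycentre_mem.
exists (tau * N%:R)^-1; first by rewrite invr_gt0.
move=> y /mem_direction_cross_face[h1 h2] yz.
have -> : y = z + (y - z) by rewrite addrC subrK.
apply: barycentre_near => // i; apply: le_trans (norm_le_enorm _ _) (ltW yz).
Qed.

(** Both sides consist of the directions [u] along which a short step from the barycentre stays in
    [P]. On the left this is read off from the given inequalities, on the right from the sum of
    absolute values, so the cone is the same for every description. *)
Lemma tangent_cone_cross_face m (a : 'I_m -> V) (b : 'I_m -> R) :
  P = [set y | forall r, dotp (a r) y <= b r] -> tangent_cone a b F = sign_cone s.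
Proof.
move=> PE.
have PP y : P y <-> forall r, dotp (a r) y <= b r by rewrite PE.
have [Pz zs] := barycentre_mem.
have sz i : s 0 i != 0 -> s 0 i * z 0 i = (tau * N%:R)^-1.
  by move=> si; rewrite mxE mulrCA -expr2 sP// mulr1.
have z_off j : s 0 j = 0 -> z 0 j = 0 := cross_face_off barycentre_mem (j := j).
have off_sum (u : V) (e : R) : 0 < e -> \sum_(i | s 0 i == 0) `|(z + e *: u) 0 i| = e * \sum_(i | s 0 i == 0) `|u 0 i|.
  move=> e0; rewrite mulr_sumr; apply: eq_bigr => i /eqP si.
  by rewrite !mxE si mulr0 add0r normrM gtr0_norm.
have on_sum (u : V) : \sum_(i | s 0 i != 0) s 0 i * u 0 i = dotp s u.
  rewrite /dotp [RHS](bigID (fun i => s 0 i != 0))/= [X in _ = _ + X]big1 ?addr0// => i.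
  by rewrite negbK => /eqP ->; rewrite mul0r.
have zes (u : V) e : dotp s (z + e *: u) = 1 / tau + e * dotp s u.
  by rewrite dotp_segment -zs.
apply/seteqP; split => u.
  move=> Tu.
  have slack r : exists c : R, forall e, 0 < e -> e * c <= 1 -> dotp (a r) (z + e *: u) <= b r.
    have [Fr|] := pselect (forall y, F y -> dotp (a r) y = b r).
      exists 0 => e e0 _; rewrite dotp_segment (Fr z barycentre_mem) gerDl.
      by rewrite pmulr_rle0//; exact: Tu.
    move=> /existsNP[y /not_implyP[Fy /eqP ay]].
    have ay' : dotp (a r) y < b r by rewrite lt_neqAle ay; apply: (PP y).1 => //; have [] := Fy.
    (* An inequality strict at [y] is strict at [z]: the segment from [y] to [z] extends beyond [z]
       inside [F]. *)
    have az : dotp (a r) z < b r.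
      have [h1 h2] := cross_face_diff barycentre_mem Fy.
      have [e e0 [/PP/(_ r) + _]] := barycentre_near_scale h1 h2.
      rewrite dotp_segment (ipDr dP) (ipNr dP) => h.
      have : e * (dotp (a r) z - dotp (a r) y) <= b r - dotp (a r) z by rewrite lerBrDl.
      rewrite ltNge; apply: contraTN => h3; rewrite -ltNge.
      have h4 : 0 < e * (dotp (a r) z - dotp (a r) y) by rewrite mulr_gt0// subr_gt0 (lt_le_trans ay').
      by rewrite (le_lt_trans _ h4)// subr_le0.
    exists (dotp (a r) u / (b r - dotp (a r) z)) => e e0.
    by rewrite mulrA ler_pdivrMr ?subr_gt0// mul1r dotp_segment lerBrDl.
  have [c hc] := choice slack.
  have [e e0 he] := small_scale c.
  have : P (z + e *: u) by apply/PP => r; exact: hc.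
  rewrite /= (bigID (fun i => s 0 i == 0))/= off_sum// => h.
  have : dotp s (z + e *: u) <= \sum_(i | s 0 i != 0) `|(z + e *: u) 0 i|.
    rewrite -on_sum; apply: ler_sum => i si; apply: le_trans (ler_norm _) _.
    by rewrite normrM sign_vector_norm// si mul1r.
  rewrite zes => h2; rewrite /sign_cone/= -(pmulr_rle0 _ e0) mulrDr; lra.
rewrite /sign_cone/= => Tu r Fr.
have [e e0 he] := small_scale (fun i => `|u 0 i| * (tau * N%:R)).
(* The step is short enough not to reverse signs on the support of [s], so there the absolute values
   add up to a linear function. *)
have : P (z + e *: u).
  rewrite /= (bigID (fun i => s 0 i == 0))/= off_sum//.
  rewrite [X in _ + X](eq_bigr (fun i => s 0 i * (z + e *: u) 0 i)); last first.
    move=> i si; have s1 : `|s 0 i| = 1 by rewrite sign_vector_norm// si.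
    rewrite -[LHS]mul1r -s1 -normrM ger0_norm//.
    rewrite [(z + _) 0 i]mxE mulrDr sz// [(e *: u) 0 i]mxE.
    have := ler_norm (- (s 0 i * (e * u 0 i))); rewrite normrN normrM s1 mul1r normrM (gtr0_norm e0) => h.
    have : e * `|u 0 i| <= (tau * N%:R)^-1 by rewrite -[leRHS]div1r ler_pdivlMr// -mulrA.
    by move: h; lra.
  rewrite on_sum zes addrCA gerDl -mulrDr pmulr_rle0//; lra.
move/PP/(_ r); rewrite dotp_segment (Fr z barycentre_mem) gerDl.
by rewrite pmulr_rle0.
Qed.

End CrosspolytopeFace.

Section Description.
Context {R : realType} {d : nat}.
Local Notation V := 'rV[R]_d.
Variable tau : R.
Hypotheses (t0 : 0 < tau) (d2 : (2 <= d)%N).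
Local Notation P := [set y : V | \sum_i `|y 0 i| <= 1 / tau].

(* The inequality given by the sign vector [e] is violated at
   [((d - 1) * tau)^-1 *: e]; the others hold there, as two distinct sign vectors
   have inner product at most [d - 2]. *)
Lemma crosspolytope_irredundant : exists m (a : 'I_m -> V) b, irredundant_description P a b.
Proof.
pose eps (e : {ffun 'I_d -> bool}) : V := \row_i (-1) ^+ e i.
have d0 : (0 < d)%N by exact: leq_trans d2.
exists #|{ffun 'I_d -> bool}|, (fun r => eps (enum_val r)), (fun=> 1 / tau).
have d1 : 0 < d%:R - 1 :> R by rewrite subr_gt0 ltr1n.
split.
- exact: affine_dim_crosspolytope.
- apply/seteqP; split => y /= h.
    move=> r; apply: le_trans h; apply: ler_sum => i _; rewrite mxE (le_trans (ler_norm _))//.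
    by rewrite normrM normr_sign mul1r.
  have := h (enum_rank [ffun i => y 0 i < 0]); rewrite enum_rankK.
  congr (_ <= _); apply: eq_bigr => i _; rewrite mxE ffunE.
  have [yi|yi] := ltP (y 0 i) 0; first by rewrite mulN1r ltr0_norm.
  by rewrite mul1r ger0_norm.
- move=> r /rowP/(_ (Ordinal d0)); rewrite !mxE => /eqP.
  by rewrite signr_eq0.
- move=> r; pose c : R := 1 / ((d%:R - 1) * tau).
  have c0 : 0 < c by rewrite divr_gt0// mulr_gt0.
  have cE : c * (d%:R - 1) = 1 / tau by rewrite /c; field; rewrite !gt_eqF.
  exists (c *: eps (enum_val r)) => [q qr|].
    rewrite (ipZr inner_product_dotp) -cE ler_pM2l//.
    have [i hi] : exists i, enum_val q i != enum_val r i.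
      apply/existsP; apply: contra_notT qr => /existsPn h; apply: enum_val_inj.
      by apply/ffunP => i; apply/eqP/negPn/h.
    rewrite /dotp (bigD1 i)//= !mxE -signr_addb.
    have -> : enum_val q i (+) enum_val r i = true by move: hi; case: (enum_val q i); case: (enum_val r i).
    apply: (@le_trans _ _ (-1 + \sum_(j < d | j != i) 1)).
      rewrite expr1 lerD2l ler_sum// => j _; rewrite !mxE -signr_addb.
      by rewrite (le_trans (ler_norm _))// normr_sign.
    rewrite sumr_const cardC1 card_ord -subn1 natrB//; lra.
  rewrite (ipZr inner_product_dotp) -cE ltr_pM2l//.
  have -> : dotp (eps (enum_val r)) (eps (enum_val r)) = d%:R.
    rewrite /dotp (eq_bigr (fun=> 1)) => [|i _]; first by rewrite sumr_const card_ord.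
    by rewrite !mxE -expr2 sqrr_sign.
  by rewrite gtrBl.
Qed.

End Description.

(** * Angles of the crosspolytope *)

Section FaceAngles.
Context {R : realType} {d : nat}.
Local Notation V := 'rV[R]_d.
Let dP : inner_product (@dotp R d) := inner_product_dotp.
Variables (kappa tau : R) (s : V).
Hypotheses (t0 : 0 < tau) (d2 : (2 <= d)%N) (sP : sign_vector s) (sn0 : exists i, s 0 i != 0).
Local Notation N := #|[pred i | s 0 i != 0]|.
Local Notation P := [set y : V | \sum_i `|y 0 i| <= 1 / tau].
Local Notation F := (cross_face tau s).
Local Notation z := (barycentre tau s).
Hypothesis m0 : 0 < N%:R * tau ^+ 2 + kappa.

(** The squared distance of the barycentre from the origin is [1 / (N * tau ^ 2)], so [m0] places it
    in the ball. For the ideal crosspolytope [m0] amounts to [N >= 2], that is to faces of positive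
    dimension. *)
Lemma barycentre_ball : klein_ball kappa z.
Proof.
rewrite /klein_ball; case: ifPn => [//|]; rewrite -ltNge => k0 /=.
have k0' : 0 < - kappa by rewrite oppr_gt0.
rewrite -(ltr_pXn2r (n := 2))// ?nnegrE ?sqrtr_ge0 ?divr_ge0 ?sqrtr_ge0//.
rewrite enorm_sqr barycentre_sqr// div1r [ltRHS]expr_div_n expr1n div1r sqr_sqrtr ?ltW//.
rewrite ltf_pV2 ?posrE// ?mulr_gt0 ?exprn_gt0 ?ltr0n ?sign_card_gt0//.
by move: m0; lra.
Qed.

Let solid_angles x : F x -> klein_ball kappa x ->
  solid_angle kappa x (sign_cone s) = gil_pelaez (cone_sigma kappa tau s) #|[pred j | s 0 j == 0]| 0
  /\ forall a : R,
  (\int[lebesgue_measure]_t (if (0 <= t)%R then gauss_half t * (Num.sqrt (2 * pi) *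
     (2 * complex.Re (Phi (cone_sigma kappa tau s * t)%:C%C) - 1)) ^+ #|[pred j | (s 0 j)%R == 0]| else 0)%:E =
   a%:E)%E ->
  solid_angle kappa x (polar_cone (klein_metric kappa x) (sign_cone s)) =
  a / Num.sqrt (2 * pi) ^+ #|[pred j | s 0 j == 0]|.+1.
Proof.
move=> Fx /klein_ball_gt0 c0; have xs := Fx.2; have xZ := cross_face_off sP Fx.
have oc := orthonormal_cone c0 t0 sP xs xZ m0.
have [r [oo full]] := orthonormal_extend (inner_product_klein c0) oc.
split; first exact: (solid_angle_sign_cone c0 t0 sP xs xZ m0 oo full).
by move=> a; exact: (solid_angle_polar_cone c0 t0 sP xs xZ m0 oo full).
Qed.

(** Every admissible description and point give the same value, and at least one choice exists, so
    the value picked by [xget] is determined. *)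
Lemma internal_angle_cross_face :
  internal_angle kappa F P = gil_pelaez (cone_sigma kappa tau s) #|[pred j | s 0 j == 0]| 0.
Proof.
have val m (a : 'I_m -> V) b x : irredundant_description P a b ->
    (relint F `&` klein_ball kappa) x -> solid_angle kappa x (tangent_cone a b F) =
    gil_pelaez (cone_sigma kappa tau s) #|[pred j | s 0 j == 0]| 0.
  move=> [_ PE _ _] [[Fx _] bx]; rewrite (tangent_cone_cross_face t0 sP sn0 PE).
  exact: (solid_angles Fx bx).1.
have [m [a [b ab]]] := crosspolytope_irredundant t0 d2.
have zF : (relint F `&` klein_ball kappa) z.
  by split; [exact: relint_barycentre|exact: barycentre_ball].
apply: xget_unique; first by exists m, a, b, z; split => //; rewrite (val _ _ _ _ ab zF).
by move=> t [m' [a' [b' [x [ab' Fx ->]]]]]; exact: val.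
Qed.

Lemma external_angle_cross_face (v : R) :
  (\int[lebesgue_measure]_t (if (0 <= t)%R then gauss_half t * (Num.sqrt (2 * pi) *
     (2 * complex.Re (Phi (cone_sigma kappa tau s * t)%:C%C) - 1)) ^+ #|[pred j | (s 0 j)%R == 0]| else 0)%:E =
   v%:E)%E ->
  external_angle kappa F P = v / Num.sqrt (2 * pi) ^+ #|[pred j | s 0 j == 0]|.+1.
Proof.
move=> vE.
have val m (a : 'I_m -> V) b x : irredundant_description P a b ->
    (relint F `&` klein_ball kappa) x -> solid_angle kappa x (normal_cone kappa x a b F) =
    v / Num.sqrt (2 * pi) ^+ #|[pred j | s 0 j == 0]|.+1.
  move=> [_ PE _ _] [[Fx _] bx].
  rewrite /normal_cone (tangent_cone_cross_face t0 sP sn0 PE).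
  exact: ((solid_angles Fx bx).2 _ vE).
have [m [a [b ab]]] := crosspolytope_irredundant t0 d2.
have zF : (relint F `&` klein_ball kappa) z.
  by split; [exact: relint_barycentre|exact: barycentre_ball].
apply: xget_unique; first by exists m, a, b, z; split => //; rewrite (val _ _ _ _ ab zF).
by move=> t [m' [a' [b' [x [ab' Fx ->]]]]]; exact: val.
Qed.

End FaceAngles.

(** * Edge length and the parameter [tau] *)

Section Edge.
Context {R : realType} {d : nat}.
Local Notation V := 'rV[R]_d.
Let dP : inner_product (@dotp R d) := inner_product_dotp.
Variable tau : R.
Hypothesis t0 : 0 < tau.
Local Notation P := [set y : V | \sum_i `|y 0 i| <= 1 / tau].
Local Notation vertex i := (tau^-1 *: (delta_mx 0 i : V)).

(** The segment is [cross_face] for the sign vector with entries [1] at [i] and [j] and [0]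
    elsewhere, hence cut out by a supporting hyperplane. *)
Lemma adjacent_vertices (i j : 'I_d) : i != j -> Defs.adjacent P (vertex i) (vertex j).
Proof.
move=> ij; split.
  move=> /rowP/(_ i); rewrite !mxE !eqxx (negbTE ij) andbF mulr1 mulr0 => /eqP.
  by rewrite invr_eq0 gt_eqF.
pose s : V := delta_mx 0 i + delta_mx 0 j.
have sE k : s 0 k = ((k == i) || (k == j))%:R.
  rewrite !mxE eqxx/=; have [->|] := eqVneq k i; last by rewrite add0r.
  by rewrite (negbTE ij) addr0.
have sP : sign_vector s by move=> k; rewrite sE; case: (_ || _); rewrite ?eqxx// expr1n.
have dotp_s y : dotp s y = y 0 i + y 0 j by rewrite (ipDl dP) !dotp_delta.
have tn : tau != 0 by rewrite gt_eqF.
suff -> : segment (vertex i) (vertex j) = cross_face tau s.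
  split; first by exists (barycentre tau s); apply: barycentre_mem => //; exists i; rewrite sE eqxx oner_eq0.
  exists s, (1 / tau); split => // y Py; apply: (dotp_tight ltr01 _ Py).1 => k.
  by rewrite sign_vector_norm// lern1 leq_b1.
apply/seteqP; split => [y [w [w0 w1] ->]|y].
  have w1' : w true + w false = 1 by rewrite -w1 big_bool.
  have yE k : (\sum_b w b *: (if b then vertex i else vertex j)) 0 k =
      (w true * (k == i)%:R + w false * (k == j)%:R) / tau.
    by rewrite big_bool/= !mxE eqxx/=; field.
  apply/(cross_faceP _ _ sP).
  have E k : s 0 k * (\sum_b w b *: (if b then vertex i else vertex j)) 0 k =
    `|(\sum_b w b *: (if b then vertex i else vertex j)) 0 k|.
    rewrite ger0_norm; last by rewrite yE divr_ge0 ?(ltW t0)// addr_ge0// mulr_ge0.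
    rewrite yE sE; case: (k == i); case: (k == j); rewrite /= ?mul1r//.
    by rewrite !mulr0 addr0 !mul0r.
  split => //; under eq_bigr do rewrite -E.
  rewrite -[LHS]/(dotp s _) dotp_s !yE !eqxx (negbTE ij) (eq_sym j i) (negbTE ij) -mulrDl.
  by congr (_ / _); rewrite !mulr1 !mulr0 addr0 add0r.
move=> Fy; have [_ /= ys] := Fy; have yz := cross_face_off sP Fy.
move/(cross_faceP _ _ sP): Fy => [_ h].
have yi : 0 <= y 0 i by have := h i; rewrite sE eqxx mul1r => ->.
have yj : 0 <= y 0 j by have := h j; rewrite sE eqxx orbT mul1r => ->.
exists (fun b : bool => tau * y 0 (if b then i else j)).
  split => [[]|]; rewrite ?mulr_ge0 ?(ltW t0)//.
  by rewrite big_bool/= -mulrDr -dotp_s ys mulrC divfK.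
apply/rowP => k; rewrite big_bool/= !mxE eqxx/=.
have [ki|ki] := eqVneq k i.
  by rewrite ki (negbTE ij) !mulr0 mulr1 addr0 mulrAC mulfV// mul1r.
have [kj|kj] := eqVneq k j; first by rewrite kj !mulr0 mulr1 add0r mulrAC mulfV// mul1r.
by rewrite !mulr0 addr0 yz// sE (negbTE ki) (negbTE kj).
Qed.

End Edge.

Section EdgeLength.
Context {R : realType}.

Lemma arcoshK (q : R) : 1 <= q -> (expR (arcosh q) + expR (- arcosh q)) / 2 = q.
Proof.
move=> q1; have q0 : 0 < q by exact: lt_le_trans q1.
have q21 : 0 <= q ^+ 2 - 1 by rewrite subr_ge0 expr_ge1// ltW.
have w0 : 0 <= Num.sqrt (q ^+ 2 - 1) by exact: sqrtr_ge0.
have p0 : 0 < q + Num.sqrt (q ^+ 2 - 1) by rewrite ltr_pwDl.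
rewrite expRN /arcosh lnK ?posrE//.
have -> : (q + Num.sqrt (q ^+ 2 - 1))^-1 = q - Num.sqrt (q ^+ 2 - 1).
  apply: (mulfI (lt0r_neq0 p0)); rewrite mulfV ?gt_eqF// mulrC -subr_sqr sqr_sqrtr//.
  by ring.
by field.
Qed.

(** A single edge suffices: two orthogonal vertices of squared norm [1 / tau ^ 2] give
    [q = tau ^ 2 / (tau ^ 2 + kappa)], and [Ckappa] inverts the distance function. The denominator
    is positive because a vertex lies in the ball. *)
Lemma Ckappa_edge (d : nat) (kappa ell tau : R) : (2 <= d)%N -> 0 < tau ->
  crosspolytope d tau `<=` klein_ball kappa ->
  (forall v w : 'rV[R]_d, Defs.adjacent (crosspolytope d tau) v w -> klein_dist kappa v w = ell) ->
  0 < tau ^+ 2 + kappa /\ Ckappa kappa ell = tau ^+ 2 / (tau ^+ 2 + kappa).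
Proof.
move=> d2 t0; have d0 : (0 < d)%N by exact: leq_trans d2.
have dP := @inner_product_dotp R d; have tn : tau != 0 by rewrite gt_eqF.
rewrite (crosspolytopeE t0 d0) => Pball Pdist.
pose i := Ordinal d0; pose j := Ordinal d2 : 'I_d.
pose v k : 'rV[R]_d := tau^-1 *: delta_mx 0 k.
have vv k : dotp (v k) (v k) = 1 / tau ^+ 2.
  by rewrite (ipZr dP) (ipZl dP) dotp_delta mxE !eqxx/= mulr1; field.
have vij : dotp (v i) (v j) = 0.
  by rewrite (ipZr dP) (ipZl dP) dotp_delta mxE !mulr0.
have m0 : 0 < tau ^+ 2 + kappa.
  have /Pball/klein_ball_gt0 : [set y : 'rV[R]_d | \sum_i `|y 0 i| <= 1 / tau] (v i).
    by have := crosspolytope_vertex t0 i (normr1 R); rewrite div1r.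
  rewrite vv => h; have : 0 < tau ^+ 2 * (1 + kappa * (1 / tau ^+ 2)) by rewrite mulr_gt0// exprn_gt0.
  by congr (0 < _); field.
have mn : tau ^+ 2 + kappa != 0 by rewrite gt_eqF.
split => //.
have := Pdist _ _ (@adjacent_vertices _ _ tau t0 i j isT).
rewrite /klein_dist -/(v i) -/(v j) vij !enorm_sqr !vv mulr0 addr0.
have c0 : 0 < 1 + kappa * (1 / tau ^+ 2).
  have -> : 1 + kappa * (1 / tau ^+ 2) = (tau ^+ 2 + kappa) / tau ^+ 2 by field.
  by rewrite divr_gt0// exprn_gt0.
rewrite -expr2 sqrtr_sqr (gtr0_norm c0).
have -> : 1 / (1 + kappa * (1 / tau ^+ 2)) = tau ^+ 2 / (tau ^+ 2 + kappa).
  have -> : 1 + kappa * (1 / tau ^+ 2) = (tau ^+ 2 + kappa) / tau ^+ 2 by field.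
  by field; rewrite mn tn.
set q := tau ^+ 2 / (tau ^+ 2 + kappa).
have t2 : 0 < tau ^+ 2 by exact: exprn_gt0.
rewrite /Ckappa; have [k0|k0|k0] := ltgtP kappa 0.
- have sk : 0 < Num.sqrt (- kappa) by rewrite sqrtr_gt0 oppr_gt0.
  move=> <-; rewrite mulrA mulfV ?gt_eqF// mul1r arcoshK// /q.
  by rewrite ler_pdivlMr// mul1r gerDl ltW.
- have sk : 0 < Num.sqrt kappa by rewrite sqrtr_gt0.
  move=> <-; rewrite mulrA mulfV ?gt_eqF// mul1r acosK// in_itv/=.
  rewrite (le_trans (lerN10 R))/=; last by rewrite divr_ge0 ?ltW.
  by rewrite ler_pdivrMr// mul1r lerDl ltW.
- by move=> _; rewrite /q k0 addr0 divff// gt_eqF.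
Qed.

End EdgeLength.

(** The rescaled parameter [sigma / sqrt (1 + n * sigma ^ 2)] of the internal angle. With
    [K = k + 1] and [n = d - k - 1] the sum [K + n] is [d]. *)
Lemma sqrt_ratio (R : realType) (t K n kappa : R) : 0 <= t -> 0 <= n -> 0 < K * t + kappa ->
  Num.sqrt (t / (K * t + kappa)) / Num.sqrt (1 + n * Num.sqrt (t / (K * t + kappa)) ^+ 2) =
  Num.sqrt (t / ((K + n) * t + kappa)).
Proof.
move=> t0 n0 A0; have B0 : 0 < (K + n) * t + kappa.
  by rewrite mulrDl addrAC ltr_pwDl// mulr_ge0.
have q0 : 0 <= t / (K * t + kappa) by rewrite divr_ge0 ?(ltW A0).
rewrite sqr_sqrtr//.
have -> : 1 + n * (t / (K * t + kappa)) = ((K + n) * t + kappa) / (K * t + kappa).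
  by field; rewrite gt_eqF.
rewrite -[X in _ * X]sqrtrV -?sqrtrM//; last by rewrite divr_ge0 ?ltW.
by congr Num.sqrt; field; rewrite !gt_eqF.
Qed.

(** * The formulas for regular and ideal crosspolytopes *)

Section ExpectationFormulas.
Context {R : realType} (d : nat) (kappa tau : R).
Context {disp : measure_display} {Omega : measurableType disp} {Pr : probability Omega R} {xi : {RV Pr >-> R}}.
Hypotheses (d2 : (2 <= d)%N) (t0 : 0 < tau).
Hypothesis hxi : forall A : set R, measurable A -> distribution Pr xi A = normal_prob 0 1 A.

(** Stated in terms of [tau] instead of [C], with positivity of a denominator in place of
    containment in the ball, so that the regular and the ideal crosspolytope are both instances. *)
Lemma face_angles (k : nat) (F : set 'rV[R]_d) : (k <= d - 1)%N ->
  0 < k.+1%:R * tau ^+ 2 + kappa ->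
  is_face (crosspolytope d tau) F -> affine_dim F = k ->
  ((external_angle kappa F (crosspolytope d tau))%:E =
    (1 / 2)%:E * 'E_Pr[fun w : Omega =>
      ((2 * complex.Re (Phi (Num.sqrt (tau ^+ 2 / (k.+1%:R * tau ^+ 2 + kappa)) * `|xi w|)%:C%C) - 1)
        ^+ (d - k - 1))%R])%E /\
  ((internal_angle kappa F (crosspolytope d tau))%:E =
    (1 / 2)%:E - (2 ^+ (d - k - 1) / Num.sqrt (2 * pi))%:E *
      'E_Pr[fun w : Omega => extend_at0 (fun x : R =>
        (1 / x * complex.Im
          (Phi ('i%C * (Num.sqrt (tau ^+ 2 / (d%:R * tau ^+ 2 + kappa)) * x)%:C%C)
             ^+ (d - k - 1)))%R) (xi w)])%E.
Proof.
have d0 : (0 < d)%N by exact: leq_trans d2.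
move=> kd A0; rewrite (crosspolytopeE t0 d0) => faceF dimF.
have kd' : (k < d)%N by move: kd; rewrite -ltnS subn1 prednK.
have [|s [sP sn0 FE]] := face_crosspolytope t0 faceF; first by rewrite dimF.
rewrite {faceF}FE in dimF *.
have NE : #|[pred i | s 0 i != 0]| = k.+1 by rewrite -(affine_dim_cross_face t0 sP sn0) dimF.
have ZE : #|[pred j | s 0 j == 0]| = (d - k - 1)%N.
  by have := cone_card s; rewrite NE -cardE -subnDA addn1 => h; rewrite -[X in (X - _)%N]h addKn.
have m0 : 0 < #|[pred i | s 0 i != 0]|%:R * tau ^+ 2 + kappa by rewrite NE.
have sE : cone_sigma kappa tau s = Num.sqrt (tau ^+ 2 / (k.+1%:R * tau ^+ 2 + kappa)).
  by rewrite /cone_sigma NE.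
have sigma0 := cone_sigma_gt0 t0 m0.
split.
  have [a [Ea Ea2]] := external_expectation hxi #|[pred j | s 0 j == 0]| sigma0.
  by rewrite (external_angle_cross_face t0 d2 sP sn0 m0 Ea) Ea2 ZE sE.
rewrite (internal_angle_cross_face t0 d2 sP sn0 m0) (internal_expectation hxi _ sigma0) ZE sE.
have dk : k.+1%:R + (d - k - 1)%:R = d%:R :> R.
  by rewrite -natrD -subnDA addn1 subnKC.
by rewrite (sqrt_ratio (sqr_ge0 tau) (ler0n R _) A0) dk.
Qed.

End ExpectationFormulas.

Theorem theorem1p3 (R : realType) (d : nat) (kappa : R) (hd : (2 <= d)%N)
  (disp : measure_display) (Omega : measurableType disp)
  (Pr : probability Omega R) (xi : {RV Pr >-> R})
  (hxi : forall A : set R, measurable A ->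
     distribution Pr xi A = normal_prob 0 1 A) :
  (forall (k : nat) (ell : R) (P F : set 'rV[R]_d),
     (k <= d - 1)%N -> 0 < ell ->
     is_regular_crosspolytope kappa ell P ->
     is_face P F -> affine_dim F = k ->
     let C := Ckappa kappa ell in
     ((external_angle kappa F P)%:E =
       (1 / 2)%:E * 'E_Pr[fun w : Omega =>
         ((2 * complex.Re (Phi (Num.sqrt (C / (1 + k%:R * C)) * `|xi w|)%:C%C) - 1)
           ^+ (d - k - 1))%R])%E
     /\
     ((internal_angle kappa F P)%:E =
       (1 / 2)%:E - (2 ^+ (d - k - 1) / Num.sqrt (2 * pi))%:E *
         'E_Pr[fun w : Omega => extend_at0 (fun x : R =>
           (1 / x * complex.Im
             (Phi ('i%C * (Num.sqrt (C / (1 + (d - 1)%:R * C)) * x)%:C%C)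
                ^+ (d - k - 1)))%R) (xi w)])%E)
  /\
  (kappa < 0 ->
   forall (k : nat) (F : set 'rV[R]_d),
     (1 <= k <= d - 1)%N ->
     is_face (ideal_crosspolytope d kappa) F -> affine_dim F = k ->
     ((external_angle kappa F (ideal_crosspolytope d kappa))%:E =
       (1 / 2)%:E * 'E_Pr[fun w : Omega =>
         ((2 * complex.Re (Phi (Num.sqrt (1 / k%:R) * `|xi w|)%:C%C) - 1)
           ^+ (d - k - 1))%R])%E
     /\
     ((internal_angle kappa F (ideal_crosspolytope d kappa))%:E =
       (1 / 2)%:E - (2 ^+ (d - k - 1) / Num.sqrt (2 * pi))%:E *
         'E_Pr[fun w : Omega => extend_at0 (fun x : R =>
           (1 / x * complex.Im
             (Phi ('i%C * (Num.sqrt (1 / (d - 1)%:R) * x)%:C%C)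
                ^+ (d - k - 1)))%R) (xi w)])%E).
Proof.
have dE : d%:R = (d - 1)%:R + 1 :> R by rewrite natr1 subn1 prednK// ltnW.
split=> [k ell _ F kd _ [tau [t0 -> Pball Pdist]] faceF dimF /=|k0 k F /andP[k1 kd] faceF dimF].
  have [m0 CE] := Ckappa_edge hd t0 Pball Pdist.
  have t2 : 0 < tau ^+ 2 by exact: exprn_gt0.
  have A0 (m : nat) : 0 < (1 + m%:R) * tau ^+ 2 + kappa.
    by rewrite mulrDl mul1r addrAC ltr_pwDl// mulr_ge0 ?ler0n ?sqr_ge0.
  (* Translates [tau] back to [C]; [m = k] serves the external and [m = d - 1] the internal
     angle. *)
  have E (m : nat) : Ckappa kappa ell / (1 + m%:R * Ckappa kappa ell) =
      tau ^+ 2 / ((1 + m%:R) * tau ^+ 2 + kappa).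
    have := A0 m; rewrite CE => Am.
    have -> : 1 + m%:R * (tau ^+ 2 / (tau ^+ 2 + kappa)) =
      ((1 + m%:R) * tau ^+ 2 + kappa) / (tau ^+ 2 + kappa) by field; rewrite gt_eqF.
    by field; rewrite !gt_eqF.
  have := face_angles hd t0 hxi kd (kappa := kappa) _ faceF dimF.
  by rewrite !E -(natr1 k) dE [k%:R + 1]addrC [_%:R + 1]addrC; apply.
have s0 : 0 < Num.sqrt (- kappa) by rewrite sqrtr_gt0 oppr_gt0.
have ss : Num.sqrt (- kappa) ^+ 2 = - kappa by rewrite sqr_sqrtr// oppr_ge0 ltW.
have A0 (m : nat) : (m%:R + 1) * - kappa + kappa = m%:R * - kappa by ring.
(* With [tau ^ 2 = - kappa] the ratio is [1 / m] outright, which is the limit of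
   [C / (1 + m * C)]. *)
have E (m : nat) : (0 < m)%N -> (- kappa) / ((m%:R + 1) * - kappa + kappa) = 1 / m%:R.
  by move=> m1; rewrite A0; field; rewrite pnatr_eq0 -lt0n m1 lt_eqF.
have := face_angles hd s0 hxi kd (kappa := kappa) _ faceF dimF.
rewrite ss -(natr1 k) dE !E//; last by rewrite subn_gt0.
by apply; rewrite A0 mulr_gt0 ?oppr_gt0// ltr0n.
Qed.
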